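(* For any integer $S\ge 3$, $$\rho^{in}_S=\frac{1}{2S},$$ and the plane convex bodies $K\in\{S\}$ with maximal internal robustness with respect to their centers of gravity (that is, those with $\rho^{in}(K,G)=\rho^{in}_S$, $G$ being the center of gravity of $K$) are the regular $S$-gons.
   Context: A convex body is a compact convex set with nonempty interior. $\mathcal K_2$ denotes the family of convex bodies in $\mathbb R^2$ with piecewise smooth ($C^\infty$) boundary. Let $K\in\mathcal K_2$ and let $p\in\mathbb R^2$ be a reference point. A point $q\in\operatorname{bd}K$ is an equilibrium point of $K$ with respect to $p$ if the line through $q$ perpendicular to $q-p$ supports $K$ (at a smooth boundary point this means that $q$ is a critical point of $z\mapsto|z-p|$, $z\in\operatorname{bd}K$). The equilibrium point $q$ is nondegenerate if: when $\operatorname{bd}K$ is smooth at $q$, the second derivative of $z\mapsto|z-p|$, $z\in\operatorname{bd}K$, at $q$ is not zero; when $\operatorname{bd}K$ is not smooth at $q$, both angles between $p-q$ and the two one-sided tangent half lines of $\operatorname{bd}K$ at $q$ are acute. A nondegenerate equilibrium point at a smooth boundary point is stable (resp. unstable) if that second derivative is positive (resp. negative); a nondegenerate equilibrium point at a nonsmooth boundary point is unstable. If $p$ itself is a smooth point of $\operatorname{bd}K$, then $q=p$ is counted as a (nondegenerate) stable point; if $p$ is a nonsmooth point of $\operatorname{bd}K$, then $q=p$ is counted as a degenerate equilibrium point. Standing assumption: saying that $K$ has $S$ stable points with respect to a point includes that $K$ has only nondegenerate equilibrium points with respect to it. Let $p\in\operatorname{int}K$ and assume $K$ has $S$ stable points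 with respect to $p$. Let $R(K,p)\subseteq\mathbb R^2$ be the set of points of $\mathbb R^2$ (not necessarily in $K$) with respect to which $K$ has $S$ stable points. The internal robustness of $K$ with respect to $p$ is $$\rho^{in}(K,p)=\frac{\min\{|q-p|:q\notin R(K,p)\}}{\operatorname{perim}K},$$ where $\operatorname{perim}K$ is the perimeter of $K$. $\{S\}$ denotes the family of $K\in\mathcal K_2$ having $S$ stable points with respect to their own center of gravity (with uniform density), and $\rho^{in}_S=\sup\{\rho^{in}(K,G):K\in\{S\}\}$, where $G$ is the center of gravity of $K$. *)

(* Defs.v *)
From mathcomp Require Import all_boot all_order all_algebra.
From mathcomp Require Import all_classical all_reals all_analysis.

Set Implicit Arguments.
Unset Strict Implicit.
Unset Printing Implicit Defensive.

Import Order.TTheory GRing.Theory Num.Theory numFieldNormedType.Exports.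

Local Open Scope classical_set_scope.
Local Open Scope ring_scope.

Notation plane R := (R * R)%type.

Section Plane.
Variable R : realType.
Implicit Types u v z : plane R.

Definition dotp u v : R := u.1 * v.1 + u.2 * v.2.

(* The Euclidean norm; the norm [`| _ |] that the library puts on a product is
   the maximum norm. *)
Definition enorm v : R := Num.sqrt (dotp v v).

Definition angle u v : R := acos (dotp u v / (enorm u * enorm v)).

End Plane.

Section ConvexBodies.
Variable R : realType.
Implicit Types (K : set (plane R)) (p q : plane R) (c g : R -> plane R).

Definition convex_body K : Prop :=
  [/\ compact K, convex_set K & interior K !=set0].

Definition boundary K : set (plane R) := closure K `\` interior K.

Definition smooth_curve g : Prop := forall n t, derivable (derive1n n g) t 1.

(* [c], restricted to [0, 1], is a simple closed parametrization of the boundary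
   which, for some subdivision of [0, 1], coincides on each closed piece with a
   regular C^oo curve. Requiring the curve [g] to be defined and smooth on the
   whole line expresses smoothness of the piece up to its endpoints. *)
Definition boundary_parametrization K c : Prop :=
  [/\ c @` `[0, 1] = boundary K,
      c 0 = c 1,
      {in `[0, 1[ &, injective c}
    & exists (N : nat) (t : nat -> R),
        [/\ t 0%N = 0, t N = 1, (forall i, (i < N)%N -> t i < t i.+1)
          & forall i, (i < N)%N -> exists g,
              [/\ smooth_curve g,
                  {in `[t i, t i.+1], forall x, derive1 g x != 0}
                & {in `[t i, t i.+1], c =1 g}]]].

Definition piecewise_smooth_convex_body K : Prop :=
  convex_body K /\ exists c, boundary_parametrization K c.

(* The derivative has arbitrary values at the finitely many subdivision points;
   these do not affect the integral. *)
Definition arc_length c : R :=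
  (\int[lebesgue_measure]_(t in `[0, 1]) enorm (derive1 c t))%R.

(* The common length of all the parametrizations of the boundary. *)
Definition perimeter K : R :=
  get [set l | exists2 c, boundary_parametrization K c & l = arc_length c].

Local Notation plane_measure := (@lebesgue_measure R \x @lebesgue_measure R)%E.

Definition area K : R := fine (plane_measure K).

Definition centroid K : plane R :=
  ((\int[plane_measure]_(z in K) z.1)%R / area K,
   (\int[plane_measure]_(z in K) z.2)%R / area K).

(* [g], restricted to ]-e, e[, is a regular C^oo parametrization of the boundary
   of [K] near [q], with [g 0 = q]. *)
Definition local_parametrization K q g (e : R) : Prop :=
  [/\ 0 < e /\ g 0 = q,
      smooth_curve g,
      {in `]-e, e[ &, injective g},
      {in `]-e, e[, forall t, derive1 g t != 0}
    & exists2 U, nbhs q U & boundary K `&` U = g @` `]-e, e[].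

Definition smooth_at K q : Prop := exists g e, local_parametrization K q g e.

(* [u] is the unit direction of a one-sided tangent half line of the boundary of
   [K] at [q], that is, a limit of directions from [q] to boundary points tending
   to [q]. At each boundary point of a plane convex body there are exactly two of
   them. *)
Definition half_tangent K q u : Prop :=
  cluster ((fun z => (enorm (z - q))^-1 *: (z - q)) @
             within (boundary K `\ q) (nbhs q)) u.

(* The line through [q] with normal vector [v] supports [K] at [q]: [K] lies in
   one of the two closed half-planes that it bounds. *)
Definition supports K q v : Prop :=
  (forall z, K z -> 0 <= dotp v (z - q)) \/
  (forall z, K z -> dotp v (z - q) <= 0).

Definition equilibrium K p q : Prop :=
  boundary K q /\ (q = p \/ supports K q (q - p)).

(* The second derivative, at [g 0], of the distance from [p] along [g]. At an
   equilibrium point distinct from [p], changing the regular parametrization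
   multiplies it by a positive factor. *)
Definition distance_derive2 p g : R :=
  derive1n 2 (fun t => enorm (g t - p)) 0.

Definition nondegenerate K p q : Prop :=
  (smooth_at K q /\
     (q = p \/ exists g e,
        local_parametrization K q g e /\ distance_derive2 p g != 0)) \/
  (~ smooth_at K q /\ q <> p /\
     forall u, half_tangent K q u -> angle (p - q) u < pi / 2).

(* Equilibrium points at nonsmooth boundary points are never stable. *)
Definition stable K p q : Prop :=
  equilibrium K p q /\ smooth_at K q /\
  (q = p \/ exists g e,
     local_parametrization K q g e /\ 0 < distance_derive2 p g).

Definition has_stable_points K (S : nat) p : Prop :=
  (forall q, equilibrium K p q -> nondegenerate K p q) /\
  ([set q | stable K p q] #= `I_S)%card.

Definition robust_region K p : set (plane R) :=
  [set q | exists2 S, has_stable_points K S p & has_stable_points K S q].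

(* The complement of the region is closed, so the infimum is the minimal
   distance. *)
Definition internal_robustness K p : R :=
  inf [set enorm (q - p) | q in ~` robust_region K p] / perimeter K.

Definition stable_class (S : nat) : set (set (plane R)) :=
  [set K | piecewise_smooth_convex_body K /\
           has_stable_points K S (centroid K)].

(* [sup] is 0 on a set that is empty or unbounded, so a positive value is a
   genuine supremum. *)
Definition max_internal_robustness (S : nat) : R :=
  sup [set internal_robustness K (centroid K) | K in stable_class S].

Definition polygon_hull n (v : 'I_n -> plane R) : set (plane R) :=
  [set z | exists a : 'I_n -> R,
     [/\ forall k, 0 <= a k, \sum_k a k = 1 & z = \sum_k a k *: v k]].

(* Vertices equally spaced on the circle of center [o] and radius [r]. *)
Definition regular_polygon (n : nat) K : Prop :=
  exists (o : plane R) (r phi : R),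
    0 < r /\
    K = polygon_hull (fun k : 'I_n =>
          o + r *: (cos (phi + 2 * pi * k%:R / n%:R),
                    sin (phi + 2 * pi * k%:R / n%:R))).

End ConvexBodies.

Arguments max_internal_robustness : clear implicits.

(* Main.v *)
(* Let F be the signed distance from the center of gravity p to the normal line
   of the boundary, as the boundary point runs around K; it vanishes at the
   stable points, changing sign from negative to positive. By convexity dF <= ds
   for the arc length s along smooth pieces, and F jumps down at corners, so
   s - F is nondecreasing. Let M > 0 be the maximum of F on the arc between two
   consecutive stable points, attained at z with tangent T. Moving p by M T makes
   z a degenerate equilibrium, so M is at least the minimal distance r from p to
   the complement of R(K, p); in the same way the minimum of F on the arc is at
   most -r. Hence the arc is at least 2 r long, and summing over the S arcs gives
   perim K >= 2 S r.

   If equality holds, then on every arc F attains its extrema r and -r at one and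
   the same corner, and s - F is constant elsewhere, so the boundary is a polygon
   whose sides all have length 2 r and midpoint at the foot of the perpendicular
   from p. Consecutive corners are then related by one fixed rotation about p,
   which makes K regular.

   For a regular S-gon with side 2 h, the rotation invariance of the area puts
   the center of gravity at the center; reference points at distance less than h
   have one stable point inside each side and nondegenerate vertices, while at
   distance h a vertex becomes degenerate. *)
Require Import Defs.
From mathcomp Require Import all_boot all_order all_algebra.
From mathcomp Require Import all_classical all_reals all_analysis.
From mathcomp Require Import archimedean measurable_realfun.
From mathcomp Require complex.
From mathcomp Require Import ring lra zify.

Set Implicit Arguments.
Unset Strict Implicit.
Unset Printing Implicit Defensive.

Import Order.TTheory GRing.Theory Num.Theory numFieldNormedType.Exports.

Local Open Scope classical_set_scope.
Local Open Scope ring_scope.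

(** * Plane geometry and convex bodies *)

(** Stability refers to some local parametrization, chosen freely and unrelated to the given
    parametrization of the boundary, whose subdivision points may or may not be smooth points. Much
    of the work therefore compares two curves in the boundary: both are graphs over the same tangent
    line, hence pass through the same points. The direction of travel is free as well; a sign [e]
    with square 1 records it.

    At a corner F has two values. Functions such as F are indexed by a piece and a parameter, and a
    corner is one parameter lying in two pieces.

    For a general body the center of gravity is used through one property: every supporting line
    leaves it strictly on the side of K.

    The perimeter is the length of an unspecified parametrization, so the length of the regular
    polygon must be found for every parametrization. The inequality perim K >= 2 S r, applied to the
    polygon itself, gives one half of this. For the other half the unit tangent of each piece is
    shown to be constant, because it is continuous and can take only finitely many values. *)

Section PlaneAlgebra.
Variable R : realType.
Implicit Types (u v w z : plane R) (a : R).

Definition crossp u v : R := u.1 * v.2 - u.2 * v.1.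
Definition rot u : plane R := (- u.2, u.1).

Lemma fstD u v : (u + v).1 = u.1 + v.1. Proof. by []. Qed.
Lemma sndD u v : (u + v).2 = u.2 + v.2. Proof. by []. Qed.
Lemma fstN u : (- u).1 = - u.1. Proof. by []. Qed.
Lemma sndN u : (- u).2 = - u.2. Proof. by []. Qed.
Lemma fstZ a u : (a *: u).1 = a * u.1. Proof. by []. Qed.
Lemma sndZ a u : (a *: u).2 = a * u.2. Proof. by []. Qed.
Lemma fst0 : (0 : plane R).1 = 0. Proof. by []. Qed.
Lemma snd0 : (0 : plane R).2 = 0. Proof. by []. Qed.
Definition plE := (fstD, sndD, fstN, sndN, fstZ, sndZ, fst0, snd0).

Lemma plane_eq u v : u.1 = v.1 -> u.2 = v.2 -> u = v.
Proof. by case: u v => [a b] [c d] /= -> ->. Qed.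

Lemma dotp_ge0 u : 0 <= dotp u u.
Proof. by rewrite /dotp addr_ge0 // -expr2 sqr_ge0. Qed.

Lemma dotp_eq0 u : (dotp u u == 0) = (u == 0).
Proof.
rewrite /dotp paddr_eq0 -?expr2 ?sqr_ge0 // !sqrf_eq0.
apply/idP/eqP => [/andP[/eqP h1 /eqP h2]|->]; last by rewrite /= eqxx.
exact: plane_eq.
Qed.

Lemma dotp_gt0 u : u != 0 -> 0 < dotp u u.
Proof. by rewrite lt_def dotp_eq0 dotp_ge0 andbT. Qed.

Lemma enorm_ge0 u : 0 <= enorm u. Proof. exact: sqrtr_ge0. Qed.

Lemma enorm_sqr u : enorm u ^+ 2 = dotp u u.
Proof. by rewrite sqr_sqrtr ?dotp_ge0. Qed.

Lemma enorm_eq0 u : (enorm u == 0) = (u == 0).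
Proof. by rewrite -(@sqrf_eq0 _ (enorm u)) enorm_sqr dotp_eq0. Qed.

Lemma enorm_gt0 u : u != 0 -> 0 < enorm u.
Proof. by move=> u0; rewrite lt_def enorm_eq0 u0 enorm_ge0. Qed.

Lemma enormZ a u : enorm (a *: u) = `|a| * enorm u.
Proof.
rewrite /enorm (_ : dotp (a *: u) (a *: u) = a ^+ 2 * dotp u u).
  by rewrite sqrtrM ?sqr_ge0 // sqrtr_sqr.
by rewrite /dotp !plE; ring.
Qed.

Lemma enormN u : enorm (- u) = enorm u.
Proof. by rewrite -scaleN1r enormZ normrN1 mul1r. Qed.

Lemma dotpC u v : dotp u v = dotp v u.
Proof. by rewrite /dotp; ring. Qed.

Lemma dotpZr u a v : dotp u (a *: v) = a * dotp u v.
Proof. by rewrite /dotp !plE; ring. Qed.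

Lemma dotpZl u a v : dotp (a *: u) v = a * dotp u v.
Proof. by rewrite /dotp !plE; ring. Qed.

Lemma dotpBr u v w : dotp u (v - w) = dotp u v - dotp u w.
Proof. by rewrite /dotp !plE; ring. Qed.

Lemma dotpDr u v w : dotp u (v + w) = dotp u v + dotp u w.
Proof. by rewrite /dotp !plE; ring. Qed.

Lemma dotpNr u v : dotp u (- v) = - dotp u v.
Proof. by rewrite /dotp !plE; ring. Qed.

Lemma dotp_rot u v : dotp (rot u) v = crossp u v.
Proof. by rewrite /dotp /crossp /rot /=; ring. Qed.

Lemma dotp0r u : dotp u 0 = 0.
Proof. by rewrite /dotp /= !mulr0 addr0. Qed.

Lemma dotp0l u : dotp 0 u = 0.
Proof. by rewrite dotpC dotp0r. Qed.

Lemma dotpNl u v : dotp (- u) v = - dotp u v.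
Proof. by rewrite dotpC dotpNr dotpC. Qed.

Lemma dotpDl u v w : dotp (u + v) w = dotp u w + dotp v w.
Proof. by rewrite !(dotpC _ w) dotpDr. Qed.

Lemma dotpBl u v w : dotp (u - v) w = dotp u w - dotp v w.
Proof. by rewrite !(dotpC _ w) dotpBr. Qed.

Lemma crosspC u v : crossp u v = - crossp v u.
Proof. by rewrite /crossp; ring. Qed.

Lemma crosspp u : crossp u u = 0.
Proof. by rewrite /crossp; ring. Qed.

Lemma crosspZr u a v : crossp u (a *: v) = a * crossp u v.
Proof. by rewrite /crossp !plE; ring. Qed.

Lemma crosspZl u a v : crossp (a *: u) v = a * crossp u v.
Proof. by rewrite /crossp !plE; ring. Qed.

Lemma crosspNr u v : crossp u (- v) = - crossp u v.
Proof. by rewrite /crossp !plE; ring. Qed.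

Lemma crosspBr u v w : crossp u (v - w) = crossp u v - crossp u w.
Proof. by rewrite /crossp !plE; ring. Qed.

Lemma crossp0r u : crossp u 0 = 0.
Proof. by rewrite /crossp /= !mulr0 subrr. Qed.

Lemma crossp0l u : crossp 0 u = 0.
Proof. by rewrite crosspC crossp0r oppr0. Qed.

Lemma cauchy_schwarz u v : `|dotp u v| <= enorm u * enorm v.
Proof.
rewrite -(@ler_pXn2r _ 2) ?nnegrE ?mulr_ge0 ?enorm_ge0 //.
rewrite exprMn !enorm_sqr real_normK ?num_real // /dotp -subr_ge0.
rewrite (_ : _ - _ = (u.1 * v.2 - u.2 * v.1) ^+ 2) ?sqr_ge0 //; ring.
Qed.

Lemma dotp_eq0_parallel u v : u != 0 -> dotp u v = 0 ->
  v = (crossp u v / dotp u u) *: rot u.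
Proof.
move=> u0 uv0; have uu0 := lt0r_neq0 (dotp_gt0 u0).
apply: plane_eq; rewrite !plE /rot /=; apply: (mulIf uu0).
  rewrite mulrAC divfK //.
  transitivity (- (crossp u v * u.2) + u.1 * dotp u v).
    by rewrite /dotp /crossp; ring.
  by rewrite uv0; ring.
rewrite mulrAC divfK //.
transitivity (crossp u v * u.1 + u.2 * dotp u v).
  by rewrite /dotp /crossp; ring.
by rewrite uv0; ring.
Qed.

End PlaneAlgebra.

Section PlaneTopology.
Variable R : realType.
Implicit Types (K : set (plane R)) (p q u v w z n : plane R) (a e : R).

Lemma plane_nbhsP z (U : set (plane R)) :
  nbhs z U <-> exists2 e, 0 < e & forall w, `|w.1 - z.1| < e -> `|w.2 - z.2| < e -> U w.
Proof.
split=> [/nbhs_ballP[e /= e0 zU]|[e e0 zU]].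
  exists e => // w w1 w2; apply: zU; split => /=;
  by rewrite -ball_normE /= distrC.
apply/nbhs_ballP; exists e => // w [] /=; rewrite -!ball_normE /= => w1 w2.
by apply: zU; rewrite distrC.
Qed.

Lemma normr_le_enorm u : `|u.1| <= enorm u /\ `|u.2| <= enorm u.
Proof.
split; rewrite -(@ler_pXn2r _ 2) ?nnegrE ?enorm_ge0 // enorm_sqr real_normK
  ?num_real // /dotp -!expr2 ?lerDl ?lerDr ?sqr_ge0 //.
Qed.

Lemma enorm_le_normr u : enorm u <= `|u.1| + `|u.2|.
Proof.
rewrite -(@ler_pXn2r _ 2) ?nnegrE ?enorm_ge0 ?addr_ge0 // enorm_sqr /dotp.
rewrite sqrrD !real_normK ?num_real // -!expr2 addrAC lerDl.
by rewrite mulrn_wge0 // mulr_ge0.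
Qed.

Lemma enorm_nbhsP z (U : set (plane R)) :
  nbhs z U <-> exists2 e, 0 < e & forall w, enorm (w - z) < e -> U w.
Proof.
rewrite plane_nbhsP; split=> [] [e e0 zU].
  exists e => // w we; have [w1 w2] := normr_le_enorm (w - z).
  by apply: zU; [apply: le_lt_trans w1 we | apply: le_lt_trans w2 we].
exists (e / 2); first by rewrite divr_gt0.
move=> w w1 w2; apply: zU; apply: le_lt_trans (enorm_le_normr _) _.
by rewrite [e]splitr ltrD.
Qed.

Lemma convex_comb K u v a : convex_set K -> K u -> K v -> 0 <= a <= 1 ->
  K (a *: u + (1 - a) *: v).
Proof.
move=> cK Ku Kv a01.
have := cK u v (Itv01 (andP a01).1 (andP a01).2).
by rewrite !inE => /(_ Ku Kv).
Qed.

Lemma compact_boundary K z : compact K ->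
  boundary K z <-> K z /\ forall e, 0 < e -> exists2 w, ~ K w & enorm (w - z) < e.
Proof.
move=> cK; have clK : closed K by apply: compact_closed => //; exact: norm_hausdorff.
have EK : closure K = K by rewrite -(proj1 (closure_id K) clK).
rewrite /boundary EK /=; split=> [[Kz nK]|[Kz nK]].
  split => // e e0; apply: contrapT => h; apply: nK.
  apply/enorm_nbhsP; exists e => // w we; apply: contrapT => Kw; apply: h.
  by exists w.
split=> // /enorm_nbhsP[e e0 eK].
by have [w Kw we] := nK e e0; apply: Kw; exact: eK.
Qed.

End PlaneTopology.

Section ConvexGeometry.
Variable R : realType.
Implicit Types (K : set (plane R)) (p q u v w z n : plane R) (a e : R).

Lemma continuous_fst : continuous (fst : plane R -> R).
Proof. by move=> z; apply: cvg_fst. Qed.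

Lemma continuous_snd : continuous (snd : plane R -> R).
Proof. by move=> z; apply: cvg_snd. Qed.

Lemma continuous_dotp (f g : plane R -> plane R) :
  continuous f -> continuous g -> continuous (fun w => dotp (f w) (g w)).
Proof.
move=> cf cg z; rewrite /dotp; apply: cvgD; apply: cvgM;
  by [apply: continuous_comp; [exact: cf|exact: continuous_fst]
    | apply: continuous_comp; [exact: cf|exact: continuous_snd]
    | apply: continuous_comp; [exact: cg|exact: continuous_fst]
    | apply: continuous_comp; [exact: cg|exact: continuous_snd]].
Qed.

Lemma compact_unit_circle : compact [set n : plane R | dotp n n = 1].
Proof.
have cbox : compact (`[(-1 : R), 1] `*` `[(-1 : R), 1]).
  by apply: compact_setX; exact: segment_compact.
apply: (subclosed_compact _ cbox).
  have -> : [set n : plane R | dotp n n = 1] = (fun n => dotp n n) @^-1` [set 1] by [].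
  apply: preimage_closed => /=; last exact: closed_eq.
  by move=> x _; apply: (@continuous_dotp id id) => z; exact: cvg_id.
move=> n /= nn; rewrite /= !in_itv /=.
have [] := normr_le_enorm n; rewrite /enorm nn sqrtr1.
by rewrite !ler_norml => -> ->.
Qed.

(* The normal is [y - q], with [y] the point of [K] nearest to [q]. *)
Lemma exterior_separation K q : compact K -> convex_set K -> K !=set0 -> ~ K q ->
  exists2 n, dotp n n = 1 & forall w, K w -> 0 <= dotp n (w - q).
Proof.
move=> cK vK K0 Kq.
have cont : {within K, continuous (fun w => dotp (w - q) (w - q))}.
  apply: continuous_subspaceT;
  apply: (@continuous_dotp (fun w => w - q) (fun w => w - q)) => z; apply: cvgB;
  by [exact: cvg_id|exact: cvg_cst].
have [y Ky ymin] := compact_EVT_min K0 cK cont.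
rewrite inE in Ky.
have yq : y - q != 0 by rewrite subr_eq0; apply: contra_notN Kq => /eqP <-.
have yq0 := enorm_gt0 yq.
exists ((enorm (y - q))^-1 *: (y - q)).
  by rewrite dotpZl dotpZr -enorm_sqr expr2 mulKf ?mulVf // gt_eqF.
move=> w Kw; rewrite dotpZl mulr_ge0 ?invr_ge0 ?enorm_ge0 //.
suff h : 0 <= dotp (y - q) (w - y).
  have -> : w - q = (w - y) + (y - q) by rewrite subrKA.
  by rewrite dotpDr addr_ge0 // dotp_ge0.
rewrite leNgt; apply/negP => neg.
set d := dotp (y - q) (w - y) in neg; set m := dotp (w - y) (w - y).
have m_gt0 : 0 < m.
  apply: dotp_gt0; apply: contra_ltN neg => /eqP wy.
  by rewrite /d wy /dotp fst0 snd0 !mulr0 addr0.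
(* On the segment from [y] towards [w] the squared distance from [q] changes by [t * (2 d + t m)];
   [t <= - d / m] keeps the bracket at most [d], hence negative. *)
pose t := Num.min 1 (- d / m).
have t01 : 0 < t <= 1 by rewrite /t lt_min ltr01 divr_gt0 ?oppr_gt0 //= ge_min lexx.
have tm : t * m <= - d by rewrite -ler_pdivlMr // /t ge_min lexx orbT.
have Kt : K (t *: w + (1 - t) *: y) by apply: convex_comb => //; case/andP: t01 => /ltW -> ->.
have := ymin _ (mem_set Kt); rewrite leNgt => /negP; apply.
have -> : t *: w + (1 - t) *: y - q = (y - q) + t *: (w - y).
  by apply: plane_eq; rewrite !plE; ring.
have -> : dotp (y - q + t *: (w - y)) (y - q + t *: (w - y)) =
  dotp (y - q) (y - q) + t * (d + d + t * m).
  by rewrite /d /m /dotp !plE; ring.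
rewrite gtrDl pmulr_rlt0 ?(andP t01).1 //.
have := ler_ltD tm neg; lra.
Qed.

(** Points outside [K] tend to [z]. Their unit separating normals have a cluster point on the
    compact unit circle, and the separation inequalities, valid up to [1 / (k + 1)], pass to it. *)
Lemma support_normal K z : compact K -> convex_set K -> K !=set0 -> boundary K z ->
  exists2 n, n != 0 & forall w, K w -> 0 <= dotp n (w - z).
Proof.
move=> cK vK K0 /(compact_boundary _ cK)[Kz nK].
have sep (k : nat) : exists n, dotp n n = 1 /\
    forall w, K w -> - (k.+1%:R)^-1 <= dotp n (w - z).
  have k0 : (0 : R) < (k.+1%:R)^-1 by rewrite invr_gt0 ltr0n.
  have [q Kq qz] := nK _ k0.
  have [n nn hn] := exterior_separation cK vK K0 Kq.
  exists n; split => // w Kw.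
  have -> : w - z = (w - q) + (q - z) by rewrite subrKA.
  rewrite dotpDr; apply: le_trans (lerD (hn w Kw) (lexx _)); rewrite add0r.
  rewrite lerNl; apply: le_trans (ltW qz).
  have := cauchy_schwarz n (q - z); rewrite {1}/enorm nn sqrtr1 mul1r.
  by rewrite ler_norml => /andP[+ _]; rewrite lerNl.
have [N hN] := choice sep.
have [n nn] : [set n : plane R | dotp n n = 1] `&` cluster (N @ \oo) !=set0.
  apply: compact_unit_circle; apply: (@nearW _ eventually) => k /=.
  by have [] := hN k.
case: nn => nn cl; exists n.
  by rewrite -dotp_eq0 nn oner_eq0.
move=> w Kw; rewrite leNgt; apply/negP => neg.
pose e := - dotp n (w - z) / 2.
have e0 : 0 < e by rewrite divr_gt0 // oppr_gt0.
have nb : nbhs n [set n' | dotp n' (w - z) < - e].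
  have c : continuous (fun n' => dotp n' (w - z)).
    by apply: (@continuous_dotp id (fun=> w - z)) => x; [exact: cvg_id|exact: cvg_cst].
  have := c n [set x | x < - e]; apply; apply: open_nbhs_nbhs; split.
    exact: open_lt.
  by rewrite /= /e; lra.
have ev : (N @ \oo) [set n' | - e < dotp n' (w - z)].
  have := near_infty_natSinv_lt (PosNum e0) => /= h.
  apply: filterS h => k /= h.
  by apply: lt_le_trans ((hN k).2 w Kw); rewrite ltrN2.
have [n' /= [h1 h2]] := cl _ _ ev nb.
by have := lt_trans h1 h2; rewrite ltxx.
Qed.

(** The ends are the points of [K] with extreme first coordinate on the horizontal line through [w];
    just beyond them the line leaves [K]. An inclusion of [K] in a convex set is thereby reduced to
    the boundary. *)
Lemma boundary_chord K w : compact K -> K w ->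
  exists b1 b2 a, [/\ boundary K b1, boundary K b2, 0 <= a <= 1 &
                      w = a *: b1 + (1 - a) *: b2].
Proof.
move=> cK Kw.
pose L := K `&` (snd @^-1` [set w.2]).
have L0 : L !=set0 by exists w.
have cL : compact L.
  apply: (subclosed_compact _ cK); last by move=> x [].
  apply: closedI; first by apply: compact_closed => //; exact: norm_hausdorff.
  by apply: preimage_closed; [move=> x _; exact: continuous_snd|exact: closed_eq].
have cont : {within L, continuous (fst : plane R -> R)}.
  by apply: continuous_subspaceT; exact: continuous_fst.
have [b1 b1L b1max] := compact_EVT_max L0 cL cont.
have [b2 b2L b2min] := compact_EVT_min L0 cL cont.
rewrite !inE in b1L b2L; case: b1L => Kb1 /= b1w; case: b2L => Kb2 /= b2w.
(* The sign [s] treats the rightmost point (1) and the leftmost point (-1) together. *)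
have bd (s : R) b : `|s| = 1 -> K b -> b.2 = w.2 ->
    (forall t, t \in L -> s * t.1 <= s * b.1) -> boundary K b.
  move=> s1 Kb bw h; apply/compact_boundary => //; split => // e e0.
  pose x : plane R := (b.1 + s * (e / 2), b.2).
  exists x; last first.
    have -> : x - b = (e / 2) *: (s, 0).
      by apply: plane_eq; rewrite !plE /x /=; ring.
    rewrite enormZ /enorm /dotp /= mulr0 addr0 -expr2 sqrtr_sqr s1 mulr1.
    by rewrite ger0_norm ?divr_ge0 ?ltW // ltr_pdivrMr // mulr2n mulrDr mulr1 ltrDl.
  move=> Kx; have /h : x \in L by rewrite inE; split.
  rewrite /x /= mulrDr mulrA.
  have -> : s * s = 1 by rewrite -expr2 -real_normK ?num_real // s1 expr1n.
  by rewrite mul1r gerDl leNgt divr_gt0.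
have B1 : boundary K b1.
  by apply: (bd 1) => //; [rewrite normr1|move=> t /b1max; rewrite !mul1r].
have B2 : boundary K b2.
  by apply: (bd (-1)) => //; [rewrite normrN1|move=> t /b2min; rewrite !mulN1r lerN2].
have w1 : w.1 <= b1.1 by apply: b1max; rewrite inE; split.
have w2 : b2.1 <= w.1 by apply: b2min; rewrite inE; split.
case: (eqVneq b1.1 b2.1) => [e12|n12].
  exists b1, b2, 0; split => //; first by rewrite lexx ler01.
  rewrite scale0r add0r subr0 scale1r.
  by apply: plane_eq => //; apply/eqP; rewrite eq_le w2 -e12 w1.
exists b1, b2, ((w.1 - b2.1) / (b1.1 - b2.1)).
have d0 : 0 < b1.1 - b2.1 by rewrite subr_gt0 lt_def n12 (le_trans w2 w1).
split => //.
  rewrite divr_ge0 ?subr_ge0 ?(le_trans w2 w1) //=.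
  by rewrite ler_pdivrMr // mul1r lerD2r.
apply: plane_eq; rewrite !plE.
  rewrite -[LHS](subrK b2.1) -{1}(divfK (lt0r_neq0 d0) (w.1 - b2.1)).
  by move: (_ / _) => t; ring.
by rewrite b1w b2w; ring.
Qed.

Lemma polygon_hull_convex (n : nat) (v : 'I_n -> plane R) b1 b2 a :
  polygon_hull v b1 -> polygon_hull v b2 -> 0 <= a <= 1 ->
  polygon_hull v (a *: b1 + (1 - a) *: b2).
Proof.
move=> [f [f0 f1 ->]] [g [g0 g1 ->]] /andP[a0 a1].
exists (fun k => a * f k + (1 - a) * g k); split.
- by move=> k; rewrite addr_ge0 // mulr_ge0 // subr_ge0.
- by rewrite big_split /= -!mulr_sumr f1 g1 !mulr1 addrC subrK.
- rewrite !scaler_sumr -big_split /=; apply: eq_bigr => k _.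
  by rewrite !scalerA -scalerDl.
Qed.

Lemma polygon_hull_vertex (n : nat) (v : 'I_n -> plane R) k : polygon_hull v (v k).
Proof.
exists (fun j => (j == k)%:R); split => [j||].
- by rewrite ler0n.
- by rewrite (bigD1 k) //= eqxx big1 ?addr0 // => j /negbTE ->.
- rewrite (bigD1 k) //= eqxx scale1r big1 ?addr0 // => j /negbTE ->.
  by rewrite scale0r.
Qed.

(** Induction on the number of vertices: the weights after the first are divided by their sum,
    unless that sum is 0, in which case they all vanish. *)
Lemma polygon_hull_sub (n : nat) (v : 'I_n -> plane R) K :
  convex_set K -> (forall k, K (v k)) -> polygon_hull v `<=` K.
Proof.
move=> vK; elim: n v => [|n IH] v Kv z [a [a0 a1 ->]].
  by move: a1; rewrite big_ord0 => /esym/eqP; rewrite oner_eq0.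
rewrite big_ord_recl /=; rewrite big_ord_recl /= in a1.
have s0 : 0 <= \sum_(i < n) a (lift ord0 i) by apply: sumr_ge0.
case: (eqVneq (\sum_(i < n) a (lift ord0 i)) 0) => [e0|n0].
  have -> : a ord0 = 1 by rewrite -a1 e0 addr0.
  rewrite big1 ?addr0 ?scale1r // => i _.
  have /eqP := e0; rewrite psumr_eq0 // => /allP /(_ i).
  by rewrite mem_index_enum => /(_ isT)/eqP ->; rewrite scale0r.
set s := \sum_(i < n) _ in s0 n0 a1.
have -> : \sum_(i < n) a (lift ord0 i) *: v (lift ord0 i) =
  (1 - a ord0) *: \sum_(i < n) (a (lift ord0 i) / s) *: v (lift ord0 i).
  rewrite -a1 addrC addKr scaler_sumr; apply: eq_bigr => i _.
  by rewrite scalerA mulrC divfK.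
apply: convex_comb => //.
  apply: (IH (fun i => v (lift ord0 i))) => //.
  exists (fun i => a (lift ord0 i) / s); split => //.
    by move=> k; rewrite divr_ge0.
  by rewrite -mulr_suml divff.
by rewrite a0 /= -a1 lerDl.
Qed.

End ConvexGeometry.

(** * Calculus along plane curves *)

Section ScalarCalculus.
Variable R : realType.
Implicit Types (f g df : R -> R) (t s a b d e : R).

(* The prefix [dd] marks facts about derivatives of scalar functions stated with
   [is_derive]. *)
Lemma ddc a t : is_derive t 1 (fun=> a) (0 : R).
Proof. exact: is_derive_cst. Qed.
Lemma ddid t : is_derive t 1 (fun s : R => s) (1 : R).
Proof. exact: is_derive_id. Qed.
Lemma ddD f g t a b : is_derive t 1 f a -> is_derive t 1 g b ->
  is_derive t 1 (fun s => f s + g s) (a + b).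
Proof. by move=> *; exact: is_deriveD. Qed.
Lemma ddN f t a : is_derive t 1 f a -> is_derive t 1 (fun s => - f s) (- a).
Proof. by move=> *; exact: is_deriveN. Qed.
Lemma ddB f g t a b : is_derive t 1 f a -> is_derive t 1 g b ->
  is_derive t 1 (fun s => f s - g s) (a - b).
Proof. by move=> *; exact: is_deriveB. Qed.
Lemma ddM f g t a b : is_derive t 1 f a -> is_derive t 1 g b ->
  is_derive t 1 (fun s => f s * g s) (a * g t + f t * b).
Proof.
move=> fa gb; rewrite addrC [a * _]mulrC.
exact: is_deriveM.
Qed.
Lemma ddsqrt f t a : 0 < f t -> is_derive t 1 f a ->
  is_derive t 1 (fun s => Num.sqrt (f s)) (a / (2 * Num.sqrt (f t))).
Proof.
move=> f0 fa; rewrite mulrC.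
exact: (is_derive1_comp (is_derive1_sqrt f0) fa).
Qed.
Lemma ddV f t a : f t != 0 -> is_derive t 1 f a ->
  is_derive t 1 (fun s => (f s)^-1) (- a / f t ^+ 2).
Proof.
move=> f0 fa; have := is_deriveV f0 fa.
by rewrite -[_ *: _]/(_ * _) mulNr mulrC -mulNr.
Qed.
Lemma dd_eq f t a b : is_derive t 1 f a -> a = b -> is_derive t 1 f b.
Proof. by move=> fa <-. Qed.

Lemma dd_slope f t d : is_derive t 1 f d ->
  forall e, 0 < e -> exists2 r, 0 < r &
    forall s, `|s - t| < r -> `|f s - f t - d * (s - t)| <= e * `|s - t|.
Proof.
move=> [dv vd] e e0.
move: dv; rewrite /derivable => /cvg_ex[/= l cl].
have dl : d = l.
  by rewrite -vd /derive; apply/cvg_lim.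
move/(@cvgrPdist_le _ R^o)/(_ e e0): cl; rewrite dl => -[r /= r0 hr].
exists r => // s sr.
case: (eqVneq s t) => [->|st]; first by rewrite !subrr mulr0 subr0 normr0 mulr0.
have := hr (s - t); rewrite /= sub0r normrN => /(_ sr).
rewrite subr_eq0 => /(_ st).
rewrite [_%:A]mulr1 -[_ *: _]/(_ * _) subrK => h.
have -> : f s - f t - l * (s - t) = - (l - (s - t)^-1 * (f s - f t)) * (s - t).
  have st0 : s - t != 0 by rewrite subr_eq0.
  by field.
by rewrite normrM normrN ler_wpM2r.
Qed.

Lemma dd_cont f t d : is_derive t 1 f d ->
  forall e, 0 < e -> exists2 r, 0 < r &
    forall s, `|s - t| < r -> `|f s - f t| < e.
Proof.
move=> [dv _] e e0.
have /derivable1_diffP/differentiable_continuous : derivable f t 1 by [].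
move/cvgrPdist_lt => /(_ e e0)[r /= r0 h]; exists r => // s st.
by rewrite distrC; apply: h; rewrite /= distrC.
Qed.

Lemma dd_continuous f t d : is_derive t 1 f d -> {for t, continuous f}.
Proof. by move=> [dv _]; apply: differentiable_continuous; apply/derivable1_diffP. Qed.

Lemma dd_uniq f t a b : is_derive t 1 f a -> is_derive t 1 f b -> a = b.
Proof. by move=> [_ <-] [_ <-]. Qed.

Lemma dd_within f df a b : (forall x, a <= x <= b -> is_derive x 1 f (df x)) ->
  {within `[a, b], continuous f}.
Proof.
move=> fd; apply: derivable_within_continuous => x; rewrite in_itv /= => /fd.
by case.
Qed.

Lemma dd_mvt f df a b : a < b -> (forall x, a <= x <= b -> is_derive x 1 f (df x)) ->
  exists2 c, a < c < b & f b - f a = df c * (b - a).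
Proof.
move=> ab fd; have [||c cab ->] := MVT (f := f) (df := df) ab.
- by move=> x; rewrite in_itv /= => /andP[ax xb]; apply: fd; rewrite !ltW.
- exact: dd_within fd.
- by exists c => //; rewrite in_itv in cab.
Qed.

Lemma dd_ivt f df a b y : a <= b -> (forall x, a <= x <= b -> is_derive x 1 f (df x)) ->
  f a <= y <= f b -> exists2 c, a <= c <= b & f c = y.
Proof.
move=> ab fd /andP[ay yb].
have [|c cab <-] := IVT (v := y) ab (dd_within fd).
  by rewrite ge_min ay le_max yb orbT.
by exists c => //; rewrite in_itv in cab.
Qed.

Lemma dd_ge0_le f df a b : a <= b -> (forall x, a <= x <= b -> is_derive x 1 f (df x)) ->
  (forall x, a < x < b -> 0 <= df x) -> f a <= f b.
Proof.
rewrite le_eqVlt => /predU1P[->//|ab] fd df0.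
have [c cab e] := dd_mvt ab fd.
by rewrite -subr_ge0 e mulr_ge0 ?df0 // subr_ge0 ltW.
Qed.

Lemma dd_local_max f t d r : is_derive t 1 f d -> 0 < r ->
  (forall s, `|s - t| < r -> f s <= f t) -> d = 0.
Proof.
move=> fd r0 fmax; apply/eqP; apply: contrapT => /negP d0.
have d0' : 0 < `|d| / 2 by rewrite divr_gt0 ?normr_gt0.
have [r' r'0 h] := dd_slope fd d0'.
have [h0 h00 hr] : exists2 h0, 0 < h0 & h0 < r /\ h0 < r'.
  have : 0 < Num.min r r' by rewrite lt_min r0.
  have : Num.min r r' <= r /\ Num.min r r' <= r' by rewrite !ge_min !lexx orbT.
  by exists (Num.min r r' / 2); lra.
have sE : t + Num.sg d * h0 - t = Num.sg d * h0 by ring.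
have sN : `|Num.sg d * h0| = h0 by rewrite normrM normr_sg d0 mul1r gtr0_norm.
have := h (t + Num.sg d * h0); have := fmax (t + Num.sg d * h0).
have dE : d * Num.sg d = `|d| by rewrite mulrC -normrEsg.
rewrite sE sN mulrA dE => /(_ hr.1) m /(_ hr.2).
rewrite ler_norml => /andP[+ _].
have : 0 < `|d| * h0 by rewrite mulr_gt0 ?normr_gt0.
lra.
Qed.

Lemma dd_pos_right f t d : is_derive t 1 f d -> 0 < d ->
  exists2 r, 0 < r & forall s, `|s - t| < r ->
    (t < s -> f t < f s) /\ (s < t -> f s < f t).
Proof.
move=> fd d0; have [r r0 h] := dd_slope fd (divr_gt0 d0 (ltr0n _ 2)).
exists r => // s /h; rewrite ler_norml => /andP[h1 h2]; split => st.
  by rewrite gtr0_norm ?subr_gt0 // in h1 h2; have := mulr_gt0 d0 (_ : 0 < s - t); rewrite subr_gt0 => /(_ st); lra.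
by rewrite ltr0_norm ?subr_lt0 // in h1 h2; have := mulr_gt0 d0 (_ : 0 < t - s); rewrite subr_gt0 => /(_ st); lra.
Qed.

(** The ends of the interval are allowed: [f] is constant only on one side of them, but the
    derivative is two-sided and is already determined by the slopes from that side. *)
Lemma dd_cst f a b t : a < b -> (forall x, a <= x <= b -> f x = f a) ->
  a <= t <= b -> forall d, is_derive t 1 f d -> d = 0.
Proof.
move=> ab fc /andP[at_ tb] d fd; apply/eqP; apply: contrapT => /negP d0.
have d0' : 0 < `|d| / 2 by rewrite divr_gt0 ?normr_gt0.
have [r r0 h] := dd_slope fd d0'.
have [s [sab st sr]] : exists s, [/\ a <= s <= b, s != t & `|s - t| < r].
  case: (ltP t b) => [tb'|bt].
    exists (Num.min b (t + r / 2)); split.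
    - by rewrite le_min ge_min lexx /= (le_trans at_ tb) andbT; apply: (le_trans at_); rewrite lerDl divr_ge0 // ltW.
    - by rewrite gt_eqF // lt_min tb' ltrDl divr_gt0.
    - rewrite ger0_norm; last by rewrite subr_ge0 le_min tb lerDl divr_ge0 // ltW.
      have : Num.min b (t + r / 2) <= t + r / 2 by rewrite ge_min lexx orbT.
      by move: (Num.min _ _) => m mt; lra.
  have {bt}tb_ : t = b by apply/eqP; rewrite eq_le tb bt.
  exists (Num.max a (t - r / 2)); split.
  - by rewrite le_max lexx /= ge_max (le_trans at_ tb) /= tb_ gerDl oppr_le0 divr_ge0 // ltW.
  - by rewrite lt_eqF // gt_max tb_ ab /= gtrDl oppr_lt0 divr_gt0.
  - rewrite ler0_norm; last first.
      by rewrite subr_le0 ge_max at_ /= gerDl oppr_le0 divr_ge0 // ltW.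
    have : t - r / 2 <= Num.max a (t - r / 2) by rewrite le_max lexx orbT.
    by move: (Num.max _ _) => m mt; lra.
have := h s sr; rewrite (fc s sab) (fc t) ?at_ ?tb // subrr sub0r normrN normrM.
have : 0 < `|d| * `|s - t| by rewrite mulr_gt0 ?normr_gt0 // subr_eq0.
lra.
Qed.

End ScalarCalculus.

Section PlaneCalculus.
Variable R : realType.
Implicit Types (f g : R -> plane R) (t s d e : R) (u v w a b p : plane R).

(** Coordinatewise, so that the scalar rules and the mean and intermediate value theorems apply
    directly to components of a curve. *)
Definition vderiv f t v :=
  is_derive t 1 (fun s => (f s).1) v.1 /\ is_derive t 1 (fun s => (f s).2) v.2.

Lemma derivable_vderiv f t : derivable f t 1 -> vderiv f t (derive1 f t).
Proof.
move=> df; have := df; rewrite /derivable => /cvg_ex[/= l cl].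
have -> : derive1 f t = l.
  by rewrite derive1E /derive; apply/cvg_lim => //; exact: norm_hausdorff.
have c1 := cvg_comp _ _ cl (@continuous_fst R l).
have c2 := cvg_comp _ _ cl (@continuous_snd R l).
split; (split; first by apply/cvg_ex; eexists; [exact: c1 || exact: c2]).
  by rewrite /derive; apply/cvg_lim => //; exact: c1.
by rewrite /derive; apply/cvg_lim => //; exact: c2.
Qed.

Lemma smooth_vderiv f n t : smooth_curve f -> vderiv (derive1n n f) t (derive1n n.+1 f t).
Proof. by move=> sf; exact: derivable_vderiv. Qed.

Lemma smooth_vderiv0 f t : smooth_curve f -> vderiv f t (derive1 f t).
Proof. by move=> sf; exact: (smooth_vderiv 0). Qed.

Lemma smooth_vderiv1 f t : smooth_curve f -> vderiv (derive1 f) t (derive1n 2 f t).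
Proof. by move=> sf; exact: (smooth_vderiv 1). Qed.

Lemma vderiv_cst a t : vderiv (fun=> a) t 0.
Proof. by split; exact: ddc. Qed.

Lemma vderivB_cst f t v p : vderiv f t v -> vderiv (fun s => f s - p) t v.
Proof.
move=> [f1 f2]; split.
  by apply: dd_eq (ddB f1 (ddc p.1 t)) _; rewrite subr0.
by apply: dd_eq (ddB f2 (ddc p.2 t)) _; rewrite subr0.
Qed.

Lemma vderiv_dotp f g t a b : vderiv f t a -> vderiv g t b ->
  is_derive t 1 (fun s => dotp (f s) (g s)) (dotp a (g t) + dotp (f t) b).
Proof.
move=> [f1 f2] [g1 g2]; apply: dd_eq (ddD (ddM f1 g1) (ddM f2 g2)) _.
by rewrite /dotp; ring.
Qed.

Lemma vderiv_crossp f g t a b : vderiv f t a -> vderiv g t b ->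
  is_derive t 1 (fun s => crossp (f s) (g s)) (crossp a (g t) + crossp (f t) b).
Proof.
move=> [f1 f2] [g1 g2]; apply: dd_eq (ddB (ddM f1 g2) (ddM f2 g1)) _.
by rewrite /crossp; ring.
Qed.

Lemma vderiv_dotpl f t a u : vderiv f t a -> is_derive t 1 (fun s => dotp u (f s)) (dotp u a).
Proof.
move=> fa; apply: dd_eq (vderiv_dotp (vderiv_cst u t) fa) _.
by rewrite /dotp fst0 snd0; ring.
Qed.

Lemma vderiv_enorm f t a : vderiv f t a -> f t != 0 ->
  is_derive t 1 (fun s => enorm (f s)) (dotp (f t) a / enorm (f t)).
Proof.
move=> fa f0; apply: dd_eq (ddsqrt _ (vderiv_dotp fa fa)) _; first exact: dotp_gt0.
rewrite -/(enorm _) (dotpC a); have := lt0r_neq0 (enorm_gt0 f0) => n0.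
by field.
Qed.

Lemma vderiv_uniq f t a b : vderiv f t a -> vderiv f t b -> a = b.
Proof.
by move=> [f1 f2] [g1 g2]; apply: plane_eq; [exact: dd_uniq f1 g1|exact: dd_uniq f2 g2].
Qed.

Lemma vderiv_cont f t a : vderiv f t a -> forall e, 0 < e -> exists2 r, 0 < r &
  forall s, `|s - t| < r -> enorm (f s - f t) < e.
Proof.
move=> [f1 f2] e e0; have e2 : 0 < e / 2 by rewrite divr_gt0.
have [r1 r10 h1] := dd_cont f1 e2; have [r2 r20 h2] := dd_cont f2 e2.
exists (Num.min r1 r2); first by rewrite lt_min r10.
move=> s; rewrite lt_min => /andP[s1 s2].
apply: le_lt_trans (enorm_le_normr _) _; rewrite [e]splitr.
by apply: ltrD; [exact: h1|exact: h2].
Qed.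

End PlaneCalculus.

Section PiecewiseIntegral.
Variable R : realType.
Implicit Types (f h : R -> R) (a b x : R).
Local Notation mu := (@lebesgue_measure R).

Lemma continuous_primitive f a : continuous f -> exists W : R -> R,
  (forall x, a < x -> is_derive x 1 W (f x)) /\
  (forall x y, a < x -> x <= y -> (\int[mu]_(s in `]x, y[) f s)%R = W y - W x).
Proof.
move=> cf.
have intf x y : mu.-integrable `[x, y] (EFin \o f).
  apply: continuous_compact_integrable; first exact: segment_compact.
  exact: continuous_subspaceT.
exists (fun x => \int[mu]_(s in `[a, x]) f s)%R; split => [x ax|x y ax xy].
  have x1 : x < x + 1 by rewrite ltrDl.
  have [d1 d2] := continuous_FTC1_closed x1 (intf a (x + 1)) ax (cf x).
  by split => //; rewrite -derive1E.
rewrite Rintegral_itvB ?bnd_simp //; last exact: ltW.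
rewrite Rintegral_itv_bndo_bndc //.
have : mu.-integrable `]x, y] (EFin \o f).
  by apply: integrableS (intf x y) => //; exact: subset_itv_oc_cc.
by apply: integrableS => //; exact: subset_itv_oo_oc.
Qed.

Lemma integrable_point f x : mu.-integrable [set x] (EFin \o f).
Proof.
apply: null_set_integrable => //; first exact: measurable_fun_set1.
exact: lebesgue_measure_set1.
Qed.

Lemma integrable_setU f (A B : set R) : measurable A -> measurable B ->
  [disjoint A & B] -> mu.-integrable A (EFin \o f) ->
  mu.-integrable B (EFin \o f) -> mu.-integrable (A `|` B) (EFin \o f).
Proof.
move=> mA mB AB /integrableP[mfA iA] /integrableP[mfB iB]; apply/integrableP.
have mf := proj2 (measurable_funU _ mA mB) (conj mfA mfB).
split => //; rewrite ge0_integral_setU //; first exact: lte_add_pinfty.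
exact: measurableT_comp.
Qed.

Lemma integrable_itvU f x y z : x < y -> y < z ->
  mu.-integrable `[x, y] (EFin \o f) -> mu.-integrable `]y, z[ (EFin \o f) ->
  mu.-integrable `[x, z] (EFin \o f).
Proof.
move=> xy yz fxy fyz.
have fz := integrable_point f z.
have -> : [set` `[x, z]] = `[x, y] `|` (`]y, z[ `|` [set z]).
  rewrite setUitv1 ?bnd_simp //.
  by rewrite -itv_bndbnd_setU // bnd_simp ltW.
have d1 : [disjoint `]y, z[ & [set z]].
  by apply/disj_setPS => s [/=]; rewrite in_itv /= => /andP[_ sz] sE; rewrite sE ltxx in sz.
apply: integrable_setU => //; first by apply: measurableU.
  apply/disj_setPS => s [/=]; rewrite !in_itv /= => /andP[_ sy] [/andP[ys _]|sz].
    by move: (lt_le_trans ys sy); rewrite ltxx.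
  by rewrite sz leNgt yz in sy.
by apply: integrable_setU.
Qed.

(** [h] stands for the speed of the whole curve, known only inside the pieces. Finitely many points
    are negligible, so on each closed piece its integral up to a variable point is, up to a
    constant, a primitive of the smooth speed [w i]. *)
Lemma piecewise_integral (N : nat) (t : nat -> R) h (w : nat -> R -> R) :
  t 0%N = 0 -> (forall i, (i < N)%N -> t i < t i.+1) ->
  (forall i, (i < N)%N -> continuous (w i)) ->
  (forall i x, (i < N)%N -> t i < x < t i.+1 -> h x = w i x) ->
  exists W : nat -> R -> R, forall i, (i < N)%N ->
    (forall x, t i <= x <= t i.+1 -> is_derive x 1 (W i) (w i x)) /\
    (forall a b, t i <= a -> a <= b -> b <= t i.+1 ->
      (\int[mu]_(s in `[0, b]) h s)%R - (\int[mu]_(s in `[0, a]) h s)%R =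
      W i b - W i a).
Proof.
move=> t0 tlt cw hw.
have tge (i : nat) : (i <= N)%N -> 0 <= t i.
  elim: i => [|i IH] iN; first by rewrite t0.
  by apply: le_trans (IH (ltnW iN)) (ltW (tlt _ iN)).
have hint (i : nat) : (i <= N)%N -> mu.-integrable `[0, t i] (EFin \o h).
  elim: i => [|i IH] iN.
    by rewrite t0 set_itv1; exact: integrable_point.
  have I : mu.-integrable `]t i, t i.+1[ (EFin \o h).
    have wi : mu.-integrable `]t i, t i.+1[ (EFin \o w i).
      have : mu.-integrable `[t i, t i.+1] (EFin \o w i).
        apply: continuous_compact_integrable; first exact: segment_compact.
        by apply: continuous_subspaceT => x; exact: cw.
      by apply: integrableS => //; exact: subset_itv_oo_cc.
    apply: eq_integrable wi => // x; rewrite inE /= in_itv /= => xi.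
    by rewrite (hw i).
  (* For [i = 0] the part already covered is the single point 0, whereas gluing needs a
     nondegenerate left interval; the first piece is cut in the middle instead. *)
  case: (i =P 0%N) => [i0|/eqP i0].
    move: I; rewrite i0 t0 => I.
    have t1 : 0 < t 1%N by have := tlt 0%N; rewrite t0 i0 in iN *; apply.
    have m01 : mu.-integrable `[0, (t 1%N) / 2] (EFin \o h).
      have : mu.-integrable ([set 0] `|` `]0, (t 1%N)[) (EFin \o h).
        have Z := integrable_point h 0.
        apply: integrable_setU => //.
        by apply/disj_setPS => s [/= ->]; rewrite in_itv /= ltxx.
      apply: integrableS => //; first exact: measurableU.
      move=> s /=; rewrite !in_itv /= => /andP[]; rewrite le_eqVlt => /predU1P[->|->] s1.
        by left.
      by right; rewrite (le_lt_trans s1) // ltr_pdivrMr // mulr2n mulrDr mulr1 ltrDl.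
    apply: (@integrable_itvU _ 0 (t 1%N / 2)) => //.
    - by rewrite divr_gt0.
    - by rewrite ltr_pdivrMr // mulr2n mulrDr mulr1 ltrDl.
    - apply: integrableS I => //; apply: subset_itvr; rewrite bnd_simp.
      by rewrite divr_ge0 // ltW.
  apply: (@integrable_itvU _ 0 (t i)) => //; last exact: IH (ltnW iN).
  + case: i i0 iN {IH I} => // i _ iN.
    by apply: le_lt_trans (tge i (ltnW (ltnW iN))) (tlt _ (ltnW iN)).
  + exact: tlt.
have prim (i : nat) : exists Wi : R -> R, (i < N)%N ->
   (forall x, t i <= x <= t i.+1 -> is_derive x 1 Wi (w i x)) /\
   (forall a b, t i <= a -> a <= b -> b <= t i.+1 ->
      (\int[mu]_(s in `]a, b[) w i s)%R = Wi b - Wi a).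
  case: (ltnP i N) => iN; last by exists (fun=> 0).
  (* Starting to the left of [t i] makes the primitive differentiable at [t i] itself. *)
  have [Wi [W1 W2]] := continuous_primitive (t i - 1) (cw i iN).
  have lt1 x : t i <= x -> t i - 1 < x by apply: lt_le_trans; rewrite gtrBl.
  exists Wi => _; split => [x /andP[/lt1 x1 _]|a b /lt1 a1 ab _]; first exact: W1.
  exact: W2.
have [W hW] := choice prim.
exists W => i iN; have [W1 W2] := hW i iN; split => // a b ia ab bi.
rewrite -W2 //.
have hb : mu.-integrable `[0, b] (EFin \o h).
  apply: integrableS (hint _ iN) => //; apply: subset_itvl; by rewrite bnd_simp.
have a0 : 0 <= a by apply: le_trans ia; apply: tge; exact: ltnW.
rewrite Rintegral_itvB ?bnd_simp //.
rewrite -Rintegral_itv_bndo_bndc //.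
  apply: eq_Rintegral => x; rewrite inE /= in_itv /= => /andP[ax xb].
  by rewrite (hw i) // (le_lt_trans ia ax) (lt_le_trans xb bi).
apply: integrableS hb => // s /=; rewrite !in_itv /= => /andP[as_ sb].
by rewrite (le_trans a0 (ltW as_)) ltW.
Qed.

End PiecewiseIntegral.

(** * Periodic parametrization of the boundary *)

Section PeriodicBoundary.
Variable R : realType.
Implicit Types (K : set (plane R)) (c : R -> plane R) (L s t : R).

(* The 1-periodic extension of a boundary parametrization, with its pieces
   [pb_piece] on the intervals [tau j, tau j.+1], and its arc length [pb_len];
   [pb_prim j] is a primitive of the speed on the [j]-th interval. *)
Record periodic_boundary K L := PeriodicBoundary {
  pb_curve :> R -> plane R;
  pb_len : R -> R;
  pb_num : nat;
  pb_tau : nat -> R;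
  pb_piece : nat -> R -> plane R;
  pb_vel : nat -> R -> plane R;
  pb_acc : nat -> R -> plane R;
  pb_prim : nat -> R -> R;
  pb_num_gt0 : (0 < pb_num)%N;
  pb_tau0 : pb_tau 0 = 0;
  pb_tauN : forall j, pb_tau (j + pb_num) = pb_tau j + 1;
  pb_tau_lt : forall j, pb_tau j < pb_tau j.+1;
  pb_velP : forall j t, vderiv (pb_piece j) t (pb_vel j t);
  pb_accP : forall j t, vderiv (pb_vel j) t (pb_acc j t);
  pb_regular : forall j t, pb_tau j <= t <= pb_tau j.+1 -> pb_vel j t != 0;
  pb_curveE : forall j t, pb_tau j <= t <= pb_tau j.+1 -> pb_curve t = pb_piece j t;
  pb_curve_per : forall t, 0 <= t -> pb_curve (t + 1) = pb_curve t;
  pb_boundary : forall t, 0 <= t -> boundary K (pb_curve t);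
  pb_surj : forall z, boundary K z -> exists2 t, 0 <= t < 1 & pb_curve t = z;
  pb_inj : forall s t, 0 <= s -> s < t -> t < s + 1 -> pb_curve s != pb_curve t;
  pb_prim_derive : forall j t, pb_tau j <= t <= pb_tau j.+1 ->
    is_derive t 1 (pb_prim j) (enorm (pb_vel j t));
  pb_lenE : forall j s t, pb_tau j <= s <= pb_tau j.+1 -> pb_tau j <= t <= pb_tau j.+1 ->
    pb_len t - pb_len s = pb_prim j t - pb_prim j s;
  pb_len_per : forall t, 0 <= t -> pb_len (t + 1) = pb_len t + L }.

Lemma derive1_shift (V : normedModType R) (f : R -> V) (a t : R) :
  derive1 (fun s => f (s - a)) t = derive1 f (t - a).
Proof.
rewrite /derive1.
suff -> : (fun h : R => h^-1 *: (f (h + t - a) - f (t - a))) =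
          (fun h => h^-1 *: (f (h + (t - a)) - f (t - a))) by [].
by apply/funext => h; rewrite addrA.
Qed.

Lemma derivable_shift (V : normedModType R) (f : R -> V) (a t : R) :
  derivable f (t - a) 1 -> derivable (fun s => f (s - a)) t 1.
Proof.
rewrite /derivable; set F := (X in cvg (X @ _)) => cF.
set G := (X in cvg (X @ _)); suff -> : G = F by [].
by apply/funext => h; rewrite /G /F /= addrA.
Qed.

Lemma derive1n_shift (V : normedModType R) (f : R -> V) n (a : R) :
  derive1n n (fun s => f (s - a)) = fun t => derive1n n f (t - a).
Proof.
elim: n => [//|n IH]; rewrite !derive1nS IH.
by apply/funext => t; rewrite derive1_shift.
Qed.

Lemma smooth_curve_shift (g : R -> plane R) a : smooth_curve g ->
  smooth_curve (fun s => g (s - a)).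
Proof.
move=> sg n t; rewrite derive1n_shift; exact: (derivable_shift (sg n (t - a))).
Qed.

Lemma is_derive_shift (f : R -> R) (a t d : R) : is_derive (t - a) 1 f d ->
  is_derive t 1 (fun s => f (s - a)) d.
Proof.
move=> [fd <-]; split; first exact: derivable_shift.
by rewrite -!derive1E derive1_shift.
Qed.

Lemma derive1_near (V : normedModType R) (f g : R -> V) (t r : R) : 0 < r ->
  (forall s, `|s - t| < r -> f s = g s) -> derive1 f t = derive1 g t.
Proof.
move=> r0 fg; rewrite !derive1E; apply: near_eq_derive.
by exists r => // s /=; rewrite distrC => /fg.
Qed.

Lemma smooth_continuous_speed (g : R -> plane R) : smooth_curve g ->
  continuous (fun t => enorm (derive1 g t)).
Proof.
move=> sg t; have [d1 d2] := smooth_vderiv1 t sg.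
apply: (@continuous_comp _ _ _ (fun t => dotp (derive1 g t) (derive1 g t)) Num.sqrt).
  exact: dd_continuous (vderiv_dotp (smooth_vderiv1 t sg) (smooth_vderiv1 t sg)).
exact: sqrt_continuous.
Qed.

(** Interval [j] carries piece [j %% N] translated by [j %/ N]. The curve and its length are read
    off at the fractional part of the parameter, one full length being added for every completed
    turn. *)
Lemma periodic_boundary_exists K c : boundary_parametrization K c ->
  inhabited (periodic_boundary K (arc_length c)).
Proof.
move=> [cim c01 cinj [N [t [t0 tN tlt pieces]]]].
have N0 : (0 < N)%N.
  by case: N tN {tlt pieces} => // /eqP; rewrite t0 eq_sym oner_eq0.
have gex (i : nat) : exists gi : R -> plane R, (i < N)%N -> [/\ smooth_curve gi,
    {in `[t i, t i.+1], forall x, derive1 gi x != 0} & {in `[t i, t i.+1], c =1 gi}].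
  by case: (ltnP i N) => [/pieces[gi]|_]; [exists gi|exists (fun=> 0)].
have [g hg] := choice gex.
have tle (i j : nat) : (i <= j)%N -> (j <= N)%N -> t i <= t j.
  elim: j => [|j IH]; first by rewrite leqn0 => /eqP ->.
  rewrite leq_eqVlt => /predU1P[->//|ij] jN.
  by apply: le_trans (IH ij (ltnW jN)) (ltW (tlt _ jN)).
pose h s := enorm (derive1 c s).
have [W hW] : exists W : nat -> R -> R, forall i, (i < N)%N ->
    (forall x, t i <= x <= t i.+1 -> is_derive x 1 (W i) (enorm (derive1 (g i) x))) /\
    (forall a b, t i <= a -> a <= b -> b <= t i.+1 ->
      (\int[@lebesgue_measure R]_(s in `[0, b]) h s)%R -
      (\int[@lebesgue_measure R]_(s in `[0, a]) h s)%R = W i b - W i a).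
  apply: (@piecewise_integral R N t h (fun i x => enorm (derive1 (g i) x)) t0 tlt)
    => [i iN|i x iN /andP[ix xi]].
    by have [sg _ _] := hg i iN; exact: smooth_continuous_speed.
  have [sg _ cg] := hg i iN; rewrite /h; congr (enorm _).
  apply: (@derive1_near _ _ _ _ (Num.min (x - t i) (t i.+1 - x))).
    by rewrite lt_min !subr_gt0 ix.
  move=> s; rewrite lt_min => /andP[s1 s2]; apply: cg; rewrite in_itv /=.
  by move: s1 s2; rewrite !ltr_norml; lra.
pose L0 (x : R) : R := (\int[@lebesgue_measure R]_(s in `[0%R, x]) h s)%R.
have L01 : L0 1 = arc_length c by [].
have L00 : L0 0 = 0 by rewrite /L0 set_itv1 Rintegral_set1.
pose q (j : nat) : R := (j %/ N)%:R.
pose tau (j : nat) : R := t (j %% N)%N + q j.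
have modN j : (j %% N < N)%N by rewrite ltn_mod.
have tauS j : tau j.+1 = t (j %% N).+1 + q j.
  rewrite /tau /q; have := modN j; rewrite leq_eqVlt => /predU1P[jN|jN].
    have jS : (j.+1 = (j %/ N).+1 * N)%N.
      by rewrite {1}(divn_eq j N) -addnS jN mulSn addnC.
    by rewrite jS modnMl mulnK // t0 jN tN add0r -natr1 addrC.
  have jS : (j.+1 = (j %/ N) * N + (j %% N).+1)%N by rewrite addnS -divn_eq.
  by rewrite {1 2}jS modnMDl divnMDl // (modn_small jN) (divn_small jN) addn0.
pose cu s := c (s - (Num.truncn s)%:R).
pose G j s := g (j %% N)%N (s - q j).
have piece j s : tau j <= s <= tau j.+1 -> t (j %% N)%N <= s - q j <= t (j %% N).+1.
  by rewrite tauS /tau lerBrDr lerBlDr.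
have piece01 j s : tau j <= s <= tau j.+1 -> 0 <= s - q j <= 1.
  move/piece => /andP[h1 h2]; rewrite -t0 -tN.
  by rewrite (le_trans _ h1) ?(le_trans h2) // ?tle // ltnW.
(* At the right end of the last piece of a turn the integer part of the parameter already belongs to
   the next turn. The two readings agree there because [c 0 = c 1] and, for the length, because
   [L0 1] is the full length. *)
have trn j s : tau j <= s <= tau j.+1 ->
    (Num.truncn s = (j %/ N)%N \/ (s = (j %/ N).+1%:R /\ Num.truncn s = (j %/ N).+1)).
  move/piece01; rewrite /q subr_ge0 lerBlDl natr1 => /andP[h1].
  rewrite le_eqVlt => /predU1P[->|h2]; first by right; rewrite natrK.
  by left; apply: truncn_def; rewrite h1.
have cuE j s : tau j <= s <= tau j.+1 -> cu s = c (s - q j).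
  move=> js; rewrite /cu; case: (trn j s js) => [->//|[sE ->]].
  by rewrite /q sE subrr -natr1 addrAC subrr add0r c01.
pose La s := L0 (s - (Num.truncn s)%:R) + (Num.truncn s)%:R * arc_length c.
have LaE j s : tau j <= s <= tau j.+1 -> La s = L0 (s - q j) + q j * arc_length c.
  move=> js; rewrite /La; case: (trn j s js) => [->//|[sE ->]].
  rewrite /q sE subrr -natr1 addrAC subrr add0r L00 L01 add0r; ring.
have trn1 s : 0 <= s -> Num.truncn (s + 1) = (Num.truncn s).+1.
  move=> s0; apply: truncn_def; have /andP[h1 h2] := truncn_itv s0.
  by rewrite -!natr1 lerD2r h1 ltrD2r natr1.
have fr s : 0 <= s -> 0 <= s - (Num.truncn s)%:R < 1.
  by move=> s0; rewrite subr_ge0 ltrBlDl natr1; exact: truncn_itv.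
have bd01 s : 0 <= s <= 1 -> boundary K (c s).
  by move=> s01; rewrite -cim; exists s => //=; rewrite in_itv.
have smG j : smooth_curve (G j).
  by apply: smooth_curve_shift; have [] := hg _ (modN j).
exists; refine (@PeriodicBoundary K (arc_length c) cu La N tau G
  (fun j => derive1 (G j)) (fun j => derive1n 2 (G j)) (fun j s => W (j %% N)%N (s - q j)) N0 _ _ _ _ _ _ _ _ _ _ _ _ _ _).
- by rewrite /tau /q mod0n div0n t0 addr0.
- by move=> j; rewrite /tau /q modnDr divnDr // divnn N0 natrD addrA.
- by move=> j; rewrite tauS /tau ltrD2r tlt.
- by move=> j s; apply: smooth_vderiv0; exact: smG.
- by move=> j s; apply: smooth_vderiv1; exact: smG.
- move=> j s js; rewrite /G derive1_shift; have [_ + _] := hg _ (modN j).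
  by apply; rewrite in_itv /= piece.
- move=> j s js; rewrite (cuE j) // /G; have [_ _ +] := hg _ (modN j).
  by apply; rewrite in_itv /= piece.
- by move=> s s0; rewrite /cu trn1 // -natr1 opprD addrACA subrr addr0.
- by move=> s s0; apply: bd01; have /andP[-> /ltW ->] := fr s s0.
- move=> z; rewrite -cim => -[s /=]; rewrite in_itv /= => /andP[s0].
  have cus x : 0 <= x < 1 -> cu x = c x.
    by move=> x01; rewrite /cu (@truncn_def _ x 0) ?subr0.
  rewrite le_eqVlt => /predU1P[->|s1] <-.
    by exists 0; rewrite ?lexx ?ltr01 // cus ?lexx ?ltr01 // c01.
  by exists s; rewrite ?s0 // cus // s0.
- move=> s x s0 sx xs; apply/eqP => e.
  have x0 := le_trans s0 (ltW sx).
  have /andP[a1 a2] := fr s s0; have /andP[b1 b2] := fr x x0.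
  have /cinj : s - (Num.truncn s)%:R \in `[0, 1[ by rewrite in_itv /= a1.
  move=> /(_ (x - (Num.truncn x)%:R)); rewrite in_itv /= b1 => /(_ b2 e) E.
  have D : x - s = (Num.truncn x)%:R - (Num.truncn s)%:R.
    by move: E; move: (_%:R) (_%:R) => m n; lra.
  have D1 : 0 < (Num.truncn x)%:R - (Num.truncn s)%:R :> R by rewrite -D subr_gt0.
  have D2 : (Num.truncn x)%:R - (Num.truncn s)%:R < 1 :> R by rewrite -D ltrBlDl.
  move: D1 D2; rewrite subr_gt0 ltr_nat ltrBlDl natr1 ltr_nat ltnS => h1 h2.
  by rewrite ltnNge h2 in h1.
- move=> j s js; rewrite /G derive1_shift; apply: is_derive_shift.
  by apply: (hW _ (modN j)).1; exact: piece.
- move=> j a b ja jb; rewrite !(LaE j) // opprD addrACA subrr addr0.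
  have /andP[a1 a2] := piece _ _ ja; have /andP[b1 b2] := piece _ _ jb.
  have [_ WW] := hW _ (modN j).
  case: (leP a b) => [ab|/ltW ba].
    by rewrite -WW // lerD2r.
  by apply: oppr_inj; rewrite !opprB -WW // lerD2r.
- move=> s s0; rewrite /La trn1 // -natr1 opprD addrACA subrr addr0.
  by rewrite mulrDl mul1r addrA.
Qed.

End PeriodicBoundary.

Section OneSided.
Variable R : realType.
Implicit Types (f : R -> R) (t s a b d e : R).

Lemma dd_limit_ge0 f t a b d : is_derive t 1 f d -> a < b -> a <= t <= b ->
  (forall s, a < s < b -> 0 <= f s) -> 0 <= f t.
Proof.
move=> fd ab /andP[at_ tb] f0; rewrite leNgt; apply/negP => ft.
have ft' : 0 < - f t by rewrite oppr_gt0.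
have [r r0 h] := dd_cont fd ft'.
have [s [sab sr]] : exists s, a < s < b /\ `|s - t| < r.
  case: (ltP t b) => [tb'|bt].
    have m0 : 0 < Num.min (b - t) r by rewrite lt_min subr_gt0 tb'.
    have m1 : Num.min (b - t) r <= b - t by rewrite ge_min lexx.
    have m2 : Num.min (b - t) r <= r by rewrite ge_min lexx orbT.
    exists (t + Num.min (b - t) r / 2); move: (Num.min _ _) m0 m1 m2 => m m0 m1 m2.
    by split; [apply/andP; split; lra|rewrite gtr0_norm; lra].
  have m0 : 0 < Num.min (t - a) r by rewrite lt_min subr_gt0 r0 (lt_le_trans ab bt).
  have m1 : Num.min (t - a) r <= t - a by rewrite ge_min lexx.
  have m2 : Num.min (t - a) r <= r by rewrite ge_min lexx orbT.
  exists (t - Num.min (t - a) r / 2); move: (Num.min _ _) m0 m1 m2 => m m0 m1 m2.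
  by split; [apply/andP; split; lra|rewrite ltr0_norm; lra].
have := h s sr; have := f0 s sab => fs; rewrite gtr0_norm; lra.
Qed.

Lemma dd_right_ge0 f t b d : is_derive t 1 f d -> t < b ->
  (forall s, t <= s <= b -> f t <= f s) -> 0 <= d.
Proof.
move=> fd tb fmin; rewrite leNgt; apply/negP => d0.
have dn : 0 < - d by rewrite oppr_gt0.
have [r r0 h] := dd_pos_right (ddN fd) dn.
have m0 : 0 < Num.min (b - t) r by rewrite lt_min subr_gt0 tb.
have m1 : Num.min (b - t) r <= b - t by rewrite ge_min lexx.
have m2 : Num.min (b - t) r <= r by rewrite ge_min lexx orbT.
move: (Num.min _ _) m0 m1 m2 => m m0 m1 m2.
have [] := h (t + m / 2); first by rewrite gtr0_norm; lra.
have h1 : t < t + m / 2 by lra.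
move=> /(_ h1); rewrite ltrN2 => h2 _.
have ff : f t <= f (t + m / 2) by apply: fmin; apply/andP; split; lra.
by have := lt_le_trans h2 ff; rewrite ltxx.
Qed.

Lemma dd_left_le0 f t a d : is_derive t 1 f d -> a < t ->
  (forall s, a <= s <= t -> f t <= f s) -> d <= 0.
Proof.
move=> fd at_ fmin; rewrite leNgt; apply/negP => d0.
have [r r0 h] := dd_pos_right fd d0.
have m0 : 0 < Num.min (t - a) r by rewrite lt_min subr_gt0 at_.
have m1 : Num.min (t - a) r <= t - a by rewrite ge_min lexx.
have m2 : Num.min (t - a) r <= r by rewrite ge_min lexx orbT.
move: (Num.min _ _) m0 m1 m2 => m m0 m1 m2.
have [] := h (t - m / 2); first by rewrite ltr0_norm; lra.
have h1 : t - m / 2 < t by lra.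
move=> _ /(_ h1) h2.
have ff : f t <= f (t - m / 2) by apply: fmin; apply/andP; split; lra.
by have := lt_le_trans h2 ff; rewrite ltxx.
Qed.

Lemma dd_second_ge0 f df t b d2 : (forall s, t <= s <= b -> is_derive s 1 f (df s)) ->
  is_derive t 1 df d2 -> t < b -> df t = 0 ->
  (forall s, t <= s <= b -> f t <= f s) -> 0 <= d2.
Proof.
move=> fd dfd tb df0 fmin; rewrite leNgt; apply/negP => d0.
have dn : 0 < - d2 by rewrite oppr_gt0.
have [r r0 h] := dd_pos_right (ddN dfd) dn.
have m0 : 0 < Num.min (b - t) r by rewrite lt_min subr_gt0 tb.
have m1 : Num.min (b - t) r <= b - t by rewrite ge_min lexx.
have m2 : Num.min (b - t) r <= r by rewrite ge_min lexx orbT.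
move: (Num.min _ _) m0 m1 m2 => m m0 m1 m2.
have [c tc e] : exists2 c, t < c < t + m / 2 & f (t + m / 2) - f t = df c * (t + m / 2 - t).
  apply: dd_mvt; first by lra.
  by move=> x /andP[x1 x2]; apply: fd; apply/andP; split; lra.
have [] := h c; first by rewrite gtr0_norm; lra.
move=> /(_ (andP tc).1); rewrite ltrN2 df0 => dc _.
have : f t <= f (t + m / 2) by apply: fmin; apply/andP; split; lra.
rewrite -subr_ge0 e addrAC subrr add0r pmulr_lge0; last by lra.
by rewrite leNgt dc.
Qed.

Lemma dd_pos_near f t d : is_derive t 1 f d -> 0 < f t ->
  exists2 r, 0 < r & forall s, `|s - t| < r -> 0 < f s.
Proof.
move=> fd f0; have [r r0 h] := dd_cont fd f0; exists r => // s /h.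
by rewrite ltr_norml => /andP[]; lra.
Qed.

End OneSided.

Section PlaneLemmas.
Variable R : realType.
Implicit Types (K : set (plane R)) (u v w n P : plane R) (e : R).

Lemma dotp_rot2 u v : dotp (rot u) (rot v) = dotp u v.
Proof. by rewrite /dotp /rot /=; ring. Qed.

Lemma crossp_eq0_parallel u v : u != 0 -> crossp u v = 0 ->
  v = (dotp u v / dotp u u) *: u.
Proof.
move=> u0 uv0; have uu0 := lt0r_neq0 (dotp_gt0 u0).
apply: plane_eq; rewrite !plE; apply: (mulIf uu0); rewrite mulrAC divfK //.
  transitivity (dotp u v * u.1 - u.2 * crossp u v).
    by rewrite /dotp /crossp; ring.
  by rewrite uv0; ring.
transitivity (dotp u v * u.2 + u.1 * crossp u v).
  by rewrite /dotp /crossp; ring.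
by rewrite uv0; ring.
Qed.

(* Near a boundary point with inner normal [n], the boundary is a graph over the
   tangent line. *)
Lemma graph_unique K n n1 n2 w1 w2 (l : R) : K w1 -> K w2 ->
  (forall w, K w -> 0 <= dotp n1 (w - w1)) -> (forall w, K w -> 0 <= dotp n2 (w - w2)) ->
  0 < dotp n1 n -> 0 < dotp n2 n -> w1 - w2 = l *: n -> w1 = w2.
Proof.
move=> K1 K2 s1 s2 n1n n2n e; have := s1 _ K2; have := s2 _ K1.
rewrite -(opprB w1 w2) e dotpNr !dotpZr pmulr_lge0 // oppr_ge0 pmulr_lle0 // => l1 l2.
apply/eqP; rewrite -subr_eq0 e; have -> : l = 0 by apply/eqP; rewrite eq_le l1 l2.
by rewrite scale0r.
Qed.

(* At a corner the tangent turns towards the body, so the component of [P] along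
   it drops. *)
Lemma turn_le e u v P : e ^+ 2 = 1 -> dotp u u = 1 -> dotp v v = 1 ->
  0 <= e * crossp u v -> e * crossp u P < 0 -> e * crossp v P < 0 ->
  dotp P v <= dotp P u ?= iff (u == v).
Proof.
move=> e2 uu vv; set s := e * crossp u v => s0 Y0 Z0.
set c := dotp u v; set x := dotp P u; set Y := - (e * crossp u P).
have Yp : 0 < Y by rewrite oppr_gt0.
have cs : c ^+ 2 + s ^+ 2 = 1.
  rewrite /s exprMn e2 mul1r -[1](mulr1 1) -{1}uu -vv /c /dotp /crossp; ring.
have vE : v = c *: u + (e * s) *: rot u.
  rewrite /s mulrA -expr2 e2 mul1r; apply: plane_eq; rewrite !plE /c /rot /dotp /crossp /=.
    by rewrite -[LHS]mulr1 -uu /dotp; ring.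
  by rewrite -[LHS]mulr1 -uu /dotp; ring.
have Z : e * crossp v P = - (c * Y) - s * x.
  rewrite {1}vE -[X in _ - X]mul1r -e2 /Y /x /crossp /rot !plE /dotp /=; ring.
have PE : dotp P v = c * x - s * Y.
  by rewrite {1}vE /Y /x /dotp /crossp /rot !plE /=; ring.
have cx : 0 < c * Y + s * x by move: Z0; rewrite Z; lra.
have c1 : c <= 1 by nra.
(* Multiplied by [s], the difference of the two sides is [(1 - c) (c Y + s x) + (1 - c) Y], and both
   terms are positive. *)
have main : s != 0 -> c * x - s * Y < x.
  move=> sn; have sp : 0 < s by rewrite lt_def sn.
  have c1' : c < 1.
    rewrite lt_neqAle c1 andbT; apply: contra sn => /eqP c1'.
    by move: cs; rewrite c1' expr1n -sqrf_eq0 => cs; apply/eqP; lra.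
  rewrite -(ltr_pM2l sp).
  have : 0 < (1 - c) * (c * Y + s * x) by rewrite mulr_gt0 // subr_gt0.
  have : 0 < (1 - c) * Y by rewrite mulr_gt0 // subr_gt0.
  have -> : s * (c * x - s * Y) = s * c * x - s ^+ 2 * Y by ring.
  have -> : s ^+ 2 = 1 - c ^+ 2 by rewrite -cs addrC addKr.
  by rewrite expr2; nra.
case: (eqVneq s 0) => [s0'|sn].
  have c1' : c = 1.
    move: cs cx; rewrite s0' expr0n addr0 mul0r addr0 pmulr_lgt0 // => cc c0.
    by apply/eqP; rewrite -(eqrXn2 (n := 2)) ?ltW // cc expr1n.
  have uv : u = v by rewrite vE s0' c1' mulr0 scale0r addr0 scale1r.
  by rewrite /x uv eqxx; split; rewrite ?lexx ?eqxx.
have uv : u == v = false.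
  apply: contraNF sn => /eqP uv; rewrite /s uv /crossp; apply/eqP; ring.
by rewrite uv; apply/leifP; rewrite PE main.
Qed.

End PlaneLemmas.

(** Interiority expressed through supporting half-planes, [n] being any inner normal at a point of
    [K]. The upper bound uses the center of gravity in this form. *)
Definition strictly_inside (R : realType) (K : set (plane R)) (p : plane R) : Prop :=
  forall z n, K z -> n != 0 -> (forall w, K w -> 0 <= dotp n (w - z)) ->
    0 < dotp n (p - z).

(** * Orientation of the boundary curve *)

Section Orientation.
Variables (R : realType) (K : set (plane R)) (L : R) (P : periodic_boundary K L).
Variable p : plane R.
Hypotheses (cK : compact K) (vK : convex_set K) (pK : strictly_inside K p).
Implicit Types (j k : nat) (s t e : R) (w z n : plane R).
Local Notation tau := (pb_tau P).
Local Notation G := (pb_piece P).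

Local Notation vel := (pb_vel P).
Local Notation acc := (pb_acc P).

(** Closed at both ends: a subdivision point belongs to two pieces, and naming the piece tells its
    two one-sided tangents apart. *)
Definition in_piece j t : Prop := tau j <= t <= tau j.+1.

Lemma tau_ge0 j : 0 <= tau j.
Proof.
elim: j => [|j IH]; first by rewrite pb_tau0.
exact: le_trans IH (ltW (pb_tau_lt P j)).
Qed.

Lemma in_piece_ge0 j t : in_piece j t -> 0 <= t.
Proof. by case/andP => h _; apply: le_trans h; exact: tau_ge0. Qed.

Lemma in_piece_l j : in_piece j (tau j).
Proof. by rewrite /in_piece lexx ltW // pb_tau_lt. Qed.

Lemma in_piece_r j : in_piece j (tau j.+1).
Proof. by rewrite /in_piece lexx ltW // pb_tau_lt. Qed.

Lemma vel_neq0 j t : in_piece j t -> vel j t != 0.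
Proof. exact: pb_regular. Qed.

Lemma curve_boundary t : 0 <= t -> K (P t).
Proof. by move=> t0; case: (proj1 (compact_boundary _ cK) (pb_boundary P t0)). Qed.

Lemma piece_vderiv j t : vderiv (G j) t (vel j t).
Proof. exact: pb_velP. Qed.

Lemma velocity_vderiv j t : vderiv (vel j) t (acc j t).
Proof. exact: pb_accP. Qed.

Lemma pieceB_vderiv j w t : vderiv (fun s => G j s - w) t (vel j t).
Proof. exact: vderivB_cst (piece_vderiv j t). Qed.

Lemma piece_vderivN w j t : vderiv (fun s => w - G j s) t (- vel j t).
Proof.
have [h1 h2] := piece_vderiv j t; split.
  by apply: dd_eq (ddB (ddc w.1 t) h1) _; rewrite sub0r.
by apply: dd_eq (ddB (ddc w.2 t) h2) _; rewrite sub0r.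
Qed.

Lemma dd_cross_cst u j w t : is_derive t 1 (fun s => crossp u (G j s - w)) (crossp u (vel j t)).
Proof.
apply: dd_eq (vderiv_crossp (vderiv_cst u t) (pieceB_vderiv j w t)) _.
by rewrite crossp0l add0r.
Qed.

Lemma dd_cross_vel j w t :
  is_derive t 1 (fun s => crossp (vel j s) (w - G j s)) (crossp (acc j t) (w - G j t)).
Proof.
apply: dd_eq (vderiv_crossp (velocity_vderiv j t) (piece_vderivN w j t)) _.
by rewrite (crosspNr (vel j t)) crosspp oppr0 addr0.
Qed.

Lemma dd_scale (f : R -> R) e t d : is_derive t 1 f d -> is_derive t 1 (fun s => e * f s) (e * d).
Proof. by move=> fd; apply: dd_eq (ddM (ddc e t) fd) _; rewrite mul0r add0r. Qed.

(** A supporting normal at an interior parameter is orthogonal to the velocity, because the height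
    above the supporting line has a local minimum there. The product of two cross products avoids
    deciding on which side of the tangent [K] lies. *)
Lemma interior_tangent j t : tau j < t < tau j.+1 ->
  crossp (vel j t) (p - P t) != 0 /\
  forall w, K w -> 0 <= crossp (vel j t) (p - P t) * crossp (vel j t) (w - P t).
Proof.
move=> /andP[jt tj]; have jtj : in_piece j t by rewrite /in_piece !ltW.
have t0 := in_piece_ge0 jtj.
have [n n0 sn] := support_normal cK vK (ex_intro _ _ (curve_boundary t0)) (pb_boundary P t0).
have nv : dotp n (vel j t) = 0.
  have fd := ddN (vderiv_dotpl n (pieceB_vderiv j (P t) t)).
  apply/oppr_inj; rewrite oppr0.
  apply: (dd_local_max fd (r := Num.min (t - tau j) (tau j.+1 - t))).
    by rewrite lt_min !subr_gt0 jt.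
  move=> s; rewrite lt_min => /andP[s1 s2].
  have js : in_piece j s by move: s1 s2; rewrite !ltr_norml /in_piece => *; apply/andP; split; lra.
  rewrite -!(pb_curveE js) -!(pb_curveE jtj) subrr dotp0r oppr0 oppr_le0.
  by apply: sn; apply: curve_boundary; exact: in_piece_ge0 js.
rewrite dotpC in nv; have nE := dotp_eq0_parallel (vel_neq0 jtj) nv.
set l := _ / _ in nE.
have nw w : dotp n w = l * crossp (vel j t) w by rewrite nE dotpZl dotp_rot.
have l0 : l != 0 by apply: contra_neq n0 => l0; rewrite nE l0 scale0r.
have := pK (curve_boundary t0) n0 sn; rewrite nw => lo.
split=> [|w Kw]; first by apply: contraTneq lo => ->; rewrite mulr0 ltxx.
have := sn w Kw; rewrite nw => lw; set A := crossp _ (p - _) in lo *.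
set B := crossp _ (w - _) in lw *.
have l2 : 0 < l ^+ 2 by rewrite lt_def sqrf_eq0 l0 sqr_ge0.
rewrite -(pmulr_rge0 _ l2); have -> : l ^+ 2 * (A * B) = (l * A) * (l * B) by ring.
by rewrite mulr_ge0 // ltW.
Qed.

(** For [e = 1] the body lies to the left of the velocity, that is, the boundary is run through
    counterclockwise; for [e = -1] it lies to the right. *)
Definition supporting e j t : Prop :=
  forall w, K w -> 0 <= e * crossp (vel j t) (w - P t).

Lemma supporting_strict e j t : e ^+ 2 = 1 -> in_piece j t -> supporting e j t ->
  0 < e * crossp (vel j t) (p - P t).
Proof.
move=> e2 jt se; have t0 := in_piece_ge0 jt.
have e0 : e != 0 by apply: contra_eq_neq e2 => ->; rewrite expr0n eq_sym oner_eq0.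
have n0 : e *: rot (vel j t) != 0.
  rewrite scaler_eq0 negb_or e0 -dotp_eq0 dotp_rot2 dotp_eq0; exact: vel_neq0.
have := pK (curve_boundary t0) n0; rewrite dotpZl dotp_rot; apply => w Kw.
by rewrite dotpZl dotp_rot; exact: se.
Qed.

(** Inside the piece [p] is never on the tangent line, so by the intermediate value theorem it stays
    on one side of it; the ends of the piece follow by continuity. *)
Lemma piece_orientation j : exists2 e, e ^+ 2 = 1 & forall t, in_piece j t -> supporting e j t.
Proof.
pose t0 := (tau j + tau j.+1) / 2; have jlt := pb_tau_lt P j.
have t0j : tau j < t0 < tau j.+1 by rewrite /t0; apply/andP; split; lra.
pose o t := crossp (vel j t) (p - G j t).
have od t : is_derive t 1 o (crossp (acc j t) (p - G j t)) by exact: dd_cross_vel.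
have oE t : in_piece j t -> o t = crossp (vel j t) (p - P t).
  by move=> jt; rewrite (pb_curveE jt).
have on t : tau j < t < tau j.+1 -> o t != 0.
  by move=> h; rewrite oE; [exact: (interior_tangent h).1|rewrite /in_piece; case/andP: h => *; rewrite !ltW].
have o0 := on _ t0j.
pose e := Num.sg (o t0).
have e2 : e ^+ 2 = 1 by rewrite sqr_sg o0.
have e1 : 0 < e * o t0 by rewrite -normrEsg normr_gt0.
exists e => //.
have eo t : tau j < t < tau j.+1 -> 0 < e * o t.
  move=> ht; rewrite ltNge; apply/negP => ot.
  have dd (x d : R) : is_derive x 1 o d -> is_derive x 1 (fun y : R => e * o y) (e * d).
    exact: dd_scale.
  have [c [cj ec]] : exists c, tau j < c < tau j.+1 /\ e * o c = 0.
    case/andP: ht => h1 h2; case/andP: t0j => h3 h4.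
    case: (leP t t0) => tt.
      have [c /andP[c1 c2] ec] := @dd_ivt _ (fun y => e * o y) _ t t0 0 tt
        (fun x _ => dd x _ (od x)) (introT andP (conj ot (ltW e1))).
      by exists c; split => //; apply/andP; split; lra.
    have ddn (x : R) : is_derive x 1 (fun y : R => - (e * o y)) (- (e * crossp (acc j x) (p - G j x))).
      by apply: ddN; exact: dd.
    have a1 : - (e * o t0) <= 0 <= - (e * o t) by rewrite oppr_le0 oppr_ge0 (ltW e1).
    have [c /andP[c1 c2] ec] := @dd_ivt _ (fun y => - (e * o y)) _ t0 t 0 (ltW tt)
        (fun x _ => ddn x) a1.
    by exists c; split; [apply/andP; split; lra|lra].
  move/eqP: ec; rewrite mulf_eq0 (negbTE (on _ cj)) orbF => /eqP ec.
  by move/eqP: e2; rewrite ec expr0n eq_sym oner_eq0.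
move=> t jt w Kw; rewrite (pb_curveE jt).
have fd := dd_scale e (dd_cross_vel j w t).
apply: (dd_limit_ge0 fd jlt jt) => s js.
have js' : in_piece j s by rewrite /in_piece; case/andP: js => *; rewrite !ltW.
have [_ /(_ w Kw)] := interior_tangent js; rewrite -(pb_curveE js') -oE // => ow.
have := eo _ js; set B := crossp _ (w - _) in ow *; move: ow; move: (o s) => A AB eA.
have : 0 <= (e ^+ 2) * (A * B) by rewrite e2 mul1r.
have -> : e ^+ 2 * (A * B) = (e * A) * (e * B) by ring.
by rewrite pmulr_rge0.
Qed.

(** If the sense were reversed at the junction, each piece would lie in the supporting half-plane of
    the other and the two velocities would be opposite: the curve would turn back. Both branches
    would then be graphs over the same half-line near the junction and share a point, against
    injectivity. *)
Lemma orientation_step e e' j : e ^+ 2 = 1 -> e' ^+ 2 = 1 ->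
  (forall t, in_piece j t -> supporting e j t) ->
  (forall t, in_piece j.+1 t -> supporting e' j.+1 t) -> e = e'.
Proof.
move=> e2 e2' S S'; apply/eqP; apply: contrapT => /negP ne.
have eN : e' = - e.
  move/eqP: e2; rewrite -e2' eqf_sqr => /orP[/eqP ee|/eqP ->]; last by rewrite opprK.
  by rewrite ee eqxx in ne.
have e0 : e != 0 by apply: contra_eq_neq e2 => ->; rewrite expr0n eq_sym oner_eq0.
set t := tau j.+1; set v := vel j t; set u := vel j.+1 t.
have jt : in_piece j t := in_piece_r j.
have jt' : in_piece j.+1 t := in_piece_l j.+1.
have u0 : u != 0 := vel_neq0 jt'.
have uu : 0 < dotp u u := dotp_gt0 u0.
have lt1 := pb_tau_lt P j; have lt2 := pb_tau_lt P j.+1.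
have c1 : 0 <= e * crossp v u.
  have fd := dd_scale e (dd_cross_cst v j.+1 (P t) t).
  apply: (dd_right_ge0 fd lt2) => s /andP[s1 s2].
  have js : in_piece j.+1 s by rewrite /in_piece s1.
  rewrite -(pb_curveE jt') subrr -(pb_curveE js) crossp0r mulr0.
  by apply: (S _ jt); apply: curve_boundary; exact: in_piece_ge0 js.
have c2 : e' * crossp u v <= 0.
  have fd := dd_scale e' (dd_cross_cst u j (P t) t).
  apply: (dd_left_le0 fd lt1) => s /andP[s1 s2].
  have js : in_piece j s by rewrite /in_piece s1.
  rewrite -(pb_curveE jt) subrr -(pb_curveE js) crossp0r mulr0.
  by apply: (S' _ jt'); apply: curve_boundary; exact: in_piece_ge0 js.
have uv0 : crossp u v = 0.
  have h : e * crossp u v = 0.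
    apply/eqP; rewrite eq_le; move: c1 c2; rewrite eN.
    by rewrite (crosspC v u) (mulrN e) (mulNr e) oppr_le0 oppr_ge0 => -> ->.
  by move/eqP: h; rewrite mulf_eq0 (negbTE e0) => /eqP.
have := crossp_eq0_parallel u0 uv0; set m := _ / _ => vE.
have m0 : m < 0.
  have := supporting_strict e2 jt (S _ jt); have := supporting_strict e2' jt' (S' _ jt').
  rewrite -/v -/u eN vE; set q := p - _.
  rewrite crosspZl => h1; rewrite mulrCA => h2; rewrite ltNge; apply/negP => m0.
  have : e * crossp u q < 0 by rewrite mulNr in h1; lra.
  by move=> h3; move: h2; rewrite ltNge mulr_ge0_le0 // ltW.
have uvn : dotp u v < 0 by rewrite vE dotpZr nmulr_rlt0.
have [r1 r10 h1] := dd_pos_right (vderiv_dotpl u (pieceB_vderiv j.+1 (P t) t)) uu.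
have uvn' : 0 < - dotp u v by rewrite oppr_gt0.
have [r2 r20 h2] := dd_pos_right (ddN (vderiv_dotpl u (pieceB_vderiv j (P t) t))) uvn'.
have [r3 r30 h3] := dd_pos_near (vderiv_dotpl u (velocity_vderiv j.+1 t)) uu.
have [r4 r40 h4] := dd_pos_near (ddN (vderiv_dotpl u (velocity_vderiv j t))) uvn'.
(* [d < 1 / 2] keeps the two parameters found below within one period, where the curve is
   injective. *)
have [d d0 [dr [dl1 dl2 d2]]] : exists2 d, 0 < d &
    [/\ d < r1, d < r2, d < r3 & d < r4] /\ [/\ d <= tau j.+2 - t, d <= t - tau j & d < 1 / 2].
  pose d := Num.min (Num.min (Num.min r1 r2) (Num.min r3 r4))
     (Num.min (Num.min (tau j.+2 - t) (t - tau j)) 1).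
  have d0 : 0 < d by rewrite /d !lt_min r10 r20 r30 r40 !subr_gt0 lt1 lt2 ltr01.
  have h : [/\ d <= r1, d <= r2, d <= r3 & d <= r4].
    by rewrite /d !ge_min !lexx !orbT.
  have h' : [/\ d <= tau j.+2 - t, d <= t - tau j & d <= 1].
    by rewrite /d !ge_min !lexx !orbT.
  clear -d0 h h'; move: d d0 h h' => d d0 [] ? ? ? ? [] ? ? ?; exists (d / 3); first lra.
  by split; split; lra.
case: dr => dr1 dr2 dr3 dr4.
pose X1 s := dotp u (G j.+1 s - P t); pose X2 s := dotp u (G j s - P t).
have X10 : X1 t = 0 by rewrite /X1 -(pb_curveE jt') subrr dotp0r.
have X20 : X2 t = 0 by rewrite /X2 -(pb_curveE jt) subrr dotp0r.
have X1p : 0 < X1 (t + d).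
  have td : t < t + d by rewrite ltrDl.
  have [|+ _] := h1 (t + d); first by rewrite addrC addKr gtr0_norm.
  by move=> /(_ td); rewrite -/(X1 _) -/(X1 _) X10.
have X2p : 0 < X2 (t - d).
  have td : t - d < t by rewrite gtrBl.
  have [|_] := h2 (t - d); first by rewrite addrAC subrr add0r normrN gtr0_norm.
  by move=> /(_ td); rewrite -/(X2 _) -/(X2 _) X20 ltrN2.
(* A tangential coordinate that both branches reach. *)
pose xi := Num.min (X1 (t + d)) (X2 (t - d)).
have xi0 : 0 < xi by rewrite lt_min X1p.
have xi1 : X1 t <= xi <= X1 (t + d) by rewrite X10 ltW //= ge_min lexx.
have tdl : t <= t + d by rewrite lerDl ltW.
have [s1 /andP[a1 a2] E1] := dd_ivt tdl (fun x _ => vderiv_dotpl u (pieceB_vderiv j.+1 (P t) x)) xi1.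
have xi2 : - X2 (t - d) <= - xi <= - X2 t by rewrite X20 oppr0 lerN2 oppr_le0 (ltW xi0) andbT ge_min lexx orbT.
have tdl2 : t - d <= t by rewrite gerBl ltW.
have [s2 /andP[b1 b2] E2] := dd_ivt tdl2 (fun x _ => ddN (vderiv_dotpl u (pieceB_vderiv j (P t) x))) xi2.
have js1 : in_piece j.+1 s1 by rewrite /in_piece a1 /=; apply: (le_trans a2); rewrite -lerBrDl.
have js2 : in_piece j s2 by rewrite /in_piece b2 andbT; apply: le_trans b1; rewrite lerBrDr -lerBrDl.
have s1t : t < s1.
  rewrite lt_def a1 andbT; apply: contraTneq xi0 => st.
  by rewrite -E1 st -/(X1 t) X10 ltxx.
have d1 : 0 < dotp u (vel j.+1 s1) by apply: h3; rewrite ger0_norm ?subr_ge0 // ltrBlDl (le_lt_trans a2) // ltrD2l.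
have d3 : dotp u (vel j s2) < 0.
  by rewrite -oppr_gt0; apply: h4; rewrite ler0_norm ?subr_le0 // opprB ltrBlDr -ltrBlDl (lt_le_trans _ b1) // ltrD2l ltrN2.
have s20 := in_piece_ge0 js2; have s10 := in_piece_ge0 js1.
have : P s2 != P s1 by apply: (pb_inj P s20); clear -b2 s1t a2 b1 d2; lra.
move=> /eqP; apply; apply/esym.
have D0 : dotp u (P s1 - P s2) = 0.
  have -> : P s1 - P s2 = (P s1 - P t) - (P s2 - P t) by rewrite opprB addrA subrK.
  rewrite dotpBr (pb_curveE js1) (pb_curveE js2); move/oppr_inj: E2 => ->.
  by rewrite E1 subrr.
have W := dotp_eq0_parallel u0 D0.
apply: (@graph_unique _ K (e' *: rot u) (e' *: rot (vel j.+1 s1)) (e *: rot (vel j s2))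
  (P s1) (P s2) (e' * (crossp u (P s1 - P s2) / dotp u u))).
- exact: curve_boundary.
- exact: curve_boundary.
- by move=> w Kw; rewrite dotpZl dotp_rot; exact: S'.
- by move=> w Kw; rewrite dotpZl dotp_rot; exact: S.
- by rewrite dotpZl dotpZr dotp_rot2 mulrA -expr2 e2' mul1r dotpC.
- by rewrite dotpZl dotpZr dotp_rot2 eN mulrA mulrN -expr2 e2 mulN1r oppr_gt0 dotpC.
- by rewrite scalerA mulrAC -expr2 e2' mul1r.
Qed.

Lemma orientation : exists2 e, e ^+ 2 = 1 & forall j t, in_piece j t -> supporting e j t.
Proof.
have [e e2 S0] := piece_orientation 0; exists e => //.
elim=> [//|j IH]; have [e' e2' S'] := piece_orientation j.+1.
by rewrite (orientation_step e2 e2' IH S').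
Qed.

End Orientation.

(** * Distance to the normal lines *)

Section TangentialDistance.
Variables (R : realType) (K : set (plane R)) (L : R) (P : periodic_boundary K L).
Variables (p : plane R) (e : R).
Implicit Types (i j k n : nat) (s t x : R) (w z : plane R).
Local Notation tau := (pb_tau P).
Local Notation G := (pb_piece P).
Local Notation vel := (pb_vel P).
Local Notation acc := (pb_acc P).
Local Notation len := (pb_len P).
Local Notation in_piece := (in_piece P).
Hypotheses (cK : compact K) (pK : strictly_inside K p).
Hypotheses (e2 : e ^+ 2 = 1) (eK : forall j t, in_piece j t -> supporting P e j t).

Definition speed j t : R := enorm (vel j t).
Definition tangent j t : plane R := (speed j t)^-1 *: vel j t.
(* The signed distance from [p] to the normal line of the boundary. *)
Definition tdist j t : R := dotp (G j t - p) (vel j t) / speed j t.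
(* Nondecreasing: along a piece [tdist] grows at most as fast as arc length, by
   convexity, and it drops at the corners. *)
Definition psi j t : R := len t - tdist j t.
(** Lexicographic: at a junction the end of one piece precedes the start of the next. *)
Definition param_le j s k t : Prop := (j < k)%N \/ (j = k /\ s <= t).

Lemma inner_crossp_gt0 j t : in_piece j t -> 0 < e * crossp (vel j t) (p - P t).
Proof. by move=> jt; apply: supporting_strict => //; exact: eK. Qed.

Lemma speed_gt0 j t : in_piece j t -> 0 < speed j t.
Proof. by move=> jt; apply: enorm_gt0; exact: vel_neq0. Qed.

Lemma dotp_tangent j t : in_piece j t -> dotp (tangent j t) (tangent j t) = 1.
Proof.
move=> jt; have w0 := lt0r_neq0 (speed_gt0 jt).
rewrite /tangent dotpZl dotpZr -enorm_sqr -/(speed j t).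
by move: (speed j t) w0 => w w0; field.
Qed.

Lemma velE j t : in_piece j t -> vel j t = speed j t *: tangent j t.
Proof. by move=> jt; rewrite scalerA divff ?scale1r // lt0r_neq0 // speed_gt0. Qed.

Lemma tdistE j t : in_piece j t -> tdist j t = dotp (P t - p) (tangent j t).
Proof. by move=> jt; rewrite /tdist /tangent dotpZr mulrC (pb_curveE jt). Qed.

(** The height of the curve above its tangent line at [t] is nonnegative and vanishes to first order
    at [t], so its second derivative there is nonnegative. This is convexity as a sign of the
    curvature. *)
Lemma acc_turn j t : tau j < t < tau j.+1 -> 0 <= e * crossp (vel j t) (acc j t).
Proof.
move=> /andP[jt tj].
have fd x : is_derive x 1 (fun s => e * crossp (vel j t) (G j s - P t))
    (e * crossp (vel j t) (vel j x)).
  exact: dd_scale (dd_cross_cst P (vel j t) j (P t) x).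
have fdd : is_derive t 1 (fun x => e * crossp (vel j t) (vel j x))
    (e * crossp (vel j t) (acc j t)).
  apply: dd_scale; have := vderiv_crossp (vderiv_cst (vel j t) t) (velocity_vderiv P j t).
  by rewrite crossp0l add0r.
apply: (dd_second_ge0 (fun x _ => fd x) fdd tj); first by rewrite crosspp mulr0.
have jtj : in_piece j t by rewrite /in_piece !ltW.
move=> s /andP[ts sj]; have js : in_piece j s by rewrite /in_piece (le_trans (ltW jt)).
rewrite -{1}(pb_curveE jtj) subrr (crossp0r (vel j t)) mulr0 -(pb_curveE js).
by apply: (eK jtj); apply: curve_boundary => //; exact: in_piece_ge0 js.
Qed.

Lemma dd_speed j t : in_piece j t ->
  is_derive t 1 (speed j) (dotp (vel j t) (acc j t) / speed j t).
Proof. by move=> jt; exact: (vderiv_enorm (velocity_vderiv P j t) (vel_neq0 jt)). Qed.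

(** The second summand is the curvature, [crossp vel acc / speed ^+ 3], times [crossp vel (G - p)].
    Relative to the orientation the first factor is nonnegative and the second negative, so [tdist]
    grows at most as fast as arc length. *)
Lemma dd_tdist j t : in_piece j t -> is_derive t 1 (tdist j)
  (speed j t + crossp (vel j t) (acc j t) * crossp (vel j t) (G j t - p) / speed j t ^+ 3).
Proof.
move=> jt; have w0 := lt0r_neq0 (speed_gt0 jt).
have d1 := vderiv_dotp (pieceB_vderiv P j p t) (velocity_vderiv P j t).
apply: dd_eq (ddM d1 (ddV w0 (dd_speed jt))) _.
have : speed j t ^+ 2 = dotp (vel j t) (vel j t) by exact: enorm_sqr.
move: (speed j t) w0 (vel j t) (acc j t) (G j t - p) => w w0 v a q ww.
rewrite -ww; have -> : crossp v a * crossp v q = w ^+ 2 * dotp q a - dotp q v * dotp v a.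
  by rewrite ww /crossp /dotp; ring.
by field.
Qed.

Lemma cross_lt0 j t : in_piece j t -> e * crossp (vel j t) (G j t - p) < 0.
Proof.
move=> jt; have := inner_crossp_gt0 jt; rewrite (pb_curveE jt) -(opprB p).
by rewrite (crosspNr (vel j t)) (mulrN e) oppr_lt0.
Qed.

Lemma dd_psi j t : in_piece j t ->
  is_derive t 1 (fun x => pb_prim P j x - tdist j x)
    (- (crossp (vel j t) (acc j t) * crossp (vel j t) (G j t - p) / speed j t ^+ 3)).
Proof.
move=> jt; apply: dd_eq (ddB (pb_prim_derive jt) (dd_tdist jt)) _.
by rewrite -/(speed j t) opprD addrA subrr add0r.
Qed.

Lemma psi_piece j s t : in_piece j s -> in_piece j t -> s <= t -> psi j s <= psi j t.
Proof.
move=> js jt st; rewrite -subr_ge0.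
have -> : psi j t - psi j s = (pb_prim P j t - tdist j t) - (pb_prim P j s - tdist j s).
  rewrite /psi; have := pb_lenE js jt; clear.
  move: (len t) (len s) (tdist j t) (tdist j s) (pb_prim P j t) (pb_prim P j s).
  by move=> *; lra.
rewrite subr_ge0.
have sub x : s <= x <= t -> in_piece j x.
  move: js jt => /andP[h1 h2] /andP[h3 h4] /andP[h5 h6].
  by rewrite /in_piece (le_trans h1) // (le_trans h6).
apply: (dd_ge0_le st (fun x h => dd_psi (sub x h))) => x /andP[sx xt].
have jx : in_piece j x by apply: sub; rewrite !ltW.
have hx : tau j < x < tau j.+1.
  by move: js jt => /andP[h1 h2] /andP[h3 h4]; rewrite (le_lt_trans h1) // (lt_le_trans xt).
rewrite -mulNr divr_ge0 ?exprn_ge0 ?enorm_ge0 //.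
have := acc_turn hx; have := cross_lt0 jx.
move: (crossp _ _) (crossp _ _) => A B A0 B0.
rewrite oppr_ge0 -[_ * _]mul1r -e2.
have -> : e ^+ 2 * (A * B) = (e * B) * (e * A) by ring.
by rewrite mulr_le0_ge0 // ltW.
Qed.

(** The equality clause serves rigidity: [psi] can pass a junction without increasing only if the
    tangents on both sides agree. *)
Lemma tdist_jump j :
  tdist j.+1 (tau j.+1) <= tdist j (tau j.+1)
    ?= iff (tangent j (tau j.+1) == tangent j.+1 (tau j.+1)).
Proof.
have jt := in_piece_r P j; have jt' := in_piece_l P j.+1; set t := tau j.+1 in jt jt' *.
rewrite !tdistE //; apply: turn_le (e2) _ _ _ _ _.
- exact: dotp_tangent.
- exact: dotp_tangent.
- rewrite /tangent crosspZl crosspZr mulrCA mulr_ge0 ?invr_ge0 ?enorm_ge0 //.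
  rewrite mulrCA mulr_ge0 ?invr_ge0 ?enorm_ge0 //.
  have lt2 := pb_tau_lt P j.+1.
  have fd := dd_scale e (dd_cross_cst P (vel j t) j.+1 (P t) t).
  apply: (dd_right_ge0 fd lt2) => s /andP[s1 s2].
  have js : in_piece j.+1 s by rewrite /in_piece s1.
  rewrite -{1}(pb_curveE jt') subrr -(pb_curveE js) (crossp0r (vel j t)) mulr0.
  by apply: (eK jt); apply: curve_boundary => //; exact: in_piece_ge0 js.
- rewrite /tangent crosspZl mulrCA pmulr_rlt0 ?invr_gt0 ?speed_gt0 //.
  by rewrite (pb_curveE jt); exact: cross_lt0.
- rewrite /tangent crosspZl mulrCA pmulr_rlt0 ?invr_gt0 ?speed_gt0 //.
  by rewrite (pb_curveE jt'); exact: cross_lt0.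
Qed.

Lemma psi_jump j : psi j (tau j.+1) <= psi j.+1 (tau j.+1).
Proof. by rewrite /psi lerD2l lerN2; exact: (tdist_jump j).1. Qed.

Lemma psi_le j s k t : in_piece j s -> in_piece k t -> param_le j s k t -> psi j s <= psi k t.
Proof.
move=> js kt [jk|[jk st]]; last by subst k; exact: psi_piece.
have [n kE] : exists n, k = (j + n).+1 by exists (k - j.+1)%N; rewrite -addSn subnKC.
subst k; elim: n {jk} t kt => [|n IH] t kt.
  rewrite addn0 in kt *.
  apply: (@le_trans _ _ (psi j (tau j.+1))).
    by apply: psi_piece => //; [exact: in_piece_r|case/andP: js].
  apply: le_trans (psi_jump j) _; apply: psi_piece => //; first exact: in_piece_l.
  by case/andP: kt.
rewrite addnS in kt *.
apply: (@le_trans _ _ (psi (j + n).+1 (tau (j + n).+2))).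
  by apply: IH; exact: in_piece_r.
apply: le_trans (psi_jump _) _; apply: psi_piece => //; first exact: in_piece_l.
by case/andP: kt.
Qed.

Lemma vderivZ (f : R -> R) (g : R -> plane R) t a b : is_derive t 1 f a -> vderiv g t b ->
  vderiv (fun s => f s *: g s) t (a *: g t + f t *: b).
Proof. by move=> fa [g1 g2]; split; [exact: ddM fa g1|exact: ddM fa g2]. Qed.

Lemma vderiv_tangent j t : in_piece j t -> crossp (vel j t) (acc j t) = 0 ->
  vderiv (tangent j) t 0.
Proof.
move=> jt va0; have w0 := lt0r_neq0 (speed_gt0 jt).
have := vderivZ (ddV w0 (dd_speed jt)) (velocity_vderiv P j t).
suff -> : (- (dotp (vel j t) (acc j t) / speed j t) / speed j t ^+ 2) *: vel j t +
    (speed j t)^-1 *: acc j t = 0 by [].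
have va := crossp_eq0_parallel (vel_neq0 jt) va0; rewrite {2}va scalerA -scalerDl.
have <- : speed j t ^+ 2 = dotp (vel j t) (vel j t) by exact: enorm_sqr.
rewrite (_ : _ + _ = 0) ?scale0r //.
by move: (dotp _ _) (speed j t) w0 => d w w0; field.
Qed.

Lemma vderiv0_cst (f : R -> plane R) s t : s <= t -> (forall x, s <= x <= t -> vderiv f x 0) ->
  f s = f t.
Proof.
rewrite le_eqVlt => /predU1P[->//|st] f0; apply: plane_eq.
  have [c _ /eqP] := dd_mvt st (fun x h => (f0 x h).1).
  by rewrite mul0r subr_eq0 => /eqP.
have [c _ /eqP] := dd_mvt st (fun x h => (f0 x h).2).
by rewrite mul0r subr_eq0 => /eqP.
Qed.

(** Where [psi] is constant its derivative vanishes; the factor coming from [p] is never 0, so the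
    curvature is. The unit tangent is then constant and the arc is a segment, along which [tdist] is
    the coordinate. *)
Lemma rigid_piece j s t : in_piece j s -> in_piece j t -> s <= t -> psi j s = psi j t ->
  tangent j s = tangent j t /\ P t - P s = (tdist j t - tdist j s) *: tangent j s.
Proof.
move=> js jt; rewrite le_eqVlt => /predU1P[->|st] pst; first by rewrite !subrr scale0r.
have sub x : s <= x <= t -> in_piece j x.
  move: js jt => /andP[h1 h2] /andP[h3 h4] /andP[h5 h6].
  by rewrite /in_piece (le_trans h1) // (le_trans h6).
have pc x : s <= x <= t -> pb_prim P j x - tdist j x = pb_prim P j s - tdist j s.
  move=> h; have jx := sub x h; case/andP: h => sx xt.
  have : psi j x = psi j s.
    apply/eqP; rewrite eq_le {1}pst !psi_piece //.
  rewrite /psi; have := pb_lenE js jx; move: (tdist _ _) (tdist _ _) => a b.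
  by move: (len _) (len _) (pb_prim _ _ _) (pb_prim _ _ _) => *; lra.
have cr x : s <= x <= t -> crossp (vel j x) (acc j x) = 0.
  move=> h; have jx := sub x h.
  have /eqP := dd_cst st pc h (dd_psi jx).
  rewrite oppr_eq0 !mulf_eq0 invr_eq0 expf_eq0 /= (gt_eqF (speed_gt0 jx)) orbF.
  case/orP => [/eqP//|/eqP c0]; have := cross_lt0 jx; rewrite c0 mulr0 ltxx //.
have Tc x : s <= x <= t -> tangent j s = tangent j x.
  move=> /andP[sx xt]; apply: vderiv0_cst => // y /andP[sy yx].
  have h : s <= y <= t by rewrite sy (le_trans yx).
  by apply: vderiv_tangent; [exact: sub|exact: cr].
split; first by apply: Tc; rewrite lexx ltW.
rewrite (pb_curveE jt) (pb_curveE js).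
set T := tangent j s; have TT : dotp T T = 1 by exact: dotp_tangent.
have T0 : T != 0 by rewrite -dotp_eq0 TT oner_eq0.
have X : crossp T (G j t - p) = crossp T (G j s - p).
  have fd x : s <= x <= t -> is_derive x 1 (fun x => crossp T (G j x - p)) 0.
    move=> h; apply: dd_eq (dd_cross_cst P T j p x) _.
    by rewrite (velE (sub x h)) -(Tc x h) crosspZr crosspp mulr0.
  have [c _ /eqP] := dd_mvt st fd; rewrite mul0r subr_eq0 => /eqP //.
have D x : s <= x <= t -> tdist j x = dotp T (G j x - p).
  by move=> h; rewrite (tdistE (sub x h)) -(Tc x h) dotpC (pb_curveE (sub x h)).
rewrite !D ?lexx ?ltW //.
have X' : crossp T (G j t - G j s) = 0.
  have -> : G j t - G j s = (G j t - p) - (G j s - p) by rewrite opprB addrA subrK.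
  by rewrite crosspBr X subrr.
rewrite (crossp_eq0_parallel T0 X') TT divr1 -dotpBr.
by rewrite opprB addrA subrK.
Qed.

(** Monotonicity forces [psi] to take the same value at every junction in between; hence [tdist]
    does not drop there, the tangents agree, and the segments of successive pieces add up in one
    direction. *)
Lemma rigid j s k t : in_piece j s -> in_piece k t -> param_le j s k t -> psi j s = psi k t ->
  tangent j s = tangent k t /\ P t - P s = (tdist k t - tdist j s) *: tangent j s.
Proof.
move=> js kt [jk|[jk st]]; last by subst k; exact: rigid_piece.
have [n kE] : exists n, k = (j + n).+1 by exists (k - j.+1)%N; rewrite -addSn subnKC.
have step i t' : in_piece i.+1 t' -> in_piece i (tau i.+1) ->
    psi i (tau i.+1) = psi i.+1 t' ->
    tangent i (tau i.+1) = tangent i.+1 t' /\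
    P t' - P (tau i.+1) = (tdist i.+1 t' - tdist i (tau i.+1)) *: tangent i (tau i.+1).
  move=> it' it E; have il := in_piece_l P i.+1.
  have h1 := psi_jump i; have h2 : psi i.+1 (tau i.+1) <= psi i.+1 t'.
    by apply: psi_piece => //; case/andP: it'.
  have E1 : psi i (tau i.+1) = psi i.+1 (tau i.+1) by apply/eqP; rewrite eq_le h1 E.
  have F1 : tdist i.+1 (tau i.+1) = tdist i (tau i.+1).
    by move/addrI/oppr_inj: E1.
  have T1 : tangent i (tau i.+1) = tangent i.+1 (tau i.+1).
    by apply/eqP; rewrite -(tdist_jump i).2 F1.
  rewrite T1 -F1; apply: rigid_piece => //; first by case/andP: it'.
  by rewrite -E1.
have trans i1 s1 i2 s2 i3 s3 :
    tangent i1 s1 = tangent i2 s2 /\ P s2 - P s1 = (tdist i2 s2 - tdist i1 s1) *: tangent i1 s1 ->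
    tangent i2 s2 = tangent i3 s3 /\ P s3 - P s2 = (tdist i3 s3 - tdist i2 s2) *: tangent i2 s2 ->
    tangent i1 s1 = tangent i3 s3 /\ P s3 - P s1 = (tdist i3 s3 - tdist i1 s1) *: tangent i1 s1.
  move=> [T12 P12] [T23 P23]; split; first by rewrite T12.
  have -> : P s3 - P s1 = (P s3 - P s2) + (P s2 - P s1) by rewrite addrA subrK.
  by rewrite P12 P23 -T12 -scalerDl; congr (_ *: _); rewrite addrA subrK.
subst k; elim: n {jk} t kt => [|n IH] t kt E.
  rewrite addn0 in kt E *.
  have jr := in_piece_r P j.
  have h1 : psi j s <= psi j (tau j.+1) by apply: psi_piece => //; case/andP: js.
  have h2 : psi j (tau j.+1) <= psi j.+1 t.
    by apply: psi_le => //; left.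
  have E1 : psi j s = psi j (tau j.+1) by apply/eqP; rewrite eq_le h1 E.
  apply: (trans _ _ j (tau j.+1)).
    by apply: rigid_piece => //; case/andP: js.
  by apply: step => //; rewrite -E1.
rewrite addnS in kt E *; have jr := in_piece_r P (j + n).+1.
have h1 : psi j s <= psi (j + n).+1 (tau (j + n).+2).
  by apply: psi_le => //; left; rewrite ltnS leq_addr.
have h2 : psi (j + n).+1 (tau (j + n).+2) <= psi (j + n).+2 t by apply: psi_le => //; left.
have E1 : psi j s = psi (j + n).+1 (tau (j + n).+2) by apply/eqP; rewrite eq_le h1 E.
apply: (trans _ _ (j + n).+1 (tau (j + n).+2)); first exact: IH.
by apply: step => //; rewrite -E1.
Qed.

End TangentialDistance.

(** * Equilibria and local parametrizations *)

Section Directions.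
Variable R : realType.
Implicit Types (u v w y z : plane R) (t s x r a : R).

Lemma enormD u v : enorm (u + v) <= enorm u + enorm v.
Proof.
rewrite -(@ler_pXn2r _ 2) ?nnegrE ?addr_ge0 ?enorm_ge0 // enorm_sqr sqrrD !enorm_sqr.
have := ler_normlW (cauchy_schwarz u v).
rewrite dotpDl !dotpDr (dotpC v u) mulr2n.
by move: (enorm u * enorm v) (dotp u v) (dotp u u) (dotp v v) => *; lra.
Qed.

Lemma enormB_ge u v : `|enorm u - enorm v| <= enorm (u - v).
Proof.
rewrite ler_norml; have := enormD (u - v) v; have := enormD (v - u) u.
rewrite !subrK -(opprB u v) enormN.
by move: (enorm _) (enorm u) (enorm v) => *; apply/andP; split; lra.
Qed.

Lemma direction_close y v : y != 0 -> v != 0 ->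
  enorm ((enorm y)^-1 *: y - (enorm v)^-1 *: v) <= 2 * enorm (y - v) / enorm v.
Proof.
move=> y0 v0; have yp := enorm_gt0 y0; have vp := enorm_gt0 v0.
have -> : (enorm y)^-1 *: y - (enorm v)^-1 *: v =
    (enorm v)^-1 *: (y - v) + ((enorm v - enorm y) / (enorm y * enorm v)) *: y.
  rewrite scalerBr addrAC -scalerDl; congr (_ *: _ - _).
  have := lt0r_neq0 yp; have := lt0r_neq0 vp.
  by move: (enorm y) (enorm v) => a b a0 b0; field; rewrite a0.
apply: le_trans (enormD _ _) _; rewrite !enormZ.
rewrite ger0_norm ?invr_ge0 ?enorm_ge0 // normrM (ger0_norm (_ : 0 <= (_ * _)^-1)); last first.
  by rewrite invr_ge0 mulr_ge0 ?enorm_ge0.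
have -> : `|enorm v - enorm y| / (enorm y * enorm v) * enorm y = `|enorm v - enorm y| / enorm v.
  have := lt0r_neq0 yp; have := lt0r_neq0 vp; move: `|enorm v - enorm y| => c.
  move: (enorm y) (enorm v) => a b a0 b0.
  by field; rewrite a0.
rewrite mulrC -mulrDl ler_pM2r ?invr_gt0 // mulr2n mulrDl mul1r lerD2l.
by rewrite distrC; exact: enormB_ge.
Qed.

Lemma vderiv_slope (g : R -> plane R) t v : vderiv g t v -> forall a, 0 < a ->
  exists2 r, 0 < r & forall s, s != t -> `|s - t| < r ->
    enorm ((s - t)^-1 *: (g s - g t) - v) <= a.
Proof.
move=> [g1 g2] a a0; have a2 : 0 < a / 2 by rewrite divr_gt0.
have [r1 r10 h1] := dd_slope g1 a2; have [r2 r20 h2] := dd_slope g2 a2.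
exists (Num.min r1 r2); first by rewrite lt_min r10.
move=> s st; rewrite lt_min => /andP[/h1 b1 /h2 b2].
have n0 : 0 < `|s - t| by rewrite normr_gt0 subr_eq0.
have sc (x y d : R) : `|x - y - d * (s - t)| <= a / 2 * `|s - t| -> `|(s - t)^-1 * (x - y) - d| <= a / 2.
  move=> h; rewrite -(ler_pM2r n0) -normrM; apply: le_trans h; rewrite le_eqVlt; apply/orP; left.
  apply/eqP; congr (`|_|); have := subr_eq0 s t; rewrite (negbTE st) => /negbT st0.
  by move: (s - t) st0 => c c0; field.
apply: le_trans (enorm_le_normr _) _; rewrite [a]splitr.
by apply: lerD; rewrite !plE; exact: sc.
Qed.

Lemma direction_limit (g : R -> plane R) t v : vderiv g t v -> v != 0 -> forall a, 0 < a ->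
  exists2 r, 0 < r & forall s, `|s - t| < r ->
   (t < s -> enorm ((enorm (g s - g t))^-1 *: (g s - g t) - (enorm v)^-1 *: v) < a) /\
   (s < t -> enorm ((enorm (g s - g t))^-1 *: (g s - g t) + (enorm v)^-1 *: v) < a).
Proof.
move=> gv v0 a a0; have vp := enorm_gt0 v0.
have b0 : 0 < Num.min (a * enorm v / 4) (enorm v / 2) by rewrite lt_min !divr_gt0 ?mulr_gt0.
have [r r0 h] := vderiv_slope gv b0; exists r => // s sr.
have key : s != t -> exists y, [/\ y != 0, g s - g t = (s - t) *: y &
    enorm ((enorm y)^-1 *: y - (enorm v)^-1 *: v) < a].
  move=> st; have := h s st sr; set y := (s - t)^-1 *: _; rewrite le_min => /andP[y1 y2].
  have y0 : y != 0.
    apply: contraTneq y2 => ->; rewrite sub0r enormN -ltNge ltr_pdivrMr // mulr2n mulrDr mulr1.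
    by rewrite ltrDl.
  exists y; split => //.
    by rewrite scalerA divff ?scale1r // subr_eq0.
  apply: le_lt_trans (direction_close y0 v0) _; rewrite ltr_pdivrMr //.
  move: y1; have : 0 < a * enorm v by rewrite mulr_gt0.
  by move: (enorm (y - v)) (a * enorm v) => *; lra.
split=> st.
  have [|y [y0 -> yv]] := key; first by rewrite gt_eqF.
  have d0 : 0 < s - t by rewrite subr_gt0.
  rewrite enormZ (gtr0_norm d0) scalerA.
  have -> : ((s - t) * enorm y)^-1 * (s - t) = (enorm y)^-1; last by [].
  have := lt0r_neq0 d0; have := lt0r_neq0 (enorm_gt0 y0); move: (s - t) (enorm y).
  by move=> c b bn cn; field; rewrite bn.
have [|y [y0 -> yv]] := key; first by rewrite lt_eqF.
have d0 : 0 < t - s by rewrite subr_gt0.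
have d0' : `|s - t| = t - s by rewrite ltr0_norm ?opprB // subr_lt0.
rewrite enormZ d0' scalerA; have -> : ((t - s) * enorm y)^-1 * (s - t) = - (enorm y)^-1.
  have := lt0r_neq0 d0; have := lt0r_neq0 (enorm_gt0 y0).
  by move: (enorm y) => b bn cn; field; rewrite bn.
by rewrite scaleNr addrC -enormN opprB.
Qed.

Lemma half_tangent_limit K z u :
  (forall r, 0 < r -> exists w, [/\ boundary K w, w != z, enorm (w - z) < r &
     enorm ((enorm (w - z))^-1 *: (w - z) - u) < r]) -> half_tangent K z u.
Proof.
move=> h A B FA nB; move: nB => /enorm_nbhsP[r r0 hB].
move: FA; rewrite /= /nbhs /= /within /= => /enorm_nbhsP[r' r'0 hA].
have [|w [bw wz w1 w2]] := h (Num.min r r'); first by rewrite lt_min r0.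
move: w1 w2; rewrite !lt_min => /andP[_ w1] /andP[w2 _].
exists ((enorm (w - z))^-1 *: (w - z)); split; last exact: hB.
apply: hA => //; split => //; exact/eqP.
Qed.

End Directions.

Section DistanceDerivative.
Variable R : realType.
Variables (g g1 g2 : R -> plane R) (p : plane R).
Hypotheses (gd : forall s, vderiv g s (g1 s)) (g1d : forall s, vderiv g1 s (g2 s)).

Lemma dd_tangential (s : R) : g1 s != 0 ->
  is_derive s 1 (fun x => dotp (g x - p) (g1 x) / enorm (g1 x))
  ((dotp (g1 s) (g1 s) + dotp (g s - p) (g2 s) -
    dotp (g s - p) (g1 s) * dotp (g1 s) (g2 s) / dotp (g1 s) (g1 s)) / enorm (g1 s)).
Proof.
move=> v0; have w0 := lt0r_neq0 (enorm_gt0 v0).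
have d1 := vderiv_dotp (vderivB_cst p (gd s)) (g1d s).
apply: dd_eq (ddM d1 (@ddV _ (fun x => enorm (g1 x)) s _ w0 (vderiv_enorm (g1d s) v0))) _.
have <- : enorm (g1 s) ^+ 2 = dotp (g1 s) (g1 s) by exact: enorm_sqr.
move: (enorm _) w0 (dotp _ _) (dotp _ _) (dotp _ _) => w w0 a b c.
by field.
Qed.

Lemma dd_dist (s : R) : g s != p ->
  is_derive s 1 (fun x => enorm (g x - p)) (dotp (g s - p) (g1 s) / enorm (g s - p)).
Proof. by move=> gp; apply: vderiv_enorm; [exact: vderivB_cst|rewrite subr_eq0]. Qed.

Lemma dd_dist2 (r : R) : 0 < r -> (forall s, `|s| < r -> g s != p) ->
  dotp (g 0 - p) (g1 0) = 0 ->
  is_derive (0 : R) 1 (fun x => dotp (g x - p) (g1 x) / enorm (g x - p))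
    ((dotp (g1 0) (g1 0) + dotp (g 0 - p) (g2 0)) / enorm (g 0 - p)).
Proof.
move=> r0 gp c0; have g0p : g 0 != p by apply: gp; rewrite normr0.
have w0 : enorm (g 0 - p) != 0 by rewrite enorm_eq0 subr_eq0.
have d1 := vderiv_dotp (vderivB_cst p (gd 0)) (g1d 0).
apply: dd_eq (ddM d1 (@ddV _ (fun x => enorm (g x - p)) 0 _ w0 (dd_dist g0p))) _.
by rewrite !c0 !mul0r addr0.
Qed.

(** The norm is not differentiable at 0, so the first derivative is computed where the curve avoids
    [p]; as it is differentiated once more, this is assumed on a neighbourhood of 0. At a critical
    point the derivative of the denominator contributes nothing. *)
Lemma distance_derive2E (r : R) : 0 < r -> (forall s, `|s| < r -> g s != p) ->
  dotp (g 0 - p) (g1 0) = 0 ->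
  distance_derive2 p g = (dotp (g1 0) (g1 0) + dotp (g 0 - p) (g2 0)) / enorm (g 0 - p).
Proof.
move=> r0 gp c0; have [_ <-] := dd_dist2 r0 gp c0.
rewrite -derive1E /distance_derive2 derive1nS derive1n1.
apply: (derive1_near r0) => s; rewrite subr0 => /gp gps.
by rewrite derive1E; have [_ ->] := dd_dist gps.
Qed.

Lemma dist_strict_min (r : R) : 0 < r -> (forall s, `|s| < r -> g s != p) ->
  dotp (g 0 - p) (g1 0) = 0 -> 0 < distance_derive2 p g ->
  exists2 r', 0 < r' & forall s : R, s != 0 -> `|s| < r' -> enorm (g 0 - p) < enorm (g s - p).
Proof.
move=> r0 gp c0; rewrite (distance_derive2E r0 gp c0) => d2.
have [r1 r10 h1] := dd_pos_right (dd_dist2 r0 gp c0) d2.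
exists (Num.min r r1); first by rewrite lt_min r0.
move=> s s0; rewrite lt_min => /andP[sr sr1].
have D (x : R) : `|x| < r -> is_derive x 1 (fun x => enorm (g x - p)) (dotp (g x - p) (g1 x) / enorm (g x - p)).
  by move=> /gp; exact: dd_dist.
move: s0; rewrite neq_lt => /orP[s0|s0].
  have sub x : s <= x <= 0 -> `|x| < r.
    move=> /andP[h2 h3]; apply: le_lt_trans sr; rewrite (ltr0_norm s0) ler0_norm // lerN2 //.
  have [c /andP[c1 c2] E] := dd_mvt s0 (fun x h => D x (sub x h)).
  rewrite -subr_lt0 E sub0r pmulr_llt0 ?oppr_gt0 //.
  have [|_ /(_ c2)] := h1 c; last by rewrite c0 mul0r.
  rewrite subr0 (ltr0_norm c2); apply: lt_trans sr1; rewrite (ltr0_norm s0) ltrN2 //.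
have sub x : 0 <= x <= s -> `|x| < r.
  by move=> /andP[h2 h3]; apply: le_lt_trans sr; rewrite (gtr0_norm s0) ger0_norm.
have [c /andP[c1 c2] E] := dd_mvt s0 (fun x h => D x (sub x h)).
rewrite -subr_gt0 E subr0 pmulr_lgt0 //.
have [|/(_ c1) + _] := h1 c; last by rewrite c0 mul0r.
by rewrite subr0 (gtr0_norm c1); apply: lt_trans sr1; rewrite (gtr0_norm s0).
Qed.

End DistanceDerivative.

Lemma half_lt (R : realType) (m : R) : 0 < m -> m / 2 < m.
Proof. by move=> m0; rewrite ltr_pdivrMr // mulr2n mulrDr mulr1 ltrDl. Qed.

(** * Comparison of an arbitrary local parametrization with the periodic curve *)

Section LocalParametrization.
Variables (R : realType) (K : set (plane R)) (L : R) (P : periodic_boundary K L).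
Variables (p : plane R) (e : R).
Implicit Types (i j k n : nat) (s t x y : R) (w z : plane R).
Local Notation tau := (pb_tau P).
Local Notation G := (pb_piece P).
Local Notation vel := (pb_vel P).
Local Notation acc := (pb_acc P).
Local Notation in_piece := (in_piece P).
Local Notation tdist := (tdist P p).
Local Notation tangent := (tangent P).
Hypotheses (cK : compact K) (vK : convex_set K) (pK : strictly_inside K p).
Hypotheses (e2 : e ^+ 2 = 1) (eK : forall j t, in_piece j t -> supporting P e j t).

Lemma tau_le j k : (j <= k)%N -> tau j <= tau k.
Proof.
elim: k => [|k IH]; first by rewrite leqn0 => /eqP ->.
rewrite leq_eqVlt => /predU1P[->//|jk].
exact: le_trans (IH jk) (ltW (pb_tau_lt P k)).
Qed.

Lemma tau_num m : tau (m * pb_num P) = m%:R.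
Proof.
elim: m => [|m IH]; first by rewrite mul0n pb_tau0.
by rewrite mulSn addnC pb_tauN IH natr1.
Qed.

Lemma tau_unbounded t : exists n, t < tau n.
Proof.
case: (ltP t 0) => t0; first by exists 0%N; rewrite pb_tau0.
exists ((Num.truncn t).+1 * pb_num P)%N; rewrite tau_num.
by case/andP: (truncn_itv t0).
Qed.

Lemma right_piece t : 0 <= t -> exists k, tau k <= t < tau k.+1.
Proof.
move=> t0; have ex := tau_unbounded t; case: (ex_minnP ex) => -[|k] tk kmin.
  by move: tk; rewrite pb_tau0 ltNge t0.
exists k; rewrite tk andbT leNgt; apply/negP => /kmin.
by rewrite ltnn.
Qed.

Lemma left_piece t : 0 < t -> exists j, tau j < t <= tau j.+1.
Proof.
move=> t0; have ex : exists n, t <= tau n.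
  by have [n /ltW tn] := tau_unbounded t; exists n.
case: (ex_minnP ex) => -[|k] tk kmin.
  by move: tk; rewrite pb_tau0 leNgt t0.
exists k; rewrite tk andbT ltNge; apply/negP => /kmin.
by rewrite ltnn.
Qed.

Lemma in_piece_of_left j t : tau j < t <= tau j.+1 -> in_piece j t.
Proof. by case/andP => h1 h2; rewrite /in_piece ltW. Qed.

Lemma in_piece_of_right j t : tau j <= t < tau j.+1 -> in_piece j t.
Proof. by case/andP => h1 h2; rewrite /in_piece h1 ltW. Qed.

Lemma piece_left_unique i j s : in_piece i s -> tau j < s -> s < tau j.+1 -> i = j.
Proof.
move=> /andP[i1 i2] j1 j2; apply/eqP; rewrite eqn_leq; apply/andP; split; rewrite leqNgt; apply/negP => h.
  by have := lt_le_trans (le_lt_trans i1 j2) (tau_le h); rewrite ltxx.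
by have := lt_le_trans (lt_le_trans j1 i2) (tau_le h); rewrite ltxx.
Qed.

Variables (j k : nat) (t : R).
Hypotheses (jt : tau j < t <= tau j.+1) (kt : tau k <= t < tau k.+1).

Let ijt : in_piece j t := in_piece_of_left jt.
Let ikt : in_piece k t := in_piece_of_right kt.

(** [j] carries the curve just before [t] and [k] just after it; the two coincide unless [t] is a
    subdivision point. *)
Definition sided i x : Prop := (i = j /\ tau j <= x <= t) \/ (i = k /\ t <= x <= tau k.+1).

Lemma sided_in_piece i x : sided i x -> in_piece i x.
Proof.
case/andP: jt => j1 j2; case/andP: kt => k1 k2.
case=> [[-> /andP[h1 h2]]|[-> /andP[h1 h2]]]; rewrite /in_piece.
  by rewrite h1 (le_trans h2).
by rewrite h2 (le_trans k1).
Qed.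

(** The delicate case is [x = t] at a subdivision point: there [k = j + 1], and no third piece
    contains [t]. *)
Lemma sided_near : exists2 r, 0 < r & forall i x, in_piece i x -> `|x - t| < r ->
  sided i x.
Proof.
case/andP: jt => j1 j2; case/andP: kt => k1 k2.
exists (Num.min (t - tau j) (tau k.+1 - t)); first by rewrite lt_min !subr_gt0 j1.
move=> i x ix; rewrite lt_min !ltr_norml => /andP[/andP[h1 _] /andP[_ h2]].
have x1 : tau j < x by lra.
have x2 : x < tau k.+1 by lra.
case: (ltgtP x t) => xt.
- left; split; last by rewrite !ltW.
  by apply: (piece_left_unique ix) => //; exact: lt_le_trans j2.
- right; split; last by rewrite !ltW.
  by apply: (piece_left_unique ix) => //; exact: le_lt_trans xt.
- case: (ltP x (tau j.+1)) => xj.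
    by left; split; [exact: (piece_left_unique ix)|rewrite xt lexx ltW].
  case: (ltP (tau k) x) => xk.
    by right; split; [exact: (piece_left_unique ix)|rewrite xt lexx ltW].
  have jk : j.+1 = k.
    have tj : tau j.+1 = t by apply/eqP; rewrite eq_le j2 -{1}xt xj.
    have tk : tau k = t by apply/eqP; rewrite eq_le k1 -{1}xt xk.
    apply/eqP; rewrite eqn_leq; apply/andP; split; rewrite leqNgt; apply/negP => h.
      by have := lt_le_trans (pb_tau_lt P k) (tau_le h); rewrite tj tk ltxx.
    by have := lt_le_trans (pb_tau_lt P j.+1) (tau_le h); rewrite tj tk ltxx.
  case: (ltnP i j) => ij.
    by case/andP: ix => _; have := tau_le ij; move=> a b; have := le_trans b a; rewrite leNgt x1.
  case: (ltnP k i) => ki.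
    by case/andP: ix => + _; have := tau_le ki; move=> a b; have := le_trans a b; rewrite leNgt x2.
  move: ij; rewrite leq_eqVlt => /predU1P[ji|ji].
    by left; split => //; rewrite xt lexx ltW.
  right; split; last by rewrite xt lexx ltW.
  by apply/eqP; rewrite eqn_leq ki -jk.
Qed.

Variables (g g1 g2 : R -> plane R) (eta : R).
Hypotheses (gd : forall s, vderiv g s (g1 s)) (g1d : forall s, vderiv g1 s (g2 s)).
Hypotheses (eta0 : 0 < eta) (g0 : g 0 = P t).
Hypotheses (gbd : forall s, `|s| < eta -> boundary K (g s))
  (g1n : forall s, `|s| < eta -> g1 s != 0).

Lemma param_in s : `|s| < eta -> K (g s).
Proof. by move=> /gbd /(compact_boundary _ cK)[]. Qed.

Lemma param_normal s (n : plane R) : `|s| < eta -> (forall w, K w -> 0 <= dotp n (w - g s)) ->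
  dotp n (g1 s) = 0.
Proof.
move=> se sn; apply: oppr_inj; rewrite oppr0.
have r0 : 0 < eta - `|s| by rewrite subr_gt0.
apply: (dd_local_max (ddN (vderiv_dotpl n (vderivB_cst (g s) (gd s)))) r0) => x xs.
rewrite subrr (dotp0r n) oppr0 oppr_le0; apply: sn; apply: param_in.
have -> : x = (x - s) + s by rewrite subrK.
by apply: le_lt_trans (ler_normD _ _) _; rewrite -ltrBrDr.
Qed.

Lemma param_parallel i x s : `|s| < eta -> in_piece i x -> P x = g s ->
  crossp (vel i x) (g1 s) = 0.
Proof.
move=> se ix E; have e0 : e != 0.
  by apply: contra_eq_neq e2 => ->; rewrite expr0n eq_sym oner_eq0.
have : dotp (e *: rot (vel i x)) (g1 s) = 0.
  apply: param_normal => // w Kw; rewrite dotpZl dotp_rot -E; exact: eK.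
by rewrite dotpZl dotp_rot => /eqP; rewrite mulf_eq0 (negbTE e0) => /eqP.
Qed.

Lemma z_eta : `|0 : R| < eta. Proof. by rewrite normr0. Qed.

(** A regular curve through [P t] inside the boundary excludes a corner: both one-sided velocities
    are parallel to its velocity, and the common position of [p] to their left or right gives them
    the same direction. *)
Lemma tangent_lr : tangent j t = tangent k t.
Proof.
have h1 := param_parallel z_eta ijt (esym g0).
have h2 := param_parallel z_eta ikt (esym g0).
have v1 := vel_neq0 ijt; have v2 := vel_neq0 ikt; have u0 := g1n z_eta.
have : crossp (vel j t) (vel k t) = 0.
  rewrite (crosspC _ (g1 0)) in h1; rewrite (crosspC _ (g1 0)) in h2.
  move/eqP: h1; rewrite oppr_eq0 => /eqP h1; move/eqP: h2; rewrite oppr_eq0 => /eqP h2.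
  rewrite (crossp_eq0_parallel u0 h1) (crossp_eq0_parallel u0 h2).
  by rewrite crosspZl crosspZr crosspp !mulr0.
move/(crossp_eq0_parallel v1) => kE.
have m0 : 0 < dotp (vel j t) (vel k t) / dotp (vel j t) (vel j t).
  have s1 := inner_crossp_gt0 cK pK e2 eK ijt; have := inner_crossp_gt0 cK pK e2 eK ikt.
  by rewrite {1}kE crosspZl mulrCA pmulr_lgt0.
rewrite /tangent /speed; move: (dotp _ _ / _) m0 kE => m m0 ->.
rewrite enormZ (gtr0_norm m0) scalerA; congr (_ *: _).
have := lt0r_neq0 (enorm_gt0 v1); move: (lt0r_neq0 m0); move: (enorm _).
by move=> b a0 b0; field; rewrite a0 b0.
Qed.

Local Notation T := (tangent k t).

Lemma unitT : dotp T T = 1. Proof. exact: dotp_tangent ikt. Qed.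

Lemma param_vel : exists c, c != 0 /\ g1 0 = c *: T.
Proof.
have T0 : T != 0 by rewrite -dotp_eq0 unitT oner_eq0.
have h : crossp T (g1 0) = 0.
  by rewrite /tangent crosspZl (param_parallel z_eta ikt (esym g0)) mulr0.
have E := crossp_eq0_parallel T0 h; exists (dotp T (g1 0) / dotp T T); split => //.
by apply: contra_neq (g1n z_eta) => c0; rewrite E c0 scale0r.
Qed.

Lemma tangent_vel_sided i x : sided i x -> x = t -> tangent i x = T.
Proof. by move=> + xt; rewrite xt; case=> [[-> _]|[-> _]] //; exact: tangent_lr. Qed.

Lemma vel_near i : tangent i t = T -> in_piece i t ->
  exists2 r, 0 < r & forall x, `|x - t| < r -> 0 < dotp T (vel i x).
Proof.
move=> Ti it; apply: (dd_pos_near (vderiv_dotpl T (velocity_vderiv P i t))).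
by rewrite (velE it) Ti dotpZr unitT mulr1 speed_gt0.
Qed.

(** Near [P t] the inner normals along either curve have a positive product with [e *: rot T], so
    both curves are graphs over the tangent line, and equal coordinates along [T] mean equal
    points. *)
Lemma param_match : exists2 r, 0 < r & forall s i x, `|s| < r -> `|x - t| < r -> sided i x ->
  dotp T (P x - g s) = 0 -> P x = g s.
Proof.
have [rj rj0 hj] := vel_near tangent_lr ijt.
have [rk rk0 hk] := vel_near erefl ikt.
have [c [c0 cE]] := param_vel.
have T0 : T != 0 by rewrite -dotp_eq0 unitT oner_eq0.
have sT : 0 < e * crossp T (p - P t).
  rewrite /tangent crosspZl mulrCA pmulr_rgt0; first exact: inner_crossp_gt0.
  by rewrite invr_gt0; exact: speed_gt0.
have a1 : 0 < dotp (c *: T) (g1 0).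
  by rewrite cE dotpZl dotpZr unitT mulr1 -expr2 lt_def sqrf_eq0 c0 sqr_ge0.
have [r1 r10 h1] := dd_pos_near (vderiv_dotpl (c *: T) (g1d 0)) a1.
have pd : vderiv (fun s => p - g s) 0 (- g1 0).
  have [q1 q2] := gd 0; split.
    by apply: dd_eq (ddB (ddc p.1 _) q1) _; rewrite sub0r.
  by apply: dd_eq (ddB (ddc p.2 _) q2) _; rewrite sub0r.
have a2 : 0 < (c * e) * crossp (g1 0) (p - g 0).
  rewrite cE g0 crosspZl; have -> : c * e * (c * crossp T (p - P t)) = c ^+ 2 * (e * crossp T (p - P t)).
    by ring.
  by rewrite mulr_gt0 // lt_def sqrf_eq0 c0 sqr_ge0.
have [r2 r20 h2] := dd_pos_near (dd_scale (c * e) (vderiv_crossp (g1d 0) pd)) a2.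
exists (Num.min (Num.min rj rk) (Num.min eta (Num.min r1 r2))).
  by rewrite !lt_min rj0 rk0 eta0 r10.
move=> s i x; rewrite !lt_min => /andP[_ /and3P[se s1 s2]] /andP[/andP[xj xk] _] six D.
have ix := sided_in_piece six; have x0 := in_piece_ge0 ix.
have Kx : K (P x) by exact: curve_boundary.
have Kg := param_in se.
have [n n0 sn] := support_normal cK vK (ex_intro _ _ Kg) (gbd se).
have pn := pK Kg n0 sn.
have := param_normal se sn; rewrite dotpC => ng1.
have nE := dotp_eq0_parallel (g1n se) ng1; set l := _ / _ in nE.
apply: (@graph_unique _ K (e *: rot T) (e *: rot (vel i x)) n (P x) (g s)
  (e * crossp T (P x - g s))) => //.
- by move=> w Kw; rewrite dotpZl dotp_rot; exact: eK.
- rewrite dotpZl dotpZr dotp_rot2 mulrA -expr2 e2 mul1r dotpC.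
  by case: six => [[-> _]|[-> _]]; [exact: hj|exact: hk].
(* The supporting normal at [g s] is [l *: rot (g1 s)]; the product of three positive quantities,
   divided by squares, gives the sign of [l * (e * A)]. *)
- have := h1 s; rewrite subr0 => /(_ s1) b1; have := h2 s; rewrite subr0 => /(_ s2) b2.
  move: pn; rewrite nE !dotpZl dotpZr dotp_rot2 dotp_rot => pn.
  rewrite dotpZl in b1; rewrite (dotpC _ T); clearbody l.
  move: b1 b2 pn; move: (dotp T _) (crossp _ _) => A B b1 b2 pn.
  have cc : 0 < c ^+ 2 by rewrite lt_def sqrf_eq0 c0 sqr_ge0.
  have : 0 < (c * A) * (c * e * B) * (l * B) by exact: mulr_gt0 (mulr_gt0 b1 b2) pn.
  have -> : c * A * (c * e * B) * (l * B) = (c ^+ 2 * B ^+ 2) * (l * (e * A)) by ring.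
  by rewrite pmulr_rgt0 // mulr_gt0 // lt_def sqrf_eq0 sqr_ge0 andbT; apply: contraTneq pn => ->; rewrite mulr0 ltxx.
- by rewrite scalerA mulrAC -expr2 e2 mul1r; have := dotp_eq0_parallel T0 D; rewrite unitT divr1.
Qed.

(** Intermediate values on each side of [t]: piece [k] covers the nonnegative coordinates and piece
    [j] the negative ones. *)
Lemma curve_component (d : R) : 0 < d -> exists2 xi, 0 < xi &
  forall y, `|y| < xi -> exists i x, [/\ sided i x, `|x - t| < d & dotp T (P x - P t) = y].
Proof.
move=> d0; case/andP: (jt) => j1 j2; case/andP: (kt) => k1 k2.
have dk : 0 < dotp T (vel k t) by rewrite (velE ikt) dotpZr unitT mulr1 speed_gt0.
have dj : 0 < dotp T (vel j t).
  by rewrite (velE ijt) dotpZr tangent_lr unitT mulr1 speed_gt0.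
have [rk rk0 hk] := dd_pos_right (vderiv_dotpl T (pieceB_vderiv P k (P t) t)) dk.
have [rj rj0 hj] := dd_pos_right (vderiv_dotpl T (pieceB_vderiv P j (P t) t)) dj.
have [m m0 [m1 m2 m3 m4 m5]] : exists2 m, 0 < m & [/\ m < rk, m < rj, m < d, m <= t - tau j & m <= tau k.+1 - t].
  pose m := Num.min (Num.min rk rj) (Num.min d (Num.min (t - tau j) (tau k.+1 - t))).
  have m0 : 0 < m by rewrite !lt_min rk0 rj0 d0 !subr_gt0 j1.
  have h : [/\ m <= rk, m <= rj, m <= d, m <= t - tau j & m <= tau k.+1 - t].
    by rewrite /m !ge_min !lexx !orbT.
  case: h => h1 h2 h3 h4 h5; have mh := half_lt m0; exists (m / 2); first exact: divr_gt0.
  split; [exact: lt_le_trans mh h1|exact: lt_le_trans mh h2|exact: lt_le_trans mh h3|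
    exact: le_trans (ltW mh) h4|exact: le_trans (ltW mh) h5].
pose X i x := dotp T (G i x - P t).
have Xk0 : X k t = 0 by rewrite /X -(pb_curveE ikt) subrr (dotp0r T).
have Xj0 : X j t = 0 by rewrite /X -(pb_curveE ijt) subrr (dotp0r T).
have Xk : 0 < X k (t + m).
  have [|+ _] := hk (t + m); first by rewrite addrC addKr gtr0_norm.
  by rewrite -/(X k t) -/(X k (t + m)) Xk0 ltrDl; apply.
have Xj : X j (t - m) < 0.
  have [|_] := hj (t - m); first by rewrite addrAC subrr add0r normrN gtr0_norm.
  by rewrite -/(X j t) -/(X j (t - m)) Xj0 gtrBl; apply.
exists (Num.min (X k (t + m)) (- X j (t - m))); first by rewrite lt_min Xk oppr_gt0.
move=> y; rewrite lt_min => /andP[y1 y2].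
case: (leP 0 y) => y0.
  rewrite ger0_norm // in y1.
  have tm : t <= t + m by rewrite lerDl ltW.
  have yy : X k t <= y <= X k (t + m) by rewrite Xk0 y0 ltW.
  have [x /andP[x1 x2] E] := dd_ivt tm (fun x _ => vderiv_dotpl T (pieceB_vderiv P k (P t) x)) yy.
  have sx : sided k x.
    by right; split => //; rewrite x1 (le_trans x2) // -lerBrDl.
  exists k, x; split => //.
    by rewrite ger0_norm ?subr_ge0 // ltrBlDl (le_lt_trans x2) // ltrD2l.
  by rewrite (pb_curveE (sided_in_piece sx)).
rewrite (ltr0_norm y0) ltrN2 in y2.
have tm : t - m <= t by rewrite gerBl ltW.
have yy : X j (t - m) <= y <= X j t by rewrite Xj0 !ltW.
have [x /andP[x1 x2] E] := dd_ivt tm (fun x _ => vderiv_dotpl T (pieceB_vderiv P j (P t) x)) yy.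
have sx : sided j x.
  by left; split => //; rewrite x2 andbT (le_trans _ x1) // lerBrDr -lerBrDl.
exists j, x; split => //.
  by rewrite ler0_norm ?subr_le0 // opprB ltrBlDr -ltrBlDl (lt_le_trans _ x1) // ltrD2l ltrN2.
by rewrite (pb_curveE (sided_in_piece sx)).
Qed.

Lemma param_component (d : R) : 0 < d -> exists2 xi, 0 < xi &
  forall y, `|y| < xi -> exists2 s, `|s| < d & dotp T (g s - P t) = y.
Proof.
move=> d0; have [c [c0 cE]] := param_vel.
(* [g] may run against the curve, with [c < 0]; the factor [c] makes the coordinate increasing at 0
   in either case. *)
pose X s := dotp (c *: T) (g s - P t).
have XE s : X s = c * dotp T (g s - P t) by rewrite /X dotpZl.
have dc : 0 < dotp (c *: T) (g1 0).
  by rewrite cE dotpZl dotpZr unitT mulr1 -expr2 lt_def sqrf_eq0 c0 sqr_ge0.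
have [r r0 h] := dd_pos_right (vderiv_dotpl (c *: T) (vderivB_cst (P t) (gd 0))) dc.
have [m m0 [mr md]] : exists2 m, 0 < m & m < r /\ m < d.
  have q0 : 0 < Num.min r d by rewrite lt_min r0.
  have q1 : Num.min r d <= r by rewrite ge_min lexx.
  have q2 : Num.min r d <= d by rewrite ge_min lexx orbT.
  have qh := half_lt q0; exists (Num.min r d / 2); first exact: divr_gt0.
  by split; [exact: lt_le_trans qh q1|exact: lt_le_trans qh q2].
have X0 : X 0 = 0 by rewrite /X g0 subrr (dotp0r (c *: T)).
have Xp : 0 < X m.
  have [|/(_ m0) + _] := h m; first by rewrite subr0 gtr0_norm.
  by rewrite -/(X 0) -/(X m) X0.
have Xn : X (- m) < 0.
  have [|_] := h (- m); first by rewrite subr0 normrN gtr0_norm.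
  by rewrite oppr_lt0 => /(_ m0); rewrite -/(X 0) -/(X (- m)) X0.
have cn : 0 < `|c| by rewrite normr_gt0.
exists (Num.min (X m) (- X (- m)) / `|c|).
  by rewrite divr_gt0 // lt_min Xp oppr_gt0.
move=> y; rewrite ltr_pdivlMr // mulrC -normrM lt_min !ltr_norml => /andP[/andP[_ y1] /andP[y2 _]].
have mm : - m <= m by rewrite -subr_ge0 opprK addr_ge0 // ltW.
have yy : X (- m) <= c * y <= X m by rewrite opprK in y2; rewrite !ltW.
have [s /andP[s1 s2] E] := dd_ivt mm (fun x _ => vderiv_dotpl (c *: T) (vderivB_cst (P t) (gd x))) yy.
exists s; first by apply: le_lt_trans md; rewrite ler_norml s1.
by apply: (mulfI c0); rewrite -XE.
Qed.

(** Carries an extremum of [tdist] on the curve over to [g]; the converse inclusion [curve_on_param]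
    carries a minimum of the distance along [g] over to the curve. *)
Lemma param_on_curve (d : R) : 0 < d -> exists2 r, 0 < r &
  forall s, `|s| < r -> exists i x, [/\ sided i x, `|x - t| < d & P x = g s].
Proof.
move=> d0; have [r0 r00 hm] := param_match.
have d'0 : 0 < Num.min d r0 by rewrite lt_min d0.
have [xi xi0 hc] := curve_component d'0.
have [r1 r10 h1] := dd_cont (vderiv_dotpl T (vderivB_cst (P t) (gd 0))) xi0.
exists (Num.min r0 r1); first by rewrite lt_min r00.
move=> s; rewrite lt_min => /andP[s0 s1].
have := h1 s; rewrite subr0 g0 subrr (dotp0r T) subr0 => /(_ s1) sx.
have [i [x [six xt E]]] := hc _ sx; move: xt; rewrite lt_min => /andP[xd xr].
exists i, x; split => //; apply: (hm s i x) => //.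
have -> : P x - g s = (P x - P t) - (g s - P t) by rewrite opprB addrA subrK.
by rewrite dotpBr E subrr.
Qed.

Lemma curve_on_param (d : R) : 0 < d -> exists2 r, 0 < r &
  forall i x, sided i x -> `|x - t| < r -> exists2 s, `|s| < d & g s = P x.
Proof.
move=> d0; have [r0 r00 hm] := param_match.
have d'0 : 0 < Num.min d r0 by rewrite lt_min d0.
have [xi xi0 hc] := param_component d'0.
have [r1 r10 h1] := dd_cont (vderiv_dotpl T (pieceB_vderiv P j (P t) t)) xi0.
have [r2 r20 h2] := dd_cont (vderiv_dotpl T (pieceB_vderiv P k (P t) t)) xi0.
exists (Num.min r0 (Num.min r1 r2)); first by rewrite !lt_min r00 r10.
move=> i x six; rewrite !lt_min => /and3P[x0 x1 x2].
have sx : `|dotp T (P x - P t)| < xi.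
  rewrite (pb_curveE (sided_in_piece six)); case: (six) => [[-> _]|[-> _]].
    by have := h1 x x1; rewrite -(pb_curveE ijt) subrr (dotp0r T) subr0.
  by have := h2 x x2; rewrite -(pb_curveE ikt) subrr (dotp0r T) subr0.
have [s sd E] := hc _ sx; move: sd; rewrite lt_min => /andP[sd sr].
exists s => //; apply/esym; apply: (hm s i x) => //.
have -> : P x - g s = (P x - P t) - (g s - P t) by rewrite opprB addrA subrK.
by rewrite dotpBr E subrr.
Qed.

(** Absolute values appear because the two curves may run in opposite directions. *)
Lemma param_tdist i x s : `|s| < eta -> in_piece i x -> P x = g s ->
  `|dotp (g s - p) (g1 s) / enorm (g1 s)| = `|tdist i x|.
Proof.
move=> se ix E; have vc := param_parallel se ix E.
have v0 := vel_neq0 ix; have gE := crossp_eq0_parallel v0 vc; set c := _ / _ in gE; clearbody c.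
have c0 : c != 0 by apply: contra_neq (g1n se) => c0; rewrite gE c0 scale0r.
have cn : `|c| != 0 by rewrite normr_eq0.
have vn := lt0r_neq0 (enorm_gt0 v0).
rewrite /tdist /speed -(pb_curveE ix) E gE enormZ dotpZr !normrM !normfV !normrM normr_id.
rewrite (ger0_norm (enorm_ge0 (vel i x))).
by move: `|c| `|dotp _ _| (enorm _) cn vn => a b d an dn; field; rewrite an dn.
Qed.

End LocalParametrization.

Section Equilibria.
Variables (R : realType) (K : set (plane R)) (L : R) (P : periodic_boundary K L).
Variables (p : plane R) (e : R).
Implicit Types (i j k n : nat) (s t x y : R) (w z : plane R).
Local Notation tau := (pb_tau P).
Local Notation G := (pb_piece P).
Local Notation vel := (pb_vel P).
Local Notation in_piece := (in_piece P).
Local Notation tdist := (tdist P p).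
Local Notation tangent := (tangent P).
Hypotheses (cK : compact K) (vK : convex_set K) (pK : strictly_inside K p).
Hypotheses (e2 : e ^+ 2 = 1) (eK : forall j t, in_piece j t -> supporting P e j t).

Lemma local_param_data (q : plane R) (g : R -> plane R) (eta : R) :
  local_parametrization K q g eta -> exists g1 g2 : R -> plane R,
  [/\ (forall s, vderiv g s (g1 s)) /\ (forall s, vderiv g1 s (g2 s)), 0 < eta, g 0 = q,
      (forall s, `|s| < eta -> boundary K (g s)) & (forall s, `|s| < eta -> g1 s != 0)].
Proof.
move=> [[eta0 g0] sg _ gn [U _ UE]]; exists (derive1 g), (derive1n 2 g); split => //.
- by split=> s; [exact: smooth_vderiv0|exact: smooth_vderiv1].
- move=> s; rewrite ltr_norml => se; have : (boundary K `&` U) (g s).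
    by rewrite UE; exists s => //=; rewrite in_itv.
  by case.
- by move=> s; rewrite ltr_norml => se; apply: gn; rewrite in_itv.
Qed.

Lemma inside_not_boundary z : boundary K z -> z != p.
Proof.
move=> bz; have [Kz _] := proj1 (compact_boundary _ cK) bz.
have [n n0 sn] := support_normal cK vK (ex_intro _ _ Kz) bz.
apply: contraTneq (pK Kz n0 sn) => ->; by rewrite subrr (dotp0r n) ltxx.
Qed.

Lemma both_pieces t : 0 < t -> exists j k, tau j < t <= tau j.+1 /\ tau k <= t < tau k.+1.
Proof.
move=> t0; have [j jt] := left_piece P t0; have [k kt] := right_piece P (ltW t0).
by exists j, k.
Qed.

Lemma half_tangent_right k t : tau k <= t < tau k.+1 -> half_tangent K (P t) (tangent k t).
Proof.
move=> kt; have ikt := in_piece_of_right kt; case/andP: kt => k1 k2.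
apply: half_tangent_limit => r r0.
have [r1 r10 h1] := direction_limit (piece_vderiv P k t) (vel_neq0 ikt) r0.
have [r2 r20 h2] := vderiv_cont (piece_vderiv P k t) r0.
pose m := Num.min (Num.min r1 r2) (Num.min (tau k.+1 - t) 1).
have m0 : 0 < m by rewrite !lt_min r10 r20 subr_gt0 k2 ltr01.
have [m1 m2 m3 m4] : [/\ m <= r1, m <= r2, m <= tau k.+1 - t & m <= 1].
  by rewrite /m !ge_min !lexx !orbT.
have mh := half_lt m0; have mp : 0 < m / 2 by exact: divr_gt0.
clearbody m; pose x := t + m / 2; have tx : t < x by rewrite ltrDl.
have xt : `|x - t| = m / 2 by rewrite /x addrC addKr gtr0_norm.
have kx : in_piece k x.
  by rewrite /in_piece (le_trans k1 (ltW tx)) /= /x -lerBrDl (le_trans (ltW mh)).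
have t0 := in_piece_ge0 ikt.
exists (P x); split.
- by apply: pb_boundary; exact: in_piece_ge0 kx.
- rewrite eq_sym; apply: (pb_inj P t0 tx).
  by rewrite /x ltrD2l (lt_le_trans mh).
- by rewrite (pb_curveE kx) (pb_curveE ikt); apply: h2; rewrite xt (lt_le_trans mh).
- rewrite (pb_curveE kx) (pb_curveE ikt); have [|h _] := h1 x.
    by rewrite xt (lt_le_trans mh).
  exact: h.
Qed.

Lemma half_tangent_left j t : tau j < t <= tau j.+1 -> half_tangent K (P t) (- tangent j t).
Proof.
move=> jt; have ijt := in_piece_of_left jt; case/andP: jt => j1 j2.
apply: half_tangent_limit => r r0.
have [r1 r10 h1] := direction_limit (piece_vderiv P j t) (vel_neq0 ijt) r0.
have [r2 r20 h2] := vderiv_cont (piece_vderiv P j t) r0.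
pose m := Num.min (Num.min r1 r2) (Num.min (t - tau j) 1).
have m0 : 0 < m by rewrite !lt_min r10 r20 subr_gt0 j1 ltr01.
have [m1 m2 m3 m4] : [/\ m <= r1, m <= r2, m <= t - tau j & m <= 1].
  by rewrite /m !ge_min !lexx !orbT.
have mh := half_lt m0; have mp : 0 < m / 2 by exact: divr_gt0.
clearbody m; pose x := t - m / 2; have tx : x < t by rewrite gtrBl.
have xt : `|x - t| = m / 2 by rewrite /x addrAC subrr add0r normrN gtr0_norm.
have jx : in_piece j x.
  by rewrite /in_piece (le_trans (ltW tx) j2) andbT /x lerBrDr -lerBrDl (le_trans (ltW mh)).
have x0 := in_piece_ge0 jx.
exists (P x); split.
- exact: pb_boundary.
- apply: (pb_inj P x0 tx).
  by rewrite -ltrBlDl opprB addrC subrK (lt_le_trans mh).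
- by rewrite (pb_curveE jx) (pb_curveE ijt); apply: h2; rewrite xt (lt_le_trans mh).
- rewrite (pb_curveE jx) (pb_curveE ijt); have [|_ h] := h1 x.
    by rewrite xt (lt_le_trans mh).
  by rewrite opprK; exact: h.
Qed.

(** [q] lies on the normal line at [P t], so [q - P t] makes a right angle with a half tangent,
    which at a corner is not acute. At a smooth point the second derivative of the distance from [q]
    is, up to a nonzero factor, the derivative of the tangential distance from [p], which vanishes
    at an extremum. The sign [sg] treats maxima and minima together. *)
Lemma degenerate_extremum t i (sg d : R) : 0 < t -> in_piece i t -> sg ^+ 2 = 1 ->
  0 < sg * tdist i t -> 0 < d ->
  (forall i' x, in_piece i' x -> `|x - t| < d -> sg * tdist i' x <= sg * tdist i t) ->
  let q : plane R := p + tdist i t *: tangent i t in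
  equilibrium K q (P t) /\ ~ Defs.nondegenerate K q (P t).
Proof.
move=> t0 it sg2 M0 d0 Mmax q.
have [j [k [jt kt]]] := both_pieces t0.
have ijt := in_piece_of_left jt; have ikt := in_piece_of_right kt.
have [rs rs0 hs] := sided_near jt kt.
have sit : sided P j k t i t by apply: hs => //; rewrite subrr normr0.
set M := tdist i t in M0 Mmax q *; set T := tangent i t in q *.
have TT : dotp T T = 1 by exact: dotp_tangent it.
have T0 : T != 0 by rewrite -dotp_eq0 TT oner_eq0.
have zq : P t - q = (P t - p) - M *: T by rewrite /q opprD addrA.
have qT : dotp T (P t - q) = 0.
  by rewrite zq dotpBr dotpZr TT mulr1 dotpC -tdistE // subrr.
have cq : 0 < e * crossp T (p - P t).
  rewrite /T /tangent crosspZl mulrCA pmulr_rgt0; first exact: inner_crossp_gt0.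
  by rewrite invr_gt0; exact: speed_gt0.
have zqp : e * crossp T (P t - q) < 0.
  rewrite zq crosspBr crosspZr crosspp mulr0 subr0 -(opprB p) (crosspNr T) mulrN oppr_lt0 //.
have zqn : P t - q != 0.
  by apply: contraTneq zqp => ->; rewrite (crossp0r T) mulr0 ltxx.
have zne : P t <> q by move=> E; move: zqn; rewrite E subrr eqxx.
have bz := pb_boundary P (ltW t0).
split.
  split => //; right; right => w Kw.
  have -> := dotp_eq0_parallel T0 qT; rewrite TT divr1 dotpZl dotp_rot.
  have h1 : 0 <= e * crossp T (w - P t).
    rewrite /T /tangent crosspZl mulrCA mulr_ge0 ?invr_ge0 ?enorm_ge0 //; exact: eK.
  have -> : crossp T (P t - q) * crossp T (w - P t) =
      (e ^+ 2) * (crossp T (P t - q) * crossp T (w - P t)) by rewrite e2 mul1r.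
  have -> : forall a b : R, e ^+ 2 * (a * b) = (e * a) * (e * b) by move=> a b; ring.
  by rewrite mulr_le0_ge0 // ltW.
case=> [[_ [//|[g [eta [lp dd]]]]]|[_ [_ ang]]]; last first.
  have h u : half_tangent K (P t) u -> dotp (q - P t) u = 0 -> False.
    move=> /ang; rewrite /angle => + E; by rewrite E mul0r acos0 ltxx.
  have E : dotp (q - P t) T = 0 by rewrite -opprB dotpNl dotpC qT oppr0.
  case: sit => [[ij _]|[ik _]].
    apply: (h (- T)); last by rewrite dotpNr E oppr0.
    by rewrite /T ij; exact: half_tangent_left.
  by apply: (h T) => //; rewrite /T ik; exact: half_tangent_right.
have [g1 [g2 [[gd g1d] eta0 g0 gbd g1n]]] := local_param_data lp.
move/eqP: dd; apply.
have sT i' : sided P j k t i' t -> tangent i' t = T.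
  move=> s'; rewrite (tangent_vel_sided cK pK e2 eK jt kt gd eta0 g0 gbd g1n s' erefl).
  by rewrite /T (tangent_vel_sided cK pK e2 eK jt kt gd eta0 g0 gbd g1n sit erefl).
have sM i' : in_piece i' t -> sided P j k t i' t -> tdist i' t = M.
  by move=> it' s'; rewrite /M !tdistE // sT.
have zeta : `|0 : R| < eta by rewrite normr0.
have [c [c0 cE]] : exists c, c != 0 /\ g1 0 = c *: T.
  have h : crossp T (g1 0) = 0.
    rewrite /T /tangent crosspZl.
    by rewrite (param_parallel cK e2 eK gd gbd zeta it (esym g0)) mulr0.
  have E := crossp_eq0_parallel T0 h; exists (dotp T (g1 0) / dotp T T); split => //.
  by apply: contra_neq (g1n _ zeta) => c0; rewrite E c0 scale0r.
have gq : exists2 r, 0 < r & forall s, `|s| < r -> g s != q.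
  have [r r0 h] := vderiv_cont (gd 0) (enorm_gt0 zqn).
  exists r => // s sr; have := h s; rewrite subr0 => /(_ sr) b.
  apply: contraTneq b => ->; rewrite g0 -leNgt -opprB enormN lexx //.
case: gq => r r0 gq.
have gq0 : dotp (g 0 - q) (g1 0) = 0 by rewrite g0 cE dotpZr dotpC qT mulr0.
rewrite (distance_derive2E gd g1d r0 gq gq0).
pose F s := dotp (g s - p) (g1 s) / enorm (g1 s).
have Fd := dd_tangential p gd g1d (g1n _ zeta); rewrite -/F in Fd.
have wn := lt0r_neq0 (enorm_gt0 (g1n _ zeta)).
have cn : `|c| != 0 by rewrite normr_eq0.
have F0 : F 0 = Num.sg c * M.
  rewrite /F g0 cE enormZ dotpZr; have -> : enorm T = 1 by rewrite /enorm TT sqrtr1.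
  rewrite mulr1 /M (tdistE p it) -/T {1}[c]numEsg.
  by move: (Num.sg c) `|c| cn (dotp _ _) => a b bn m; field.
have Fmax : exists2 r', 0 < r' & forall s, `|s| < r' -> `|F s| <= sg * M.
  (* Near [t] the function [tdist] keeps the sign of its extreme value, so the absolute value in the
     comparison with [F] can be removed. *)
  have posn i' : in_piece i' t -> sided P j k t i' t ->
      exists2 r1, 0 < r1 & forall x, `|x - t| < r1 -> 0 < sg * tdist i' x.
    move=> it' s'; apply: (dd_pos_near (dd_scale sg (dd_tdist p it'))).
    by rewrite sM.
  case/andP: (jt) => j1 j2; case/andP: (kt) => k1 k2.
  have [||rj rj0 hj] := posn j => //; first by left; rewrite lexx ltW.
  have [||rk rk0 hk] := posn k => //; first by right; rewrite lexx ltW.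
  have m0 : 0 < Num.min d (Num.min rj rk) by rewrite !lt_min d0 rj0.
  have [r1 r10 h1] := param_on_curve cK vK pK e2 eK jt kt gd g1d eta0 g0 gbd g1n m0.
  exists (Num.min eta r1); first by rewrite lt_min eta0.
  move=> s; rewrite lt_min => /andP[se s1].
  have [i' [x [six xt E]]] := h1 s s1; have ix := sided_in_piece jt kt six.
  move: xt; rewrite !lt_min => /and3P[xd xj xk].
  rewrite (param_tdist p cK e2 eK gd gbd g1n se ix E).
  have pos : 0 < sg * tdist i' x by case: six => [[-> _]|[-> _]]; [exact: hj|exact: hk].
  have le := Mmax i' x ix xd; apply: le_trans le.
  have sgn : `|sg| = 1.
    by apply/eqP; rewrite -(eqrXn2 (n := 2)) // real_normK ?num_real // sg2 expr1n.
  by rewrite -[X in X <= _]mul1r -sgn -normrM gtr0_norm.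
case: Fmax => r' r'0 Fmax.
have Fz : (sg * Num.sg c) * ((dotp (g1 0) (g1 0) + dotp (g 0 - p) (g2 0) -
    dotp (g 0 - p) (g1 0) * dotp (g1 0) (g2 0) / dotp (g1 0) (g1 0)) / enorm (g1 0)) = 0.
  apply: (dd_local_max (dd_scale (sg * Num.sg c) Fd) r'0) => s; rewrite subr0 => sr.
  rewrite F0; have -> : sg * Num.sg c * (Num.sg c * M) = (Num.sg c ^+ 2) * (sg * M) by ring.
  rewrite sqr_sg c0 mul1r; apply: le_trans (Fmax s sr); apply: le_trans (ler_norm _) _.
  rewrite !normrM normr_sg c0 mulr1.
  have sgn : `|sg| = 1.
    by apply/eqP; rewrite -(eqrXn2 (n := 2)) // real_normK ?num_real // sg2 expr1n.
  by rewrite sgn mul1r.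
have sgc : sg * Num.sg c != 0.
  rewrite mulf_neq0 ?sgr_eq0 //; apply: contra_eq_neq sg2 => ->.
  by rewrite expr0n eq_sym oner_eq0.
move/eqP: Fz; rewrite mulf_eq0 (negbTE sgc) /= mulf_eq0 invr_eq0 (negbTE wn) orbF => /eqP Fz.
suff -> : dotp (g1 0) (g1 0) + dotp (g 0 - q) (g2 0) = 0 by rewrite mul0r.
(* With [g1 0 = c *: T], the projection term in the derivative of [F] is [M * dotp T (g2 0)], which
   is exactly the effect of replacing [p] by [q]. *)
apply: (etrans _ Fz); rewrite -(addrA (dotp (g1 0) (g1 0))); congr (_ + _).
have -> : g 0 - q = (g 0 - p) - M *: T by rewrite g0.
rewrite (dotpBl (g 0 - p) (M *: T)) (dotpZl T M); congr (_ - _).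
rewrite cE !(dotpZl T c) !(dotpZr _ c T) TT mulr1 g0 /M (tdistE p it) -/T.
move: (dotp T (g2 0)) (dotp (P t - p) T) => a b; by field.
Qed.

(** A stable point other than [p] is a strict local minimum of the distance. By the mean value
    theorem the derivative of the squared distance, which has the sign of [tdist], is positive
    somewhere just after [t] and negative somewhere just before. *)
Lemma stable_min t : 0 < t -> stable K p (P t) ->
  (forall i, in_piece i t -> tdist i t = 0) /\
  forall d : R, 0 < d ->
    (exists i x, [/\ t < x < t + d, in_piece i x & 0 < tdist i x]) /\
    (exists i x, [/\ t - d < x < t, in_piece i x & tdist i x < 0]).
Proof.
move=> t0 [[bz eq] [_ st]]; have zp := inside_not_boundary bz.
case: eq => [zE|sup]; first by rewrite zE eqxx in zp.
case: st => [zE|[g [eta [lp dd]]]]; first by rewrite zE eqxx in zp.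
have [g1 [g2 [[gd g1d] eta0 g0 gbd g1n]]] := local_param_data lp.
have [j [k [jt kt]]] := both_pieces t0.
have ijt := in_piece_of_left jt; have ikt := in_piece_of_right kt.
have zeta : `|0 : R| < eta by rewrite normr0.
have zg : dotp (P t - p) (g1 0) = 0.
  case: sup => sup.
    by apply: (param_normal cK gd gbd zeta) => w Kw; rewrite g0; exact: sup.
  apply: oppr_inj; rewrite -dotpNl oppr0.
  apply: (param_normal cK gd gbd zeta) => w Kw; rewrite g0 dotpNl oppr_ge0; exact: sup.
have g1z := g1n _ zeta.
have T0 i : in_piece i t -> tdist i t = 0.
  move=> it; rewrite tdistE //.
  have h : crossp (g1 0) (vel i t) = 0.
    by rewrite crosspC (param_parallel cK e2 eK gd gbd zeta it (esym g0)) oppr0.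
  by rewrite /tangent (crossp_eq0_parallel g1z h) !dotpZr zg !mulr0.
split=> // d d0.
have gp s : `|s| < eta -> g s != p by move=> /gbd; exact: inside_not_boundary.
rewrite -g0 in zg.
have [r r0 hmin] := dist_strict_min gd g1d eta0 gp zg dd.
have [r1 r10 h1] := curve_on_param cK vK pK e2 eK jt kt gd g1d eta0 g0 gbd g1n r0.
(* Injectivity over one period excludes that a nearby point of the curve is [P t] again, so the
   strict minimum along [g] stays strict along the curve. *)
have far i x : sided P j k t i x -> `|x - t| < r1 -> `|x - t| < 1 -> x != t ->
    enorm (P t - p) < enorm (P x - p).
  move=> six xr x1 xt; have [s sr E] := h1 i x six xr; rewrite -E -g0; apply: hmin => //.
  apply: contra_neq xt => s0; apply/eqP; apply: contraT => xt.
  have x0 := in_piece_ge0 (sided_in_piece jt kt six).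
  move: E; rewrite s0 g0 => E; move: xt; rewrite neq_lt => /orP[xt|tx].
    have := pb_inj P x0 xt; rewrite -E eqxx; apply.
    by move: x1; rewrite ltr0_norm ?subr_lt0 // opprB ltrBlDl addrC.
  have := pb_inj P (ltW t0) tx; rewrite -E eqxx; apply.
  by move: x1; rewrite gtr0_norm ?subr_gt0 // ltrBlDl.
have sq u v : (dotp (u - p) (u - p) < dotp (v - p) (v - p)) = (enorm (u - p) < enorm (v - p)).
  by rewrite -!enorm_sqr ltr_pXn2r // nnegrE enorm_ge0.
have Dd i x : is_derive x (1 : R) (fun y => dotp (G i y - p) (G i y - p))
    (2 * dotp (G i x - p) (vel i x)).
  apply: dd_eq (vderiv_dotp (pieceB_vderiv P i p x) (pieceB_vderiv P i p x)) _.
  by rewrite (dotpC (vel i x)) mulr2n mulrDl mul1r.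
case/andP: (jt) => j1 j2; case/andP: (kt) => k1 k2.
have pick (b : R) : 0 < b -> exists2 m, 0 < m & [/\ m < d, m < r1, m < 1 & m <= b].
  move=> b0; pose m := Num.min (Num.min d r1) (Num.min 1 b).
  have m0 : 0 < m by rewrite !lt_min d0 r10 ltr01.
  have [a1 a2 a3 a4] : [/\ m <= d, m <= r1, m <= 1 & m <= b].
    by rewrite /m !ge_min !lexx !orbT.
  have mh := half_lt m0; exists (m / 2); first exact: divr_gt0.
  by split; [exact: lt_le_trans mh a1|exact: lt_le_trans mh a2|exact: lt_le_trans mh a3|
    exact: le_trans (ltW mh) a4].
split.
  have [|m m0 [md mr m1 mk]] := pick (tau k.+1 - t); first by rewrite subr_gt0.
  have tm : t < t + m by rewrite ltrDl.
  have ktm : in_piece k (t + m) by rewrite /in_piece (le_trans k1 (ltW tm)) -lerBrDl.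
  have xm : `|t + m - t| = m by rewrite addrC addKr gtr0_norm.
  have stm : sided P j k t k (t + m) by right; rewrite (ltW tm) -lerBrDl.
  have := far k (t + m) stm; rewrite xm => /(_ mr m1); rewrite gt_eqF // => /(_ isT).
  rewrite -sq (pb_curveE ktm) (pb_curveE ikt) => lt.
  have [x /andP[x1 x2] E] := dd_mvt tm (fun x _ => Dd k x).
  have kx : in_piece k x by rewrite /in_piece (le_trans k1 (ltW x1)) (le_trans (ltW x2)) // -lerBrDl.
  exists k, x; split => //; first by rewrite x1 (lt_trans x2) // ltrD2l.
  rewrite divr_gt0 //; last exact: speed_gt0 kx.
  have mm : t + m - t = m by rewrite addrC addKr.
  by move: lt; rewrite -subr_gt0 E mm pmulr_lgt0 // pmulr_rgt0.
have [|m m0 [md mr m1 mj]] := pick (t - tau j); first by rewrite subr_gt0.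
have tm : t - m < t by rewrite gtrBl.
have jm : tau j <= t - m by rewrite lerBrDr -lerBrDl.
have jtm : in_piece j (t - m) by rewrite /in_piece jm (le_trans (ltW tm)).
have xm : `|t - m - t| = m by rewrite addrAC subrr add0r normrN gtr0_norm.
have stm : sided P j k t j (t - m) by left; rewrite (ltW tm) jm.
have := far j (t - m) stm; rewrite xm => /(_ mr m1); rewrite lt_eqF // => /(_ isT).
rewrite -sq (pb_curveE jtm) (pb_curveE ijt) => lt.
have [x /andP[x1 x2] E] := dd_mvt tm (fun x _ => Dd j x).
have jx : in_piece j x by rewrite /in_piece (le_trans jm (ltW x1)) (le_trans (ltW x2)).
exists j, x; split => //; first by rewrite x2 andbT (lt_trans _ x1) // ltrD2l ltrN2.
rewrite pmulr_llt0 ?invr_gt0; last exact: speed_gt0 jx.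
have mm : t - (t - m) = m by rewrite opprB addrC subrK.
have : 2 * dotp (G j x - p) (vel j x) * (t - (t - m)) < 0 by rewrite -E subr_lt0.
by rewrite mm pmulr_llt0 // pmulr_rlt0.
Qed.

End Equilibria.

(** * Arcs between stable points *)

Section Arcs.
Variables (R : realType) (K : set (plane R)) (L : R) (P : periodic_boundary K L).
Variables (p : plane R) (e : R).
Implicit Types (i j k n : nat) (s t x y a b : R) (w z : plane R).
Local Notation tau := (pb_tau P).
Local Notation G := (pb_piece P).
Local Notation vel := (pb_vel P).
Local Notation len := (pb_len P).
Local Notation in_piece := (in_piece P).
Local Notation tdist := (tdist P p).
Local Notation tangent := (tangent P).
Local Notation psi := (psi P p).
Hypotheses (cK : compact K) (vK : convex_set K) (pK : strictly_inside K p).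
Hypotheses (e2 : e ^+ 2 = 1) (eK : forall j t, in_piece j t -> supporting P e j t).

Lemma len_piece_lt j s t : in_piece j s -> in_piece j t -> s < t -> len s < len t.
Proof.
move=> js jt st; rewrite -subr_gt0 (pb_lenE js jt).
have sub x : s <= x <= t -> in_piece j x.
  move: js jt => /andP[h1 h2] /andP[h3 h4] /andP[h5 h6].
  by rewrite /in_piece (le_trans h1) // (le_trans h6).
have [c /andP[c1 c2] ->] := dd_mvt st (fun x h => pb_prim_derive (sub x h)).
by rewrite mulr_gt0 ?subr_gt0 //; apply: speed_gt0; apply: sub; rewrite !ltW.
Qed.

Lemma len_piece_le j s t : in_piece j s -> in_piece j t -> s <= t -> len s <= len t.
Proof.
by move=> js jt; rewrite le_eqVlt => /predU1P[->//|/(len_piece_lt js jt)/ltW].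
Qed.

Lemma piece_le i k s t : in_piece i s -> in_piece k t -> s < t -> (i <= k)%N.
Proof.
move=> /andP[i1 i2] /andP[k1 k2] st; rewrite leqNgt; apply/negP => h.
by have := le_lt_trans (le_trans (tau_le P h) i1) (lt_le_trans st k2); rewrite ltxx.
Qed.

Lemma xle_of_lt i k s t : in_piece i s -> in_piece k t -> s < t -> param_le i s k t.
Proof.
move=> si kt st; have := piece_le si kt st; rewrite leq_eqVlt => /predU1P[->|ik].
  by right; rewrite ltW.
by left.
Qed.

Lemma len_tau_le i k : (i <= k)%N -> len (tau i) <= len (tau k).
Proof.
elim: k => [|k IH]; first by rewrite leqn0 => /eqP ->.
rewrite leq_eqVlt => /predU1P[->//|ik]; apply: le_trans (IH ik) _.
by apply: len_piece_le (in_piece_l P k) (in_piece_r P k) _; exact: ltW (pb_tau_lt P k).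
Qed.

Lemma len_le s t : 0 <= s -> s <= t -> len s <= len t.
Proof.
move=> s0; rewrite le_eqVlt => /predU1P[->//|st].
have [i si] := right_piece P s0; have si' := in_piece_of_right si.
have [k kt] := right_piece P (le_trans s0 (ltW st)); have kt' := in_piece_of_right kt.
have := piece_le si' kt' st; rewrite leq_eqVlt => /predU1P[ik|ik].
  by apply: (len_piece_le si') (ltW st); rewrite ik.
apply: le_trans (len_piece_le si' (in_piece_r P i) _) _; first by case/andP: si'.
apply: le_trans (len_tau_le ik) _.
by apply: (len_piece_le (in_piece_l P k) kt'); case/andP: kt'.
Qed.

Lemma len_lt s t : 0 <= s -> s < t -> len s < len t.
Proof.
move=> s0 st; have [i si] := right_piece P s0; have si' := in_piece_of_right si.
case/andP: (si) => i1 i2.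
have sm : s < Num.min t (tau i.+1) by rewrite lt_min st i2.
have im : in_piece i (Num.min t (tau i.+1)).
  by rewrite /in_piece (le_trans i1 (ltW sm)) ge_min lexx orbT.
apply: lt_le_trans (len_piece_lt si' im sm) _.
by apply: len_le; rewrite ?(le_trans s0 (ltW sm)) // ge_min lexx.
Qed.

(** The maximum is over pairs of piece and parameter, so both one-sided values compete at a
    junction. Each piece meets the interval in a compact set, and only finitely many pieces meet
    it. *)
Lemma piecewise_max (f df : nat -> R -> R) a b :
  (forall i x, in_piece i x -> is_derive x 1 (f i) (df i x)) -> 0 <= a -> a <= b ->
  exists i x, [/\ in_piece i x, a <= x <= b &
    forall i' x', in_piece i' x' -> a <= x' <= b -> f i' x' <= f i x].
Proof.
move=> fd a0 ab.
have main n : (exists i x, [/\ (i < n)%N, in_piece i x & a <= x <= b]) ->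
    exists i x, [/\ in_piece i x, a <= x <= b &
    forall i' x', (i' < n)%N -> in_piece i' x' -> a <= x' <= b -> f i' x' <= f i x].
  elim: n => [|n IH] H; first by case: H => [? [? []]].
  have last : (exists x, in_piece n x /\ a <= x <= b) -> exists x, [/\ in_piece n x, a <= x <= b &
      forall x', in_piece n x' -> a <= x' <= b -> f n x' <= f n x].
    move=> [x0 [/andP[n1 n2] /andP[x1 x2]]].
    have lm : Num.max a (tau n) <= Num.min b (tau n.+1).
      by rewrite ge_max !le_min ab (le_trans x1 n2) (le_trans n1 x2) (le_trans n1 n2).
    have sub x : Num.max a (tau n) <= x <= Num.min b (tau n.+1) -> in_piece n x /\ a <= x <= b.
      by rewrite ge_max le_min => /andP[/andP[h1 h2] /andP[h3 h4]]; rewrite /in_piece h1 h2 h3 h4.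
    have [x xm xmax] := EVT_max lm (dd_within (fun x h => fd n x (sub x h).1)).
    have [nx abx] := sub x xm; exists x; split => // x' /andP[n3 n4] /andP[h3 h4].
    by apply: xmax; rewrite in_itv /= ge_max le_min n3 n4 h3 h4.
  case: (pselect (exists i x, [/\ (i < n)%N, in_piece i x & a <= x <= b])) => [/IH|no].
    move=> [i [x [ix abx imax]]].
    case: (pselect (exists x, in_piece n x /\ a <= x <= b)) => [/last|no].
      move=> [y [ny aby ymax]]; case: (leP (f i x) (f n y)) => h.
        exists n, y; split => // i' x'; rewrite ltnS leq_eqVlt => /predU1P[->|lt] ix' abx'.
          exact: ymax.
        by apply: le_trans h; exact: imax.
      exists i, x; split => // i' x'; rewrite ltnS leq_eqVlt => /predU1P[->|lt] ix' abx'.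
        by apply: le_trans (ltW h); exact: ymax.
      exact: imax.
    exists i, x; split => // i' x'; rewrite ltnS leq_eqVlt => /predU1P[->|lt] ix' abx'.
      by case: no; exists x'.
    exact: imax.
  have [|y [ny aby ymax]] := last.
    case: H => [i [x [lt ix abx]]]; move: lt; rewrite ltnS leq_eqVlt => /predU1P[ei|lt].
      by exists x; rewrite -ei.
    by case: no; exists i, x.
  exists n, y; split => // i' x'; rewrite ltnS leq_eqVlt => /predU1P[->|lt] ix' abx'.
    exact: ymax.
  by case: no; exists i', x'.
have [n bn] := tau_unbounded P b; have bound i x : in_piece i x -> a <= x <= b -> (i < n)%N.
  move=> /andP[i1 _] /andP[_ xb]; rewrite ltnNge; apply/negP => /(tau_le P) h.
  by have := le_lt_trans (le_trans h (le_trans i1 xb)) bn; rewrite ltxx.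
have [k ka] := right_piece P a0; have ka' := in_piece_of_right ka.
have aab : a <= a <= b by rewrite lexx ab.
have [|i [x [ix abx imax]]] := main n.
  by exists k, a; split => //; exact: bound ka' aab.
exists i, x; split => // i' x' ix' abx'; exact: imax (bound _ _ ix' abx') ix' abx'.
Qed.

Definition escape_radius : R := inf [set enorm (q - p) | q in ~` robust_region K p].

(** Having any number of stable points includes nondegeneracy of all equilibria, so one degenerate
    equilibrium puts [q] outside the region. *)
Lemma escape_radius_le (q : plane R) z : equilibrium K q z -> ~ Defs.nondegenerate K q z ->
  escape_radius <= enorm (q - p).
Proof.
move=> eq nd; apply: ge_inf.
  by exists 0 => _ [w _ <-]; exact: enorm_ge0.
exists q => //= -[S' _ [nd' _]]; apply: nd; exact: nd'.
Qed.

Lemma extremum_ge t i (sg d : R) : 0 < t -> in_piece i t -> sg ^+ 2 = 1 ->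
  0 < sg * tdist i t -> 0 < d ->
  (forall i' x, in_piece i' x -> `|x - t| < d -> sg * tdist i' x <= sg * tdist i t) ->
  escape_radius <= sg * tdist i t.
Proof.
move=> t0 it sg2 M0 d0 Mmax.
have [eq nd] := degenerate_extremum cK vK pK e2 eK t0 it sg2 M0 d0 Mmax.
apply: le_trans (escape_radius_le eq nd) _.
rewrite addrAC subrr add0r enormZ.
have -> : enorm (tangent i t) = 1 by rewrite /enorm (dotp_tangent it) sqrtr1.
have sgn : `|sg| = 1.
  by apply/eqP; rewrite -(eqrXn2 (n := 2)) // real_normK ?num_real // sg2 expr1n.
by rewrite mulr1 -[X in X <= _]mul1r -sgn -normrM gtr0_norm.
Qed.

(** [tdist] vanishes at both ends of the arc, so a positive maximum lies strictly inside it and is a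
    local maximum along the whole curve. *)
Lemma arc_extremum a b (sg : R) : 0 < a -> a < b -> sg ^+ 2 = 1 ->
  (forall i, in_piece i a -> tdist i a = 0) -> (forall i, in_piece i b -> tdist i b = 0) ->
  (exists i x, [/\ a < x < b, in_piece i x & 0 < sg * tdist i x]) ->
  exists i x, [/\ a < x < b, in_piece i x, 0 < sg * tdist i x &
    escape_radius <= sg * tdist i x].
Proof.
move=> a0 ab sg2 ta tb [i0 [x0 [/andP[ax0 xb0] ix0 pos0]]].
have [i [x [ix /andP[ax xb] xmax]]] := piecewise_max
  (fun i x h => dd_scale sg (dd_tdist p h)) (ltW a0) (ltW ab).
have pos : 0 < sg * tdist i x.
  by apply: lt_le_trans pos0 _; apply: xmax => //; rewrite !ltW.
have ax' : a < x.
  rewrite lt_def ax andbT; apply: contraTneq pos => xa; rewrite xa in ix *.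
  by rewrite ta // mulr0 ltxx.
have xb' : x < b.
  rewrite lt_def xb andbT; apply: contraTneq pos => bx; rewrite -bx in ix *.
  by rewrite tb // mulr0 ltxx.
exists i, x; split; rewrite ?ax' //.
have d0 : 0 < Num.min (x - a) (b - x) by rewrite lt_min !subr_gt0 ax'.
apply: (extremum_ge (lt_trans a0 ax') ix sg2 pos d0) => i' x' ix'.
rewrite lt_min !ltr_norml => /andP[/andP[h1 h2] /andP[h3 h4]].
apply: xmax => //; apply/andP; split.
  by move: h1; rewrite opprB ltrBrDr subrK => /ltW.
by move: h4; rewrite ltrBlDr subrK => /ltW.
Qed.

Lemma stable_arc a b : 0 < a -> a < b -> stable K p (P a) -> stable K p (P b) ->
  exists i x j y, [/\ a < x < b, a < y < b, in_piece i x & in_piece j y] /\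
   [/\ 0 < tdist i x, tdist j y < 0, escape_radius <= tdist i x & tdist j y <= - escape_radius].
Proof.
move=> a0 ab sa sb; have b0 := lt_trans a0 ab.
have [ta ha] := stable_min cK vK pK e2 eK a0 sa.
have [tb hb] := stable_min cK vK pK e2 eK b0 sb.
have ba : 0 < b - a by rewrite subr_gt0.
have [[i1 [x1 [x1ab ix1 p1]]] _] := ha _ ba.
have [_ [i2 [x2 [x2ab ix2 p2]]]] := hb _ ba.
rewrite addrC subrK in x1ab; rewrite opprB addrC subrK in x2ab.
have [||i [x [xab ix xp xr]]] := arc_extremum (sg := 1) a0 ab _ ta tb.
- by rewrite expr1n.
- by exists i1, x1; rewrite mul1r.
rewrite !mul1r in xp xr.
have [||j [y [yab jy yn yr]]] := arc_extremum (sg := -1) a0 ab _ ta tb.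
- by rewrite sqrrN expr1n.
- by exists i2, x2; rewrite mulN1r oppr_gt0.
exists i, x, j, y; split => //; split => //.
  by rewrite mulN1r oppr_gt0 in yn.
by rewrite mulN1r in yr; rewrite lerNr.
Qed.

(* The rigidity alternative of the second conclusion is what makes equality
   force a corner in the middle of the arc. *)
Lemma arc_length_ge a b : 0 < a -> a < b -> stable K p (P a) -> stable K p (P b) ->
  2 * escape_radius <= len b - len a /\
  (len b - len a = 2 * escape_radius -> exists i j v,
     [/\ a < v < b, in_piece i v, in_piece j v & len v = len a + escape_radius] /\
     [/\ tdist i v = escape_radius, tdist j v = - escape_radius,
         psi i v = len a & psi j v = len b]).
Proof.
move=> a0 ab sa sb; have b0 := lt_trans a0 ab.
have [ta _] := stable_min cK vK pK e2 eK a0 sa.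
have [tb _] := stable_min cK vK pK e2 eK b0 sb.
have [i [x [j [y [[/andP[ax xb] /andP[ay yb] ix jy] [Mp mn rM rm]]]]]] := stable_arc a0 ab sa sb.
have [ka kaa] := right_piece P (ltW a0); have ka' := in_piece_of_right kaa.
have [kb kbb] := right_piece P (ltW b0); have kb' := in_piece_of_right kbb.
have pa : psi ka a = len a by rewrite /psi ta // subr0.
have pb : psi kb b = len b by rewrite /psi tb // subr0.
have le k1 s1 k2 s2 : in_piece k1 s1 -> in_piece k2 s2 -> s1 < s2 -> psi k1 s1 <= psi k2 s2.
  move=> h1 h2 h3; apply: (psi_le cK pK e2 eK h1 h2); exact: xle_of_lt.
have q1 := le _ _ _ _ ka' ix ax; have q2 := le _ _ _ _ jy kb' yb.
rewrite pa in q1; rewrite pb in q2.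
have la := len_lt (ltW a0) ay; have lb := len_lt (ltW (lt_trans a0 ax)) xb.
(* If the minimum comes first, monotonicity of [psi] puts at least [2 * escape_radius] of arc length
   between the two points, and the arc extends beyond them at both ends: the inequality is
   strict. *)
have ylem : psi j y <= psi i x -> 2 * escape_radius < len b - len a.
  rewrite /psi => h; clear -la lb h rM rm; move: la lb h rM rm.
  by move: (len a) (len b) (len x) (len y) (tdist i x) (tdist j y) => *; lra.
(* If the maximum comes first, monotonicity of [psi] from [a] to [x] and from [y] to [b] gives
   [escape_radius] at either end; equality leaves no length between [x] and [y]. *)
have xlem : len x <= len y -> 2 * escape_radius <= len b - len a.
  move: q1 q2; rewrite /psi => q1 q2 h; clear -q1 q2 h rM rm; move: q1 q2 h rM rm.
  by move: (len a) (len b) (len x) (len y) (tdist i x) (tdist j y) => *; lra.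
case: (ltgtP x y) => [xy|yx|xy].
- have lxy := len_lt (ltW (lt_trans a0 ax)) xy; split; first exact: xlem (ltW lxy).
  move=> E; exfalso; move: q1 q2; rewrite /psi => q1 q2; clear -q1 q2 lxy rM rm E.
  move: q1 q2 lxy rM rm E.
  by move: (len a) (len b) (len x) (len y) (tdist i x) (tdist j y) => *; lra.
- have h := ylem (le _ _ _ _ jy ix yx); split; first exact: ltW.
  by move=> E; rewrite E ltxx in h.
- subst y; split; first exact: xlem.
  move=> E; exists i, j, x; rewrite ax xb; move: q1 q2; rewrite /psi => q1 q2.
  have [F1 F2 F3] : [/\ tdist i x = escape_radius, tdist j x = - escape_radius &
      len x = len a + escape_radius].
    clear -q1 q2 rM rm E; move: q1 q2 rM rm E.
    by move: (len a) (len b) (len x) (tdist i x) (tdist j x) => *; split; lra.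
  split; split => //; rewrite ?F1 ?F2 F3.
    by rewrite addrK.
  by rewrite opprK -addrA -mulr2n -[X in _ + X = _]mulr_natl -E addrC subrK.
Qed.

End Arcs.

Lemma crosspDr (R : realType) (u v w : plane R) : crossp u (v + w) = crossp u v + crossp u w.
Proof. by rewrite /crossp !plE; ring. Qed.

(** * Cyclic sequence of stable points and the equality case *)

Section StableSequence.
Variables (R : realType) (K : set (plane R)) (L : R) (P : periodic_boundary K L).
Variable p : plane R.
Implicit Types (i j k n : nat) (s t x y : R) (w z : plane R).
Local Notation len := (pb_len P).

Lemma curve_period n t : 0 <= t -> P (t + n%:R) = P t.
Proof.
elim: n => [|n IH] t0; first by rewrite addr0.
by rewrite -natr1 addrA pb_curve_per ?IH // addr_ge0.
Qed.

(** Parameters are taken in []0, 1]], a stable point at the start of the curve being moved to 1, so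
    that each of them has a piece before it. *)
Lemma stable_parameters (S : nat) : has_stable_points K S p ->
  exists s : seq R, [/\ size s = S, sorted <%R s &
    {in s, forall t, 0 < t <= 1 /\ stable K p (P t)}].
Proof.
move=> [_]; rewrite card_eq_sym => /card_set_bijP[h [hfun hinj _]].
have par (i : nat) : exists t, (i < S)%N -> [/\ 0 < t <= 1, stable K p (P t) & P t = h i].
  case: (ltnP i S) => iS; last by exists 0.
  have st : stable K p (h i) by apply: hfun.
  have [[bz _] _] := st; have [t /andP[t0 t1] tE] := pb_surj P bz.
  move: t0; rewrite le_eqVlt => /predU1P[t0|t0].
    have P1 : P 1 = h i by rewrite -(add0r 1) pb_curve_per // t0 tE.
    by exists 1 => _; rewrite P1 ltr01 lexx.
  by exists t => _; rewrite t0 ltW // tE.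
have [u hu] := choice par.
exists (sort <=%R [seq u i | i <- iota 0 S]); split.
- by rewrite size_sort size_map size_iota.
- rewrite lt_sorted_uniq_le sort_le_sorted andbT sort_uniq map_inj_in_uniq ?iota_uniq //.
  move=> i j; rewrite !mem_iota !add0n /= => iS jS uij.
  apply: hinj; rewrite ?inE //.
  by have [_ _ <-] := hu i iS; have [_ _ <-] := hu j jS; rewrite uij.
- move=> t; rewrite mem_sort => /mapP[i]; rewrite mem_iota add0n /= => iS ->.
  by have [] := hu i iS.
Qed.

(** Continuing over all turns makes the arc across the start of the curve an arc like the others. *)
Lemma stable_sequence (S : nat) : (0 < S)%N -> has_stable_points K S p ->
  exists sig : nat -> R, [/\ forall i, 0 < sig i, forall i, sig i < sig i.+1,
    forall i, sig (i + S)%N = sig i + 1 & forall i, stable K p (P (sig i))].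
Proof.
move=> S0 /stable_parameters[s [sz ss sP]].
have modS i : (i %% S < S)%N by rewrite ltn_mod.
have nP i : (i < S)%N -> 0 < nth 0 s i <= 1 /\ stable K p (P (nth 0 s i)).
  by move=> iS; apply: sP; rewrite mem_nth ?sz.
exists (fun i => nth 0 s (i %% S)%N + (i %/ S)%:R); split => i.
- by have [/andP[h _] _] := nP _ (modS i); rewrite ltr_wpDr.
- have := modS i; rewrite leq_eqVlt => /predU1P[iS|iS].
    have iE : (i.+1 = (i %/ S).+1 * S)%N.
      by rewrite {1}(divn_eq i S) -addnS iS mulSn addnC.
    rewrite {1 2}iE modnMl mulnK // -natr1.
    have [/andP[_ h1] _] := nP _ (modS i); have [/andP[h2 _] _] := nP _ S0.
    by move: h1 h2; move: (nth 0 s (i %% S)%N) (nth 0 s 0) ((i %/ S)%:R : R) => a b c *; lra.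
  have iE : (i.+1 = (i %/ S) * S + (i %% S).+1)%N by rewrite addnS -divn_eq.
  rewrite {1 2}iE modnMDl divnMDl // (modn_small iS) (divn_small iS) addn0 ltrD2r.
  have := sorted_ltn_nth lt_trans 0 ss; rewrite sz => h.
  by apply: h; rewrite ?inE // ltnW.
- by rewrite modnDr divnDr // divnn S0 natrD addrA.
- have [/andP[h _] st] := nP _ (modS i).
  by rewrite curve_period // ltW.
Qed.

End StableSequence.

Section Counting.
Variables (R : realType) (K : set (plane R)) (L : R) (P : periodic_boundary K L).
Variables (p : plane R) (e : R) (S : nat).
Implicit Types (i j k n : nat) (s t x y : R) (w z : plane R).
Local Notation len := (pb_len P).
Local Notation tau := (pb_tau P).
Local Notation in_piece := (in_piece P).
Local Notation tdist := (tdist P p).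
Local Notation tangent := (tangent P).
Local Notation psi := (psi P p).
Local Notation r0 := (escape_radius K p).
Hypotheses (cK : compact K) (vK : convex_set K) (pK : strictly_inside K p).
Hypotheses (e2 : e ^+ 2 = 1) (eK : forall j t, in_piece j t -> supporting P e j t).
Hypothesis S0 : (0 < S)%N.
Variable sig : nat -> R.
Hypotheses (sig0 : forall i, 0 < sig i) (sig_lt : forall i, sig i < sig i.+1)
  (sigS : forall i, sig (i + S)%N = sig i + 1) (sigP : forall i, stable K p (P (sig i))).

Let arc i := arc_length_ge cK vK pK e2 eK (sig0 i) (sig_lt i) (sigP i) (sigP i.+1).

Lemma arcs_sum i : \sum_(i <= k < i + S) (len (sig k.+1) - len (sig k)) = L.
Proof.
rewrite telescope_sumr ?leq_addr // sigS pb_len_per ?ltW //.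
by rewrite addrAC subrr add0r.
Qed.

Lemma perimeter_ge : (2 * S%:R) * r0 <= L.
Proof.
rewrite -(arcs_sum 0) add0n.
have -> : (2 * S%:R) * r0 = \sum_(0 <= k < S) (2 * r0).
  by rewrite big_const_nat subn0 iter_addr_0 -mulr_natl; ring.
by apply: ler_sum => k _; case: (arc k).
Qed.

Hypothesis LE : L = (2 * S%:R) * r0.

Lemma arc_eq i : len (sig i.+1) - len (sig i) = 2 * r0.
Proof.
have E : \sum_(i <= k < i + S) (len (sig k.+1) - len (sig k) - 2 * r0) = 0.
  rewrite sumrB arcs_sum big_const_nat addKn iter_addr_0 -mulr_natl LE; ring.
move/eqP: E; rewrite psumr_eq0; last by move=> k _; rewrite subr_ge0; case: (arc k).
move/allP => /(_ i); rewrite mem_index_iota leqnn -[X in (X < _)%N]addn0 ltn_add2l S0.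
by move=> /(_ isT) /=; rewrite subr_eq0 => /eqP.
Qed.

(** The drop of [tdist] is concentrated at [v i]. The recorded values of [psi] are the lengths at
    the two neighbouring stable points, so [psi] is constant from one corner to the next. *)
Lemma corners : exists (v : nat -> R) (l r : nat -> nat), forall i,
  [/\ sig i < v i < sig i.+1, in_piece (l i) (v i), in_piece (r i) (v i) &
      len (v i) = len (sig i) + r0] /\
  [/\ tdist (l i) (v i) = r0, tdist (r i) (v i) = - r0,
      psi (l i) (v i) = len (sig i) & psi (r i) (v i) = len (sig i.+1)].
Proof.
have ex i : exists x : R * nat * nat,
  [/\ sig i < x.1.1 < sig i.+1, in_piece x.1.2 x.1.1, in_piece x.2 x.1.1 &
      len x.1.1 = len (sig i) + r0] /\
  [/\ tdist x.1.2 x.1.1 = r0, tdist x.2 x.1.1 = - r0,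
      psi x.1.2 x.1.1 = len (sig i) & psi x.2 x.1.1 = len (sig i.+1)].
  by have [_ /(_ (arc_eq i))[j [k [v H]]]] := arc i; exists (v, j, k).
have [f hf] := choice ex.
by exists (fun i => (f i).1.1), (fun i => (f i).1.2), (fun i => (f i).2).
Qed.

Variables (v : nat -> R) (l r : nat -> nat).
Hypothesis vP : forall i,
  [/\ sig i < v i < sig i.+1, in_piece (l i) (v i), in_piece (r i) (v i) &
      len (v i) = len (sig i) + r0] /\
  [/\ tdist (l i) (v i) = r0, tdist (r i) (v i) = - r0,
      psi (l i) (v i) = len (sig i) & psi (r i) (v i) = len (sig i.+1)].

Lemma v_gt0 i : 0 < v i.
Proof. by have [[/andP[h _] _ _ _] _] := vP i; exact: lt_trans h. Qed.

Lemma v_lt i : v i < v i.+1.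
Proof.
have [[/andP[_ h1] _ _ _] _] := vP i; have [[/andP[h2 _] _ _ _] _] := vP i.+1.
exact: lt_trans h2.
Qed.

Lemma v_mono i j : (i < j)%N -> v i < v j.
Proof.
elim: j => [//|j IH]; rewrite ltnS leq_eqVlt => /predU1P[->|/IH h]; first exact: v_lt.
exact: lt_trans (v_lt j).
Qed.

(** Length is strictly increasing, and each corner is determined by its length. *)
Lemma v_period i : v (i + S)%N = v i + 1.
Proof.
have v0 := v_gt0 i; have v0S := v_gt0 (i + S).
have E : len (v (i + S)%N) = len (v i + 1).
  rewrite pb_len_per ?ltW //; have [[_ _ _ ->] _] := vP i; have [[_ _ _ ->] _] := vP (i + S).
  by rewrite sigS pb_len_per ?ltW // addrAC.
have v1 : 0 <= v i + 1 by rewrite addr_ge0 ?ltW.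
by case: (ltgtP (v (i + S)%N) (v i + 1)) => // [/(len_lt P (ltW v0S))|/(len_lt P v1)]; rewrite E ltxx.
Qed.

Definition side_dir i : plane R := tangent (r i) (v i).
Definition corner i : plane R := P (v i).

(** [psi] equals [len (sig i.+1)] both on leaving corner [i] and on reaching corner [i.+1], so
    rigidity applies to everything in between; [tdist] climbs from [- r0] to [r0], which is the side
    length. *)
Lemma run i : side_dir i = tangent (l i.+1) (v i.+1) /\
  corner i.+1 - corner i = (2 * r0) *: side_dir i.
Proof.
have [[_ _ ri _] [_ F1 _ E1]] := vP i; have [[_ li _ _] [F2 _ E2 _]] := vP i.+1.
have h := rigid cK pK e2 eK ri li (xle_of_lt ri li (v_lt i)).
have [|h1 h2] := h; first by rewrite E1 E2.
split=> //; rewrite /corner h2 F1 F2; congr (_ *: _); ring.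
Qed.

Lemma run_between i k x : in_piece k x -> v i < x < v i.+1 ->
  P x - corner i = (len x - len (v i)) *: side_dir i.
Proof.
move=> kx /andP[vx xv].
have [[_ _ ri L1] [_ F1 _ E1]] := vP i; have [[_ li _ _] [_ _ E2 _]] := vP i.+1.
have le1 := psi_le cK pK e2 eK ri kx (xle_of_lt ri kx vx).
have le2 := psi_le cK pK e2 eK kx li (xle_of_lt kx li xv).
have E : psi (r i) (v i) = psi k x.
  by apply/eqP; rewrite eq_le le1 E1 -E2.
have [_ ->] := rigid cK pK e2 eK ri kx (xle_of_lt ri kx vx) E.
congr (_ *: _); move: E; rewrite /psi F1.
by move: (tdist k x) (len x) (len (v i)) => *; lra.
Qed.

Lemma run_segment i x : v i <= x <= v i.+1 ->
  exists2 a, 0 <= a <= 1 & P x = a *: corner i + (1 - a) *: corner i.+1.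
Proof.
move=> /andP[]; rewrite le_eqVlt => /predU1P[<- _|vx].
  by exists 1; rewrite ?ler01 ?lexx // subrr scale0r addr0 scale1r.
rewrite le_eqVlt => /predU1P[->|xv].
  by exists 0; rewrite ?ler01 ?lexx // subr0 scale0r add0r scale1r.
have x0 : 0 <= x by exact: le_trans (ltW (v_gt0 i)) (ltW vx).
have [k kx] := right_piece P x0; have kx' := in_piece_of_right kx.
have h := run_between kx' (introT andP (conj vx xv)).
have [_ h2] := run i.
have l1 := len_lt P (ltW (v_gt0 i)) vx; have l2 := len_lt P x0 xv.
have ll : len (v i.+1) - len (v i) = 2 * r0.
  have [[_ _ _ L1] _] := vP i; have [[_ _ _ L2] _] := vP i.+1.
  have := arc_eq i; rewrite L1 L2; move: (len _) (len _) r0 => *; lra.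
have r00 : 0 < 2 * r0 by rewrite -ll subr_gt0 (lt_trans l1).
have [a a2] : exists a, a * (2 * r0) = len (v i.+1) - len x.
  by exists ((len (v i.+1) - len x) / (2 * r0)); rewrite divfK // lt0r_neq0.
exists a.
  apply/andP; split; first by rewrite -(pmulr_lge0 _ r00) a2 subr_ge0 ltW.
  by rewrite -(ler_pM2r r00) a2 mul1r -ll lerD2l lerN2 ltW.
have -> : P x = corner i + (len x - len (v i)) *: side_dir i by rewrite -h addrC subrK.
have -> : corner i.+1 = corner i + (2 * r0) *: side_dir i by rewrite -h2 addrC subrK.
move: (side_dir i) => D; rewrite scalerDr addrA -scalerDl scalerA (addrC a) subrK scale1r; congr (_ + _ *: _).
have -> : (1 - a) * (2 * r0) = 2 * r0 - a * (2 * r0) by ring.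
by rewrite a2 -ll; ring.
Qed.

Lemma corner_inj i j : (i < S)%N -> (j < S)%N -> corner i = corner j -> i = j.
Proof.
have lt a b : (a < b)%N -> (b < S)%N -> corner a != corner b.
  move=> ab bS; apply: (pb_inj P (ltW (v_gt0 a)) (v_mono ab)).
  by rewrite -v_period; apply: v_mono; rewrite ltn_addl.
move=> iS jS E; case: (ltngtP i j) => // ij.
  by have := lt i j ij jS; rewrite E eqxx.
by have := lt j i ij iS; rewrite E eqxx.
Qed.

Lemma corner_period i : corner (i + S)%N = corner i.
Proof. by rewrite /corner v_period pb_curve_per // ltW // v_gt0. Qed.

Lemma r0_gt0 : 0 < r0.
Proof.
have [[/andP[h _] _ _ L1] _] := vP 0.
by have := len_lt P (ltW (sig0 0)) h; rewrite L1 ltrDl.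
Qed.

Lemma side_unit i : dotp (side_dir i) (side_dir i) = 1.
Proof. by have [[_ _ ri _] _] := vP i; exact: dotp_tangent ri. Qed.

(** Along their side consecutive corners have coordinates [- r0] and [r0]. The coordinate across the
    side is the same for all sides: a common corner has a single distance from [p], so consecutive
    values agree up to sign, and the orientation fixes the sign. *)
Lemma corner_coord : exists2 h : R, h != 0 & forall i,
  corner i - p = - r0 *: side_dir i + h *: rot (side_dir i) /\
  corner i.+1 - p = r0 *: side_dir i + h *: rot (side_dir i).
Proof.
pose h i := crossp (side_dir i) (corner i - p).
have dec i : corner i - p = - r0 *: side_dir i + h i *: rot (side_dir i).
  have [[_ _ ri _] [_ F1 _ _]] := vP i.
  have d : dotp (corner i - p) (side_dir i) = - r0 by rewrite -F1 (tdistE p ri).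
  have u0 : side_dir i != 0 by rewrite -dotp_eq0 side_unit oner_eq0.
  have z0 : dotp (side_dir i) (corner i - p + r0 *: side_dir i) = 0.
    by rewrite dotpDr dotpZr side_unit mulr1 dotpC d addNr.
  have := dotp_eq0_parallel u0 z0; rewrite side_unit divr1 => E.
  rewrite crosspDr crosspZr crosspp mulr0 addr0 in E.
  by rewrite -[LHS](addrK (r0 *: side_dir i)) E addrC (scaleNr r0).
have dec' i : corner i.+1 - p = r0 *: side_dir i + h i *: rot (side_dir i).
  have [_ E] := run i; have -> : corner i.+1 = corner i + (2 * r0) *: side_dir i.
    by rewrite -E addrC subrK.
  rewrite addrAC dec; move: (side_dir i) (h i) => D a.
  by rewrite addrAC -scalerDl; congr (_ *: _ + _); ring.
have nrm (u : plane R) (a b : R) : dotp u u = 1 ->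
    dotp (a *: u + b *: rot u) (a *: u + b *: rot u) = a ^+ 2 + b ^+ 2.
  move=> uu; have -> : a ^+ 2 + b ^+ 2 = (a ^+ 2 + b ^+ 2) * dotp u u by rewrite uu mulr1.
  by rewrite /dotp /rot !plE /=; ring.
have hneg i : e * h i < 0.
  have [[_ _ ri _] _] := vP i; have s := inner_crossp_gt0 cK pK e2 eK ri.
  rewrite /h -(opprB p) (crosspNr (side_dir i)) mulrN oppr_lt0 /side_dir /tangent.
  by rewrite crosspZl mulrCA pmulr_rgt0 // invr_gt0; exact: speed_gt0.
have hS i : h i.+1 = h i.
  have E1 := nrm (side_dir i) r0 (h i) (side_unit i).
  have E2 := nrm (side_dir i.+1) (- r0) (h i.+1) (side_unit i.+1).
  rewrite -dec' in E1; rewrite -dec E1 (sqrrN r0) in E2.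
  have /eqP : h i ^+ 2 = h i.+1 ^+ 2 by apply: (addrI (r0 ^+ 2)).
  rewrite eq_sym eqf_sqr => /orP[/eqP//|/eqP hN]; have := hneg i; have := hneg i.+1.
  by rewrite hN mulrN oppr_lt0 => a b; have := lt_trans a b; rewrite ltxx.
have hc i : h i = h 0%N by elim: i => [//|i IH]; rewrite hS.
exists (h 0%N); last by move=> i; rewrite -(hc i); split; [exact: dec|exact: dec'].
by apply: contraTneq (hneg 0%N) => ->; rewrite mulr0 ltxx.
Qed.

Lemma boundary_hull z : boundary K z -> polygon_hull (fun i : 'I_S => corner i) z.
Proof.
have inh i : polygon_hull (fun i : 'I_S => corner i) (corner i).
  have E q m : corner (q * S + m)%N = corner m.
    elim: q => [|q IH]; first by rewrite mul0n add0n.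
    by rewrite mulSn -addnA addnC corner_period.
  rewrite (divn_eq i S) E; have iS : (i %% S < S)%N by rewrite ltn_mod.
  exact: (polygon_hull_vertex _ (Ordinal iS)).
move=> bz; have [t /andP[t0 t1] tE] := pb_surj P bz.
have vm m : v (m * S)%N = v 0%N + m%:R.
  elim: m => [|m IH]; first by rewrite mul0n addr0.
  by rewrite mulSn addnC v_period IH -natr1 addrA.
(* Corners are available from [v 0] onwards only; adding [n] turns moves the parameter of [z] past
   it. *)
have v0n : v 0%N < (Num.truncn (v 0%N)).+1%:R by case/andP: (truncn_itv (ltW (v_gt0 0))).
set n := (Num.truncn (v 0%N)).+1 in v0n.
have ex : exists i, t + n%:R < v i.
  exists (n.+1 * S)%N; rewrite vm -natr1; move: t1 (v_gt0 0).
  by move: (v 0%N) (n%:R : R) => a b *; lra.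
case: (ex_minnP ex) => -[|i] ti imin.
  by have := lt_trans v0n (le_lt_trans (_ : _ <= t + n%:R) ti); rewrite ltxx lerDr t0 => /(_ isT).
have it : v i <= t + n%:R by rewrite leNgt; apply/negP => /imin; rewrite ltnn.
have [a a01 E] := run_segment (introT andP (conj it (ltW ti))).
rewrite -tE -(curve_period P n t0) E; exact: polygon_hull_convex.
Qed.

Lemma body_hull : K = polygon_hull (fun i : 'I_S => corner i).
Proof.
apply/seteqP; split => z.
  move=> Kz; have [b1 [b2 [a [/boundary_hull h1 /boundary_hull h2 a01 ->]]]] := boundary_chord cK Kz.
  exact: polygon_hull_convex.
by apply: polygon_hull_sub => // i; apply: curve_boundary => //; rewrite ltW // v_gt0.
Qed.

End Counting.

(** * Recognition of regular polygons *)

Section RegularPolygonRecurrence.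
Import complex.
Variable R : realType.
Implicit Types (u v w : plane R) (t x y : R).
Local Notation C := (complex R).

(** In complex notation the rotation from corner to corner is a multiplication, to which the theory
    of roots of unity applies. *)
Definition toC u : C := Complex u.1 u.2.
Definition expi t : C := Complex (cos t) (sin t).

Lemma toC_inj : injective toC.
Proof. by move=> [a b] [c d] [-> ->]. Qed.

Lemma expiD t x : expi (t + x) = expi t * expi x.
Proof. by rewrite /expi cosD sinD; congr Complex; rewrite addrC [cos t * _]mulrC. Qed.

Lemma expi0 : expi 0 = 1.
Proof. by rewrite /expi cos0 sin0. Qed.

Lemma expiX t n : expi t ^+ n = expi (n%:R * t).
Proof.
elim: n => [|n IH]; first by rewrite expr0 mul0r expi0.
by rewrite exprS IH -expiD -natr1 mulrDl mul1r addrC.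
Qed.

Lemma expi_neq1 t : 0 < t < 2 * pi -> expi t != 1.
Proof.
move=> /andP[t0 t2]; apply/eqP => -[c1 _].
have : 0 < sin (t / 2).
  by apply: sin_gt0_pi; apply/andP; split; lra.
have : cos t = 1 - 2 * sin (t / 2) ^+ 2.
  have {1}-> : t = t / 2 + t / 2 by rewrite -splitr.
  rewrite cosD; have := cos2Dsin2 (t / 2); rewrite !expr2.
  by move: (cos _) (sin _) => a b h; lra.
rewrite c1 => h s0; have : 0 < sin (t / 2) ^+ 2 by rewrite exprn_gt0.
lra.
Qed.

(** The order [m] of this root divides [S]; for [m < S] the angle [2 pi m / S] lies strictly between
    0 and [2 pi], where [expi] is not 1. *)
Lemma expi_primitive (S : nat) : (0 < S)%N -> S.-primitive_root (expi (2 * pi / S%:R)).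
Proof.
move=> S0; have Sn : S%:R != 0 :> R by rewrite pnatr_eq0 -lt0n.
have w1 : expi (2 * pi / S%:R) ^+ S = 1.
  rewrite expiX mulrC divfK // /expi (_ : 2 * pi = 0 + pi *+ 2).
    by rewrite cosD2pi sinD2pi cos0 sin0.
  by rewrite add0r mulr_natl.
have [m mp mS] := prim_order_exists S0 w1.
have := dvdn_leq S0 mS; rewrite leq_eqVlt => /predU1P[mE|lt]; first by rewrite mE in mp.
have m0 : (0 < m)%N by exact: prim_order_gt0 mp.
have := prim_expr_order mp; rewrite expiX => /eqP; rewrite (negbTE (expi_neq1 _)) //.
have SR : 0 < S%:R :> R by rewrite ltr0n.
have pp := pi_gt0 R.
apply/andP; split; first by rewrite mulr_gt0 ?ltr0n // divr_gt0 // mulr_gt0.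
rewrite mulrA ltr_pdivrMr // mulrC ltr_pM2l ?mulr_gt0 // ltr_nat //.
Qed.

Lemma polar u : u != 0 -> exists2 rf : R * R, 0 < rf.1 & toC u = Complex rf.1 0 * expi rf.2.
Proof.
move=> u0; have n0 := enorm_gt0 u0; have n1 := lt0r_neq0 n0.
have sq : (u.1 / enorm u) ^+ 2 + (u.2 / enorm u) ^+ 2 = 1.
  rewrite !expr_div_n -mulrDl enorm_sqr.
  have -> : u.1 ^+ 2 + u.2 ^+ 2 = dotp u u by rewrite /dotp !expr2.
  by rewrite divff // lt0r_neq0 // dotp_gt0.
have b1 : -1 <= u.1 / enorm u <= 1.
  rewrite -ler_norml -(@ler_pXn2r _ 2) ?nnegrE // expr1n real_normK ?num_real // -sq.
  by rewrite lerDl sqr_ge0.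
pose a := acos (u.1 / enorm u).
have ca : cos a = u.1 / enorm u by rewrite acosK // in_itv.
have sa : sin a ^+ 2 = (u.2 / enorm u) ^+ 2.
  have := cos2Dsin2 a; rewrite ca -sq; exact: addrI.
move/eqP: sa; rewrite eqf_sqr => /orP[/eqP sa|/eqP sa].
  exists (enorm u, a) => //=; rewrite /toC /expi ca sa; congr Complex => /=.
    by rewrite mul0r subr0 mulrC divfK.
  by rewrite mul0r addr0 mulrC divfK.
exists (enorm u, - a) => //=; rewrite /toC /expi cosN sinN ca sa opprK; congr Complex => /=.
  by rewrite mul0r subr0 mulrC divfK.
by rewrite mul0r addr0 mulrC divfK.
Qed.

Definition regular_vertex (S : nat) (o : plane R) (r phi : R) (k : nat) : plane R :=
  o + r *: (cos (phi + 2 * pi * k%:R / S%:R), sin (phi + 2 * pi * k%:R / S%:R)).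

Lemma toC_regular_vertex S o r phi k :
  toC (regular_vertex S o r phi k - o) =
  Complex r 0 * expi phi * expi (2 * pi / S%:R) ^+ k.
Proof.
rewrite /regular_vertex addrAC subrr add0r expiX -(mulrA (Complex r 0)) -expiD.
have -> : (k%:R : R) * (2 * pi / S%:R) = 2 * pi * k%:R / S%:R.
  by rewrite [LHS]mulrC mulrAC.
by rewrite /toC /expi !plE /=; congr Complex; rewrite !mul0r ?subr0 ?addr0.
Qed.

(* With [D] as unit side directions, the recurrence says that every corner is
   obtained from the preceding one by the same rotation about [p]. *)
Lemma regular_of_recurrence (S : nat) (p : plane R) (r h : R) (D c : nat -> plane R) :
  (0 < S)%N -> r != 0 -> (forall i, dotp (D i) (D i) = 1) ->
  (forall i, c i - p = - r *: D i + h *: rot (D i) /\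
             c i.+1 - p = r *: D i + h *: rot (D i)) ->
  c S = c 0%N -> (forall i j, (i < S)%N -> (j < S)%N -> c i = c j -> i = j) ->
  exists (rho phi : R), 0 < rho /\ exists f : 'I_S -> 'I_S, bijective f /\
    forall i : 'I_S, c i = regular_vertex S p rho phi (f i).
Proof.
move=> S0 rn DD cD cS cinj.
(* In complex notation [W i = A D] and [W i.+1 = B D] for the same side direction [D], so the
   quotient [B / A] is common to all sides; since the corners close up, it is an [S]-th root of
   unity. *)
pose W i := toC (c i - p); pose A : C := Complex (- r) h; pose B : C := Complex r h.
have An : A != 0 by rewrite eq_complex /= oppr_eq0 (negbTE rn).
have WA i : W i = A * toC (D i).
  rewrite /W (cD i).1 /toC /A !plE /rot /=; congr Complex; rewrite ?plE /=; ring.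
have WB i : W i.+1 = B * toC (D i).
  rewrite /W (cD i).2 /toC /B !plE /rot /=; congr Complex; rewrite ?plE /=; ring.
have WQ i : W i.+1 = B / A * W i by rewrite WB WA mulrA divfK.
have Wi i : W i = (B / A) ^+ i * W 0%N.
  by elim: i => [|i IH]; rewrite ?mul1r // WQ IH exprS mulrA.
have Dn : D 0%N != 0 by rewrite -dotp_eq0 DD oner_eq0.
have W0 : W 0%N != 0.
  rewrite WA mulf_neq0 //; apply: contra Dn => /eqP E.
  by apply/eqP; apply: toC_inj; rewrite E.
have QS : (B / A) ^+ S = 1.
  apply: (mulIf W0); rewrite -Wi mul1r /W cS //.
have prim := expi_primitive S0.
have [m Qm] := prim_rootP prim QS.
have c0p : c 0%N - p != 0.
  by apply: contra W0 => /eqP E; rewrite /W E; apply/eqP.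
have [[rho phi] /= rho0 E0] := polar c0p.
exists rho, phi; split => //.
(* Each step multiplies by the [m]-th power of the primitive root. Distinctness of the corners makes
   [m * i] a permutation modulo [S], so the set of vertices is that of a regular polygon whatever
   [m] is. *)
pose f (i : 'I_S) : 'I_S := Ordinal (ltn_pmod (m * i) S0).
have cf (i : 'I_S) : c i = regular_vertex S p rho phi (f i).
  apply/eqP; rewrite -(subr_eq0 (c i)); apply/eqP.
  have -> : c i - regular_vertex S p rho phi (f i) =
     (c i - p) - (regular_vertex S p rho phi (f i) - p) by rewrite opprB addrA subrK.
  apply/eqP; rewrite subr_eq0; apply/eqP; apply: toC_inj.
  rewrite toC_regular_vertex -E0 -[LHS]/(W i) Wi Qm /= -exprM mulrC; congr (_ * _).
  by rewrite (prim_expr_mod prim).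
exists f; split => //; apply: injF_bij => i j fij.
by have := cinj i j (ltn_ord i) (ltn_ord j); rewrite !cf fij => /(_ erefl) /val_inj.
Qed.

Lemma polygon_hull_reindex (S : nat) (v w : 'I_S -> plane R) (f : 'I_S -> 'I_S) :
  bijective f -> (forall i, v i = w (f i)) -> polygon_hull v = polygon_hull w.
Proof.
move=> bf vw; apply/seteqP; split => z.
  move=> [a [a0 a1 ->]]; case: bf => g fg gf.
  exists (a \o g); split => //=.
    by rewrite (reindex_inj (can_inj fg)) /= -a1; apply: eq_bigr => i _; rewrite fg.
  by rewrite [RHS](reindex_inj (can_inj fg)) /=; apply: eq_bigr => i _; rewrite fg vw.
move=> [a [a0 a1 ->]]; exists (a \o f); split => //=.
  by rewrite -a1 [RHS](reindex_inj (bij_inj bf)).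
by rewrite [LHS](reindex_inj (bij_inj bf)) /=; apply: eq_bigr => i _; rewrite vw.
Qed.

End RegularPolygonRecurrence.

(** * Area and center of gravity *)

Section PlaneMeasure.
Variable R : realType.
Implicit Types (K A : set (plane R)) (w z p : plane R) (a b : R).
Local Notation mu1 := (@lebesgue_measure R).
Local Notation mu2 := (@lebesgue_measure R \x @lebesgue_measure R)%E.

Lemma same_cell_lt (x c a b : R) : x <= a -> a < x + c -> x <= b -> b < x + c -> `|a - b| < c.
Proof. by move=> *; rewrite ltr_norml; apply/andP; split; lra. Qed.

(** For each mesh [1 / (n + 1)] the grid cells meeting [K] form a countable union of boxes, and
    closedness makes [K] the intersection of these unions. *)
Lemma closed_plane_measurable K : closed K -> measurable K.
Proof.
move=> cK.
pose box (n : nat) (ij : int * int) : set (plane R) :=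
  [set` `[ij.1%:~R / n.+1%:R, (ij.1 + 1)%:~R / n.+1%:R[] `*`
  [set` `[ij.2%:~R / n.+1%:R, (ij.2 + 1)%:~R / n.+1%:R[].
have mbox n ij : measurable (box n ij).
  by apply: measurableX; exact: measurable_itv.
have -> : K = \bigcap_n \bigcup_ij [set z | box n ij z /\ box n ij `&` K !=set0].
  have n0 (n : nat) : 0 < n.+1%:R :> R by rewrite ltr0n.
  apply/seteqP; split => z.
    move=> Kz n _; exists (Num.floor (z.1 * n.+1%:R), Num.floor (z.2 * n.+1%:R)) => //.
    have bz : box n (Num.floor (z.1 * n.+1%:R), Num.floor (z.2 * n.+1%:R)) z.
      by split=> /=; rewrite in_itv /= ler_pdivrMr // ltr_pdivlMr //; exact: floor_itv.
    by split => //; exists z.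
  move=> H; rewrite (proj1 (closure_id K) cK) => B /plane_nbhsP[r r0 hB].
  have [n _ hn] := near_infty_natSinv_lt (PosNum r0).
  have [[i j] _ [[/= + +] [w [[/= + +] Kw]]]] := H n I.
  rewrite !in_itv /= => /andP[a1 a2] /andP[a3 a4] /andP[b1 b2] /andP[b3 b4].
  exists w; split => //; have nr := hn n (leqnn n); rewrite /= in nr.
  have E (k : int) : (k + 1)%:~R / n.+1%:R = k%:~R / n.+1%:R + n.+1%:R^-1 :> R.
    by rewrite intrD mulrDl mul1r.
  rewrite E in a2; rewrite E in b2; rewrite E in a4; rewrite E in b4.
  apply: hB; apply: lt_trans nr; first exact: (same_cell_lt b1 b2 a1 a2).
  exact: (same_cell_lt b3 b4 a3 a4).
apply: bigcap_measurable => [|n _]; first by exists 0%N.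
apply: countable_bigcupT_measurable => [|ij]; first exact: countableP.
case: (pselect (box n ij `&` K !=set0)) => [h|h].
  by rewrite (_ : [set _ | _] = box n ij) //; apply/seteqP; split => [z []|z].
by rewrite (_ : [set _ | _] = set0) //; apply/seteqP; split => [z []|z].
Qed.

Lemma compact_bounded K : compact K -> exists2 M : R, 0 < M &
  forall z, K z -> `|z.1| <= M /\ `|z.2| <= M.
Proof.
move=> cK; case: (pselect (K !=set0)) => [K0|K0]; last first.
  by exists 1 => // z Kz; case: K0; exists z.
have c1 : {within K, continuous (fun z : plane R => `|z.1| + `|z.2|)}.
  apply: continuous_subspaceT => z; apply: cvgD; apply: cvg_norm.
    exact: continuous_fst.
  exact: continuous_snd.
have [m _ mm] := compact_EVT_max K0 cK c1.
exists (`|m.1| + `|m.2| + 1); first by rewrite ltr_wpDl // addr_ge0.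
move=> z Kz; have := mm z (mem_set Kz) => h; split; apply: (le_trans _ (le_trans h _)).
- by rewrite lerDl.
- by rewrite lerDl.
- by rewrite lerDr.
- by rewrite lerDl.
Qed.

Lemma box_measure a b (c d : R) : a < b -> c < d ->
  mu2 ([set` `]a, b[] `*` [set` `]c, d[]) = ((b - a) * (d - c))%:E.
Proof.
move=> ab cd; rewrite product_measure1E //=.
by rewrite !lebesgue_measure_itv /= !lte_fin ab cd -!EFinB -EFinM.
Qed.

Lemma compact_measure_lty K : compact K -> (mu2 K < +oo)%E.
Proof.
move=> cK; have [M M0 hM] := compact_bounded cK.
apply: (@le_lt_trans _ _ (mu2 ([set` `](- M - 1), (M + 1)[] `*` [set` `](- M - 1), (M + 1)[]))).
  apply: le_measure; rewrite ?inE.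
  - by apply: closed_plane_measurable; apply: compact_closed => //; exact: norm_hausdorff.
  - by apply: measurableX; exact: measurable_itv.
  - move=> z /hM [z1 z2]; split; rewrite /= in_itv /=; move: z1 z2; rewrite !ler_norml;
    by move=> /andP[? ?] /andP[? ?]; apply/andP; split; lra.
by rewrite box_measure ?ltry //; lra.
Qed.

Lemma measurable_fstR : measurable_fun [set: plane R] (fst : plane R -> R).
Proof. exact: measurable_fst. Qed.

Lemma measurable_sndR : measurable_fun [set: plane R] (snd : plane R -> R).
Proof. exact: measurable_snd. Qed.

Lemma affine_measurable a b (c : R) :
  measurable_fun [set: plane R] (fun z : plane R => a * z.1 + b * z.2 + c).
Proof.
apply: measurable_funD; last exact: measurable_cst.
apply: measurable_funD; apply: measurable_funM.
- exact: measurable_cst.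
- exact: measurable_fstR.
- exact: measurable_cst.
- exact: measurable_sndR.
Qed.

Lemma affine_integrable K a b (c : R) : compact K ->
  mu2.-integrable K (EFin \o (fun z : plane R => a * z.1 + b * z.2 + c)).
Proof.
move=> cK; have [M M0 hM] := compact_bounded cK.
have mK : measurable K.
  by apply: closed_plane_measurable; apply: compact_closed => //; exact: norm_hausdorff.
apply: measurable_bounded_integrable => //.
- exact: compact_measure_lty.
- exact: measurable_funS (affine_measurable a b c).
- exists (`|a| * M + `|b| * M + `|c|); split; first exact: num_real.
  move=> x xM z /hM[z1 z2]; apply: le_trans (ltW xM) => /=.
  apply: le_trans (ler_normD _ _) _; rewrite lerD2r.
  apply: le_trans (ler_normD _ _) _; rewrite !normrM.
  by apply: lerD; exact: ler_wpM2l.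
Qed.

End PlaneMeasure.

Section Centroid.
Variable R : realType.
Local Notation planeM := (measurableTypeR R * measurableTypeR R)%type.
Implicit Types (K A : set (plane R)) (w z p : plane R) (a b c : R).
Local Notation mu1 := (@lebesgue_measure R).
Local Notation mu2 := (@lebesgue_measure R \x @lebesgue_measure R)%E.

Lemma compact_measurable K : compact K -> measurable K.
Proof.
by move=> cK; apply: closed_plane_measurable; apply: compact_closed => //; exact: norm_hausdorff.
Qed.

Lemma measure_area K : compact K -> mu2 K = (area K)%:E.
Proof.
move=> cK; rewrite /area fineK // ge0_fin_numE //; exact: compact_measure_lty.
Qed.

Lemma Rintegral_affine K a b c : compact K ->
  (\int[mu2]_(z in K) (a * z.1 + b * z.2 + c))%R =
  a * (\int[mu2]_(z in K) z.1)%R + b * (\int[mu2]_(z in K) z.2)%R + c * area K.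
Proof.
move=> cK; have mK := compact_measurable cK.
have i1 : mu2.-integrable K (EFin \o (fun z : plane R => z.1)).
  have := affine_integrable 1 0 0 cK; congr (_.-integrable _ _).
  by apply/funext => z /=; rewrite mul1r mul0r !addr0.
have i2 : mu2.-integrable K (EFin \o (fun z : plane R => z.2)).
  have := affine_integrable 0 1 0 cK; congr (_.-integrable _ _).
  by apply/funext => z /=; rewrite mul1r mul0r add0r !addr0.
have j1 : mu2.-integrable K (EFin \o (fun z : plane R => a * z.1)).
  have := affine_integrable a 0 0 cK; congr (_.-integrable _ _).
  by apply/funext => z /=; rewrite mul0r !addr0.
have j2 : mu2.-integrable K (EFin \o (fun z : plane R => b * z.2)).
  have := affine_integrable 0 b 0 cK; congr (_.-integrable _ _).
  by apply/funext => z /=; rewrite mul0r add0r !addr0.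
have j3 : mu2.-integrable K (EFin \o (fun z : plane R => a * z.1 + b * z.2)).
  have := affine_integrable a b 0 cK; congr (_.-integrable _ _).
  by apply/funext => z /=; rewrite !addr0.
have j4 : mu2.-integrable K (EFin \o (fun z : plane R => c)).
  have := affine_integrable 0 0 c cK; congr (_.-integrable _ _).
  by apply/funext => z /=; rewrite !mul0r !add0r.
by rewrite RintegralD // RintegralD // RintegralZl // RintegralZl // Rintegral_cst.
Qed.

Lemma area_gt0 K : compact K -> interior K !=set0 -> 0 < area K.
Proof.
move=> cK [w /plane_nbhsP[r r0 hK]]; rewrite -lte_fin -measure_area //.
have sl (x : R) : x - r < x + r by rewrite ltrBlDr -addrA ltrDl addr_gt0.
apply: (@lt_le_trans _ _ (mu2 ([set` `](w.1 - r), (w.1 + r)[] `*` [set` `](w.2 - r), (w.2 + r)[]))).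
  by rewrite box_measure ?sl // lte_fin mulr_gt0 // subr_gt0 sl.
apply: le_measure; rewrite ?inE; last first.
- move=> z [/=]; rewrite !in_itv /= => h1 h2; apply: hK.
    by rewrite ltr_distl.
  by rewrite ltr_distl.
- exact: compact_measurable.
- by apply: measurableX; exact: measurable_itv.
Qed.

(** [area K * dotp n (centroid K - z)] is the integral over [K] of [dotp n (x - z)], which is
    nonnegative and exceeds a positive constant on a small square contained in [K]. *)
Lemma centroid_strictly_inside K : compact K -> interior K !=set0 ->
  strictly_inside K (centroid K).
Proof.
move=> cK iK z n Kz n0 sn; have A0 := area_gt0 cK iK.
have [w /enorm_nbhsP[r r0 hK]] := iK.
have mK := compact_measurable cK.
pose f (x : plane R) : R := n.1 * x.1 + n.2 * x.2 + - dotp n z.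
have fE x : f x = dotp n (x - z) by rewrite dotpBr.
have E : (\int[mu2]_(x in K) f x)%R = area K * dotp n (centroid K - z).
  rewrite Rintegral_affine // dotpBr /centroid /dotp /=.
  have := lt0r_neq0 A0; move: (area K) => A An.
  by field.
rewrite -(pmulr_rgt0 _ A0) -E.
(* Moving the interior point [w] by [r / 2] in the direction of [n] stays inside [K] and makes the
   integrand positive. *)
pose w1 := w + (r / (2 * enorm n)) *: n.
have nn := enorm_gt0 n0.
have r1 : 0 < (r : R) by [].
have w1n : enorm (w1 - w) = r / 2.
  rewrite /w1 addrAC subrr add0r enormZ ger0_norm.
    by have := lt0r_neq0 nn; move: (enorm n) => y yn; field.
  by rewrite divr_ge0 ?mulr_ge0 ?ltW.
have Kw : K w by apply: hK; rewrite subrr /enorm dotp0r sqrtr0.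
have d0 : 0 < dotp n (w1 - z).
  have -> : w1 - z = (w - z) + (r / (2 * enorm n)) *: n by rewrite /w1 addrAC.
  rewrite dotpDr dotpZr ltr_wpDl ?sn // mulr_gt0 ?dotp_gt0 // divr_gt0 // mulr_gt0 //.
pose d := dotp n (w1 - z) / 2.
have dp : 0 < d by rewrite divr_gt0.
have cf : continuous (fun x : plane R => dotp n (x - z)).
  apply: (@continuous_dotp R (fun=> n) (fun x : plane R => x - z)) => x; first exact: cvg_cst.
  by apply: cvgB; [exact: cvg_id|exact: cvg_cst].
have [s s0 hs] : exists2 s : R, 0 < s & forall x, `|x.1 - w1.1| < s -> `|x.2 - w1.2| < s ->
    K x /\ d < dotp n (x - z).
  have nb : nbhs w1 [set x | d < dotp n (x - z)].
    have := cf w1 [set y | d < y]; apply; apply: open_nbhs_nbhs; split; first exact: open_gt.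
    by rewrite /= ltr_pdivrMr // mulr2n mulrDr mulr1 ltrDl.
  have nK : nbhs w1 K.
    apply/enorm_nbhsP; exists (r / 2); first by rewrite divr_gt0.
    move=> x xw; apply: hK; have -> : x - w = (x - w1) + (w1 - w) by rewrite addrA subrK.
    apply: le_lt_trans (enormD _ _) _; rewrite w1n.
    by rewrite [ltRHS](splitr r) ltrD2r.
  have : nbhs w1 (K `&` [set x | d < dotp n (x - z)]) by exact: filterI.
  by move=> /plane_nbhsP[s s0 hs]; exists s => // x x1 x2; exact: hs.
pose B : set (plane R) := [set` `](w1.1 - s), (w1.1 + s)[] `*` [set` `](w1.2 - s), (w1.2 + s)[].
have BK x : B x -> K x /\ d < f x.
  by move=> [/=]; rewrite !in_itv /= => h1 h2; rewrite fE; apply: hs; rewrite ltr_distl.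
have mB : measurable B by apply: measurableX; exact: measurable_itv.
have Bm : mu2 B = ((2 * s) * (2 * s))%:E.
  rewrite box_measure; last 2 first.
    by rewrite ltrBlDr -addrA ltrDl addr_gt0.
    by rewrite ltrBlDr -addrA ltrDl addr_gt0.
  by congr (_%:E); ring.
have fi := affine_integrable n.1 n.2 (- dotp n z) cK; rewrite -/f in fi.
have fi' : mu2.-integrable K (EFin \o f) by [].
have fin : (\int[mu2]_(x in K) (f x)%:E)%E \is a fin_num by exact: (integrable_fin_num _ fi').
rewrite /Rintegral.
rewrite -lte_fin fineK //.
apply: (@lt_le_trans _ _ (d * ((2 * s) * (2 * s)))%:E).
  by rewrite lte_fin !mulr_gt0.
rewrite EFinM -Bm -integral_cst //.
apply: (@le_trans _ _ (\int[mu2]_(x in B) (f x)%:E)%E).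
  apply: ge0_le_integral => //.
  - by move=> x _; rewrite lee_fin ltW.
  - by apply/measurable_EFinP; exact: measurable_funS (affine_measurable n.1 n.2 (- dotp n z)).
  - by move=> x /BK[_ h]; rewrite lee_fin ltW.
apply: ge0_subset_integral => //.
- by apply/measurable_EFinP; exact: measurable_funS (affine_measurable n.1 n.2 (- dotp n z)).
- by move=> x Kx; rewrite lee_fin fE; exact: sn.
- by move=> x /BK[].
Qed.

Definition measure_preserving (f : plane R -> plane R) : Prop :=
  measurable_fun [set: plane R] f /\
  forall A, measurable A -> mu2 (f @^-1` A) = mu2 A.

Lemma measure_preserving_comp (f g : plane R -> plane R) :
  measure_preserving f -> measure_preserving g -> measure_preserving (f \o g).
Proof.
move=> [mf pf] [mg pg]; split; first exact: measurableT_comp.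
move=> A mA; rewrite comp_preimage pg ?pf //.
by have := mf measurableT A mA; rewrite setTI.
Qed.

(** Lebesgue measure is determined by its values on half-open intervals, where the translated
    measure agrees with it. *)
Lemma lebesgue_translation (c : R) (A : set R) : measurable A ->
  mu1 ((fun x => x + c) @^-1` A) = mu1 A.
Proof.
move=> mA; have mf : measurable_fun [set: measurableTypeR R]
    (fun x : measurableTypeR R => x + c : measurableTypeR R).
  by apply: measurable_funD => //; exact: measurable_cst.
apply/esym/(@lebesgue_measure_unique R
  (measure_function_pushforward__canonical__measure_function_Measure mu1 mf)) => //.
move=> _ [[a b]] _ <-; rewrite [RHS](_ : _ = mu1 [set` `](a - c), (b - c)]]); last first.
  congr (mu1 _); apply/seteqP; split => x;
  by rewrite /preimage /= !in_itv /= ltrBlDr lerBrDr.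
rewrite !lebesgue_measure_itv /= !lte_fin ltrD2r; case: ifP => // _.
by congr (_%:E); ring.
Qed.

(** The shear translates every vertical section, and the area integrates the lengths of these
    sections. *)
Lemma measure_preserving_shear2 (a c : R) :
  measure_preserving (fun z => (z.1, z.2 + (a * z.1 + c))).
Proof.
have mf : measurable_fun [set: plane R] (fun z : plane R => (z.1, z.2 + (a * z.1 + c))).
  apply/measurable_fun_pairP; split; first exact: measurable_fst.
  have := affine_measurable a 1 c; apply: eq_measurable_fun => z _ /=.
  by rewrite mul1r addrCA addrA.
split => // A mA; rewrite /product_measure1; apply: eq_integral => x _ /=.
have -> : xsection ((fun z : plane R => (z.1, z.2 + (a * z.1 + c))) @^-1` A) x =
    (fun y => y + (a * x + c)) @^-1` xsection A x.
  by apply/seteqP; split => y; rewrite /xsection /= !inE.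
by apply: lebesgue_translation; exact: measurable_xsection.
Qed.

Lemma measure_preserving_shear1 (a c : R) :
  measure_preserving (fun z => (z.1 + (a * z.2 + c), z.2)).
Proof.
have mf : measurable_fun [set: plane R] (fun z : plane R => (z.1 + (a * z.2 + c), z.2)).
  apply/measurable_fun_pairP; split; last exact: measurable_snd.
  have := affine_measurable 1 a c; apply: eq_measurable_fun => z _ /=.
  by rewrite mul1r addrA.
(* This shear translates horizontal sections, so the area is rewritten as the iterated integral in
   the other order. *)
have pm A : measurable A -> mu2 A = (mu1 \x^ mu1)%E A.
  by move=> mA; apply: product_measure_unique => //= *; rewrite product_measure2E.
split => // A mA.
have mA' : measurable ((fun z : plane R => (z.1 + (a * z.2 + c), z.2)) @^-1` A).
  by have := mf measurableT A mA; rewrite setTI.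
rewrite !pm // /product_measure2; apply: eq_integral => y _ /=.
have -> : ysection ((fun z : plane R => (z.1 + (a * z.2 + c), z.2)) @^-1` A) y =
    (fun x => x + (a * y + c)) @^-1` ysection A y.
  by apply/seteqP; split => x; rewrite /ysection /= !inE.
by apply: lebesgue_translation; exact: measurable_ysection.
Qed.

Definition rotation (c s : R) (o z : plane R) : plane R :=
  (o.1 + (c * (z.1 - o.1) - s * (z.2 - o.2)), o.2 + (s * (z.1 - o.1) + c * (z.2 - o.2))).

(* A rotation is a product of three shears. *)
Lemma measure_preserving_rotation (c s : R) (o : plane R) : c ^+ 2 + s ^+ 2 = 1 -> s != 0 ->
  measure_preserving (rotation c s o).
Proof.
(* For rotation angle theta, [t] is [- tan (theta / 2)]; the outer shears have slope [t] and the
   middle one slope [s]. *)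
move=> cs s0; pose t := (c - 1) / s.
have ts : t * s = c - 1 by rewrite divfK.
have h1 := measure_preserving_shear1 t (- t * o.2).
have h2 := measure_preserving_shear2 s (- s * o.1).
have := measure_preserving_comp h1 (measure_preserving_comp h2 h1).
congr measure_preserving; apply/funext => z; apply: plane_eq; rewrite /rotation /=.
  have tc : t * c = - s - t.
    have ss : - s * s = c ^+ 2 - 1 by rewrite -cs; ring.
    by apply: (mulIf s0); rewrite mulrAC ts [RHS]mulrBl ss ts; ring.
  transitivity (o.1 + ((t * s + 1) * (z.1 - o.1) + (t * (s * t) + t + t) * (z.2 - o.2))); first by ring.
  rewrite ts subrK mulrA ts; congr (_ + (_ + _)); rewrite -mulNr; congr (_ * _).
  by rewrite mulrBl mul1r mulrC tc; ring.
transitivity (o.2 + (s * (z.1 - o.1) + (t * s + 1) * (z.2 - o.2))); first by ring.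
by rewrite ts subrK.
Qed.

Lemma integral_measure_preserving K (f : plane R -> plane R) (g : plane R -> \bar R) :
  measure_preserving f -> measurable K -> f @^-1` K = K ->
  measurable_fun [set: plane R] g -> mu2.-integrable K (g \o f) ->
  (\int[mu2]_(z in K) (g \o f) z)%E = (\int[mu2]_(z in K) g z)%E.
Proof.
move=> [mf pf] mK fK mg ig.
have mf' : @measurable_fun _ _ planeM planeM [set: planeM] f by exact: mf.
have mg' : @measurable_fun _ _ planeM (\bar R) [set: planeM] g by exact: mg.
have mK' : @measurable _ planeM K by exact: mK.
have := @integral_pushforward _ _ planeM planeM R f mf' mu2 K g mg'; rewrite fK => /(_ ig mK') <-.
apply: (@eq_measure_integral _ planeM R K mu2
  (measure_function_pushforward__canonical__measure_function_Measure mu2 mf')) => A mA _; exact: pf.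
Qed.

Lemma Rintegral_rotation K c s (o : plane R) a b : c ^+ 2 + s ^+ 2 = 1 -> s != 0 ->
  compact K -> rotation c s o @^-1` K = K ->
  (\int[mu2]_(z in K) (a * (rotation c s o z).1 + b * (rotation c s o z).2))%R =
  a * (\int[mu2]_(z in K) z.1)%R + b * (\int[mu2]_(z in K) z.2)%R.
Proof.
move=> cs s0 cK fK.
rewrite -[RHS]addr0 -[X in _ + X](mul0r (area K)) -Rintegral_affine //.
have mK := compact_measurable cK.
have := @integral_measure_preserving K _ (EFin \o (fun z : plane R => a * z.1 + b * z.2 + 0))
  (measure_preserving_rotation o cs s0) mK fK.
have mg : measurable_fun [set: plane R] (EFin \o (fun z : plane R => a * z.1 + b * z.2 + 0)).
  by apply/measurable_EFinP; exact: affine_measurable.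
move=> /(_ mg) h; rewrite /Rintegral; congr fine; rewrite -h /=.
  by apply: eq_integral => z _; rewrite addr0.
have := affine_integrable (a * c + b * s) (b * c - a * s)
  (a * (o.1 - c * o.1 + s * o.2) + b * (o.2 - s * o.1 - c * o.2)) cK.
by congr (_.-integrable _ _); apply/funext => z /=; congr (_%:E); rewrite /rotation /=; ring.
Qed.

(** Invariance of the first moments is a homogeneous linear system for their deviation from [area K]
    times [o]; its determinant [(c - 1)^2 + s^2] is nonzero because [s] is. *)
Lemma centroid_rotation K c s (o : plane R) : compact K -> interior K !=set0 ->
  c ^+ 2 + s ^+ 2 = 1 -> s != 0 -> rotation c s o @^-1` K = K -> centroid K = o.
Proof.
move=> cK iK cs s0 fK; have A0 := area_gt0 cK iK.
have E a b := Rintegral_rotation a b cs s0 cK fK.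
have F a b : (\int[mu2]_(z in K) (a * (rotation c s o z).1 + b * (rotation c s o z).2))%R =
    (a * c + b * s) * (\int[mu2]_(z in K) z.1)%R + (b * c - a * s) * (\int[mu2]_(z in K) z.2)%R
    + (a * (o.1 - c * o.1 + s * o.2) + b * (o.2 - s * o.1 - c * o.2)) * area K.
  rewrite -Rintegral_affine //; congr (Rintegral _ _ _); apply/funext => z.
  by rewrite /rotation /=; ring.
have := E 1 0; have := E 0 1; rewrite !F /centroid.
move: (\int[mu2]_(z in K) z.1)%R (\int[mu2]_(z in K) z.2)%R (area K) A0 => m1 m2 A A0 e2 e1.
have e1' : c * m1 - s * m2 + (o.1 - c * o.1 + s * o.2) * A = m1 by lra.
have e2' : s * m1 + c * m2 + (o.2 - s * o.1 - c * o.2) * A = m2 by lra.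
have D0 : (c - 1) ^+ 2 + s ^+ 2 != 0 by rewrite paddr_eq0 ?sqr_ge0 // !sqrf_eq0 negb_and s0 orbT.
have x0 : m1 - o.1 * A = 0.
  apply: (mulfI D0); rewrite mulr0.
  transitivity ((c - 1) * ((c * m1 - s * m2 + (o.1 - c * o.1 + s * o.2) * A) - m1)
    + s * ((s * m1 + c * m2 + (o.2 - s * o.1 - c * o.2) * A) - m2)); first by ring.
  by rewrite e1' e2' !subrr !mulr0 addr0.
have y0 : m2 - o.2 * A = 0.
  apply: (mulfI D0); rewrite mulr0.
  transitivity ((c - 1) * ((s * m1 + c * m2 + (o.2 - s * o.1 - c * o.2) * A) - m2)
    - s * ((c * m1 - s * m2 + (o.1 - c * o.1 + s * o.2) * A) - m1)); first by ring.
  by rewrite e1' e2' !subrr !mulr0 subr0.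
by apply: plane_eq => /=; apply: (mulIf (lt0r_neq0 A0)); rewrite divfK ?lt0r_neq0 //;
  apply/eqP; rewrite -subr_eq0 ?x0 ?y0.
Qed.

End Centroid.

(** * Regular polygons *)

Section RegularPolygonGeometry.
Variable R : realType.
Implicit Types (u v w z : plane R) (x y t : R).
Variables (S : nat) (o : plane R) (r phi : R).
Hypotheses (S3 : (2 < S)%N) (r0 : 0 < r).

Definition unit_dir x : plane R := (cos x, sin x).
(* Side [k] joins the vertices [k] and [k + 1]; its outer normal has the angle of
   its midpoint. *)
Definition half_angle : R := pi / S%:R.
Local Notation a := half_angle.
Definition side_normal (k : nat) : plane R := unit_dir (phi + (2 * k%:R + 1) * a).
Definition side_tangent (k : nat) : plane R := rot (side_normal k).
Definition inradius : R := r * cos a.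
Definition half_side : R := r * sin a.
Local Notation n_ := side_normal.
Local Notation d_ := side_tangent.
Local Notation rho := inradius.
Local Notation h := half_side.
Local Notation V := (regular_vertex S o r phi).

Lemma dotp_unit_dir x y : dotp (unit_dir x) (unit_dir y) = cos (x - y).
Proof. by rewrite /dotp /= cosB. Qed.

Lemma crossp_unit_dir x y : crossp (unit_dir x) (unit_dir y) = sin (y - x).
Proof. by rewrite /crossp /= sinB; ring. Qed.

Let SR : 0 < S%:R :> R. Proof. by rewrite ltr0n; apply: leq_trans S3. Qed.
Let Sn : S%:R != 0 :> R. Proof. exact: lt0r_neq0. Qed.

Lemma half_angleM : S%:R * a = pi. Proof. by rewrite mulrC divfK. Qed.

Lemma half_angle_gt0 : 0 < a. Proof. by rewrite divr_gt0 ?pi_gt0. Qed.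

Lemma half_angle_lt : 3 * a <= pi.
Proof. by rewrite -half_angleM ler_pM2r ?half_angle_gt0 // ler_nat. Qed.

Lemma cos_half_angle_gt0 : 0 < cos a.
Proof.
have a0 := half_angle_gt0; have a3 := half_angle_lt; have p0 := pi_gt0 R.
by apply: cos_gt0_pihalf; apply/andP; split; lra.
Qed.

Lemma sin_half_angle_gt0 : 0 < sin a.
Proof.
have a0 := half_angle_gt0; have a3 := half_angle_lt; have p0 := pi_gt0 R.
by apply: sin_gt0_pi; apply/andP; split; lra.
Qed.

Lemma sin_angle_gt0 : 0 < sin (2 * a).
Proof.
have a0 := half_angle_gt0; have a3 := half_angle_lt; have p0 := pi_gt0 R.
by apply: sin_gt0_pi; apply/andP; split; lra.
Qed.

Lemma inradius_gt0 : 0 < rho. Proof. by rewrite mulr_gt0 ?cos_half_angle_gt0. Qed.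
Lemma half_side_gt0 : 0 < h. Proof. by rewrite mulr_gt0 ?sin_half_angle_gt0. Qed.

Lemma dotp_normal k : dotp (n_ k) (n_ k) = 1.
Proof. by rewrite dotp_unit_dir subrr cos0. Qed.

Lemma dotp_side_tangent k : dotp (d_ k) (d_ k) = 1.
Proof. by rewrite /side_tangent dotp_rot2 dotp_normal. Qed.

Lemma dotp_normal_tangent k : dotp (n_ k) (d_ k) = 0.
Proof. by rewrite /side_tangent dotpC dotp_rot crosspp. Qed.

Lemma side_frame k v : v = dotp (n_ k) v *: n_ k + dotp (d_ k) v *: d_ k.
Proof.
have := dotp_normal k; rewrite /side_tangent.
case: (n_ k) v => a1 a2 [v1 v2]; rewrite /dotp /rot /= => e.
apply: plane_eq; rewrite !plE /=.
  by rewrite -[LHS]mul1r -e; ring.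
by rewrite -[LHS]mul1r -e; ring.
Qed.

Lemma vertexE k : V k = o + r *: unit_dir (phi + 2 * k%:R * a).
Proof.
rewrite /regular_vertex /unit_dir; have -> : 2 * pi * k%:R / S%:R = 2 * k%:R * a :> R.
  by rewrite /half_angle; field.
by [].
Qed.

Lemma unit_dir_rotate x y : unit_dir (x + y) = cos y *: unit_dir x + sin y *: rot (unit_dir x).
Proof. by apply: plane_eq; rewrite !plE /rot /= ?cosD ?sinD; ring. Qed.

Lemma vertex_left k : V k = o + (rho *: n_ k - h *: d_ k).
Proof.
rewrite vertexE; congr (_ + _).
have -> : phi + 2 * k%:R * a = (phi + (2 * k%:R + 1) * a) + - a by ring.
rewrite unit_dir_rotate cosN sinN /side_tangent /side_normal /inradius /half_side.
by rewrite scalerDr !scalerA mulrN scaleNr.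
Qed.

Lemma vertex_right k : V k.+1 = o + (rho *: n_ k + h *: d_ k).
Proof.
rewrite vertexE; congr (_ + _).
have -> : phi + 2 * k.+1%:R * a = (phi + (2 * k%:R + 1) * a) + a by rewrite -natr1; ring.
rewrite unit_dir_rotate /side_tangent /side_normal /inradius /half_side.
by rewrite scalerDr !scalerA.
Qed.

Lemma normalS k : n_ k.+1 = cos (2 * a) *: n_ k + sin (2 * a) *: d_ k.
Proof.
rewrite /side_normal (_ : phi + (2 * k.+1%:R + 1) * a = (phi + (2 * k%:R + 1) * a) + 2 * a).
  by rewrite unit_dir_rotate.
by rewrite -natr1; ring.
Qed.

Lemma normalP k : n_ k = cos (2 * a) *: n_ k.+1 - sin (2 * a) *: d_ k.+1.
Proof.
rewrite {1}/side_normal (_ : phi + (2 * k%:R + 1) * a = (phi + (2 * k.+1%:R + 1) * a) + - (2 * a)).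
  by rewrite unit_dir_rotate cosN sinN scaleNr.
by rewrite -natr1; ring.
Qed.

Lemma normal_period k j : n_ (k + j * S) = n_ k.
Proof.
elim: j => [|j IH]; first by rewrite mul0n addn0.
rewrite -IH mulSn addnCA addnC /side_normal /unit_dir.
have -> : phi + (2 * (k + j * S + S)%:R + 1) * a = (phi + (2 * (k + j * S)%:R + 1) * a) + pi *+ 2.
  by rewrite -half_angleM !natrD; ring.
by rewrite cosD2pi sinD2pi.
Qed.

Lemma normal_modn k l : k = l %[mod S] -> n_ k = n_ l.
Proof.
move=> E; rewrite (divn_eq k S) (divn_eq l S) E ![(_ * S + _)%N]addnC.
by rewrite !normal_period.
Qed.

Lemma vertex_modn k l : k = l %[mod S] -> V k = V l.
Proof. by move=> E; rewrite !vertex_left /side_tangent (normal_modn E). Qed.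

(** Among the multiples of [a = pi / S] strictly between 0 and [2 pi] the cosine is largest at the
    outermost two, [a] and [2 pi - a]; beyond [pi] the reflection of [j] to [2 S - j] leads back to
    the range where cosine decreases. *)
Lemma cos_multiple (m : nat) : (0 < m < S.*2)%N ->
  cos (m%:R * a) <= cos a /\ ((1 < m)%N && (m.+1 < S.*2)%N -> cos (m%:R * a) < cos a).
Proof.
have a0 := half_angle_gt0; have p0 := pi_gt0 R; have a3 := half_angle_lt.
have lt (j : nat) : (1 < j <= S)%N -> cos (j%:R * a) < cos a.
  move=> /andP[j1 jS].
  have m1 : j%:R * a \in `[0, pi].
    by rewrite in_itv /= -half_angleM ler_pM2r // ler_nat jS andbT mulr_ge0 // ltW.
  have m2 : a \in `[0, pi] by rewrite in_itv /= ltW //=; lra.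
  by rewrite ltr_cos // -[ltLHS]mul1r ltr_pM2r // ltr1n.
have key (j : nat) : (0 < j < S.*2)%N -> (1 < j)%N -> (j.+1 < S.*2)%N -> cos (j%:R * a) < cos a.
  move=> j0 j1 jS; case: (leqP j S) => jl; first by apply: lt; rewrite j1.
  have E : j%:R * a = pi *+ 2 - (S.*2 - j)%:R * a :> R.
    rewrite natrB; last by case/andP: j0 => _ /ltnW.
    by rewrite -muln2 natrM -half_angleM; ring.
  rewrite E addrC cosD2pi cosN; apply: lt; rewrite -addnn in jS *; lia.
move=> m0; split; last by case/andP; exact: key.
case: (ltnP 1 m) => m1; last by rewrite (_ : m = 1%N) ?mul1r //; lia.
case: (ltnP m.+1 S.*2) => m2; first exact: ltW (key _ _ _ _).
have E : m%:R * a = pi *+ 2 - a :> R.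
  have -> : m = (S.*2 - 1)%N by lia.
  by rewrite natrB; [rewrite -muln2 natrM -half_angleM; ring | lia].
by rewrite E addrC cosD2pi cosN.
Qed.

Lemma modn_offset (k l : nat) : exists2 i, (i < S)%N & l = (k + i)%N %[mod S].
Proof.
have S0 : (0 < S)%N by exact: leq_trans S3.
(* Adding [k * (S - 1)] subtracts [k] modulo [S] without truncated subtraction. *)
exists ((l + k * S.-1) %% S)%N; first by rewrite ltn_mod.
by rewrite modnDmr addnCA -mulnS prednK // addnC modnMDl.
Qed.

(** With [l = k + i], the angle from vertex [k] to normal [l] is [(2 i + 1) a]. The constraint is
    tight only for the two sides meeting at the vertex, [i = 0] and [i = S - 1]. *)
Lemma normal_vertex k l : dotp (n_ l) (V k - o) <= rho /\
  (l != k %[mod S] -> l.+1 != k %[mod S] -> dotp (n_ l) (V k - o) < rho).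
Proof.
have [i iS E] := modn_offset k l.
have F : dotp (n_ l) (V k - o) = r * cos ((i.*2.+1)%:R * a).
  rewrite (normal_modn E) vertexE addrAC subrr add0r dotpZr dotp_unit_dir; congr (_ * cos _).
  by rewrite -[i.*2.+1]addn1 -muln2 !natrD natrM; ring.
have [|c1 c2] := @cos_multiple i.*2.+1; first by lia.
rewrite F; split; first by rewrite ler_pM2l.
move=> lk l1k; rewrite ltr_pM2l //; apply: c2.
have i0 : i != 0%N by apply: contra lk => /eqP i0; rewrite E i0 addn0.
have i1 : i.+1 != S.
  by apply: contra l1k => /eqP i1; rewrite -addn1 -modnDml E modnDml -addnA addn1 i1 modnDr.
lia.
Qed.

(** In this form support and boundary can be computed. The normals are periodic, and letting the
    index run over all naturals spares reducing successors modulo [S]. *)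
Definition polygon_body : set (plane R) := [set z | forall k, dotp (n_ k) (z - o) <= rho].
Local Notation K := polygon_body.

(** [t] is the signed distance from the midpoint of the side; the side itself corresponds to
    [|t| <= h]. *)
Definition side_point k t : plane R := o + (rho *: n_ k + t *: d_ k).

Lemma dotp_side_normal k t : dotp (n_ k) (side_point k t - o) = rho.
Proof.
rewrite /side_point addrAC subrr add0r dotpDr !dotpZr dotp_normal dotp_normal_tangent.
by rewrite mulr1 mulr0 addr0.
Qed.

Lemma dotp_side_point k t : dotp (d_ k) (side_point k t - o) = t.
Proof.
rewrite /side_point addrAC subrr add0r dotpDr !dotpZr dotp_side_tangent dotpC.
by rewrite dotp_normal_tangent mulr0 mulr1 add0r.
Qed.

Lemma side_pointE k z : dotp (n_ k) (z - o) = rho -> z = side_point k (dotp (d_ k) (z - o)).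
Proof.
move=> e; rewrite /side_point -[in LHS](subrK o z) addrC; congr (_ + _).
by rewrite [LHS](side_frame k) e.
Qed.

Lemma side_pointB k s t : side_point k s - side_point k t = (s - t) *: d_ k.
Proof. by rewrite /side_point; apply: plane_eq; rewrite !plE; ring. Qed.

Lemma vertex_side k : V k = side_point k (- h).
Proof. by rewrite vertex_left /side_point scaleNr. Qed.

Lemma vertex_sideS k : V k.+1 = side_point k h.
Proof. exact: vertex_right. Qed.

Lemma side_point_comb k t : side_point k t =
  ((h - t) / (2 * h)) *: V k + (1 - (h - t) / (2 * h)) *: V k.+1.
Proof.
have h0 := lt0r_neq0 half_side_gt0.
by rewrite vertex_left vertex_right /side_point; apply: plane_eq; rewrite !plE; field.
Qed.

Lemma vertex_body k : K (V k).
Proof. by move=> l; have [] := normal_vertex k l. Qed.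

Lemma body_convex u v x : K u -> K v -> 0 <= x <= 1 -> K (x *: u + (1 - x) *: v).
Proof.
move=> Ku Kv /andP[x0 x1] k.
have -> : x *: u + (1 - x) *: v - o = x *: (u - o) + (1 - x) *: (v - o).
  by apply: plane_eq; rewrite !plE; ring.
rewrite dotpDr !dotpZr; have -> : rho = x * rho + (1 - x) * rho by ring.
by apply: lerD; apply: ler_wpM2l; rewrite ?subr_ge0.
Qed.

Lemma convex_body_set : convex_set K.
Proof.
move=> u v x; rewrite !inE => Ku Kv.
by apply: body_convex => //; rewrite ge0 le1.
Qed.

Lemma side_point_body k t : `|t| <= h -> K (side_point k t).
Proof.
move=> th; rewrite side_point_comb; apply: body_convex; try exact: vertex_body.
have h0 := half_side_gt0; have h2 : 0 < 2 * h by rewrite mulr_gt0.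
move: th; rewrite ler_norml => /andP[t1 t2].
by rewrite ler_pdivlMr // ler_pdivrMr //; apply/andP; split; lra.
Qed.

(* The bound comes from the half-planes of the two neighbouring sides. *)
Lemma supporting_line_bound k t : K (side_point k.+1 t) -> `|t| <= h.
Proof.
move=> Kt; have := Kt k; have := Kt k.+2.
have ca := cos_half_angle_gt0; have sa := sin_half_angle_gt0.
have E1 : dotp (n_ k.+2) (side_point k.+1 t - o) = cos (2 * a) * rho + sin (2 * a) * t.
  by rewrite normalS dotpDl !dotpZl dotp_side_normal dotp_side_point.
have E2 : dotp (n_ k) (side_point k.+1 t - o) = cos (2 * a) * rho - sin (2 * a) * t.
  by rewrite normalP dotpBl !dotpZl dotp_side_normal dotp_side_point.
have c2 : cos (2 * a) = 1 - 2 * sin a ^+ 2.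
  rewrite (_ : 2 * a = a + a); last by ring.
  by rewrite cosD -!expr2 cos2sin2; ring.
have s2 : sin (2 * a) = 2 * sin a * cos a.
  by rewrite (_ : 2 * a = a + a) ?sinD; ring.
rewrite E1 E2 c2 s2 /inradius /half_side ler_norml => i1 i2.
have p : 0 < 2 * sin a * cos a by rewrite !mulr_gt0.
apply/andP; split; rewrite -(ler_pM2l p); move: i1 i2.
  by move: (sin a) (cos a) => s c; lra.
by move: (sin a) (cos a) => s c; lra.
Qed.

Lemma body_side k z : K z -> dotp (n_ k) (z - o) = rho ->
  exists2 t, `|t| <= h & z = side_point k t.
Proof.
move=> Kz e; exists (dotp (d_ k) (z - o)); last exact: side_pointE.
have S0 : (0 < S)%N by exact: leq_trans S3.
have E : n_ k = n_ (k + S.-1).+1 by rewrite -addnS prednK // -(normal_period k 1) mul1n.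
apply: (@supporting_line_bound (k + S.-1)); rewrite /side_tangent E -/(side_tangent _) -side_pointE //.
by rewrite -E.
Qed.

(** With at least three sides no two are adjacent at both ends, since 2 is not 0 modulo [S]. *)
Lemma neighbour_sides k l : l = k.+1 %[mod S] -> l.+1 = k %[mod S] -> False.
Proof.
move=> e1; rewrite -addn1 -modnDml e1 modnDml addn1 => e2.
have : (k + 2 == k + 0 %[mod S])%N by rewrite addn2 addn0 e2.
by rewrite eqn_modDl mod0n modn_small.
Qed.

(** An inner point of a side is a combination of its two ends with positive weights, and the line of
    another side misses at least one of these ends. *)
Lemma open_side_strict k l t : `|t| < h -> l != k %[mod S] ->
  dotp (n_ l) (side_point k t - o) < rho.
Proof.
move=> th lk; have h0 := half_side_gt0; have h2 : 0 < 2 * h by rewrite mulr_gt0.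
pose x := (h - t) / (2 * h).
move: th; rewrite ltr_norml => /andP[t1 t2].
have x0 : 0 < x by rewrite divr_gt0 //; lra.
have x1 : 0 < 1 - x by rewrite subr_gt0 ltr_pdivrMr //; lra.
rewrite side_point_comb -/x.
have -> : x *: V k + (1 - x) *: V k.+1 - o = x *: (V k - o) + (1 - x) *: (V k.+1 - o).
  by apply: plane_eq; rewrite !plE; ring.
rewrite dotpDr !dotpZr; have -> : rho = x * rho + (1 - x) * rho by ring.
have [p1 p2] := normal_vertex k l; have [q1 q2] := normal_vertex k.+1 l.
case: (boolP (l.+1 == k %[mod S])%N) => [/eqP lk1|lk1].
  apply: ler_ltD; first by rewrite ler_pM2l.
  rewrite ltr_pM2l //; apply: q2; first by apply/eqP => e; exact: (neighbour_sides e lk1).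
  by rewrite -[l.+1]addn1 -[k.+1]addn1 eqn_modDr.
by apply: ltr_leD; rewrite ?ltr_pM2l ?ler_pM2l //; exact: p2.
Qed.

(** The maximizing index is written as a successor so that both its neighbours, [k] and [k.+2], can
    be named. *)
Lemma normal_max v : exists k, forall l, dotp (n_ l) v <= dotp (n_ k.+1) v.
Proof.
have S0 : (0 < S)%N by exact: leq_trans S3.
pose i0 := Ordinal S0.
case: (@arg_maxP _ _ _ i0 xpredT (fun i : 'I_S => dotp (n_ i) v) isT) => i _ im.
exists (i + S.-1)%N => l; rewrite -addnS prednK // (_ : n_ (i + S) = n_ i); last by rewrite -(normal_period i 1) mul1n.
have := im (Ordinal (ltn_pmod l S0)) isT; rewrite /= => h1.
by rewrite (@normal_modn l (l %% S)) // modn_mod.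
Qed.

Lemma crossp_cramer u w v : crossp u w *: v = crossp v w *: u + crossp u v *: w.
Proof. by apply: plane_eq; rewrite !plE /crossp; ring. Qed.

Lemma normal_step k v : dotp (n_ k.+1) v - dotp (n_ k) v =
  2 * sin a * crossp (unit_dir (phi + 2 * k.+1%:R * a)) v.
Proof.
rewrite -dotpBl -dotp_rot -dotpZl; congr dotp.
rewrite /side_normal (_ : phi + (2 * k.+1%:R + 1) * a = (phi + 2 * k.+1%:R * a) + a); last by ring.
rewrite (_ : phi + (2 * k%:R + 1) * a = (phi + 2 * k.+1%:R * a) + - a); last by rewrite -natr1; ring.
rewrite !unit_dir_rotate cosN sinN; apply: plane_eq; rewrite !plE /rot /=; ring.
Qed.

(** The normal with the largest product with [z - o] selects the sector. Comparing it with its two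
    neighbours gives the signs of the cross products with the vertex directions, which are the
    coordinates by Cramer's rule; the half-plane of the side gives [x + y <= 1]. *)
Lemma body_sector z : K z -> exists k x y, [/\ 0 <= x, 0 <= y, x + y <= 1 &
  z = x *: V k + y *: V k.+1 + (1 - x - y) *: o].
Proof.
move=> Kz; have [k km] := normal_max (z - o); exists k.+1.
set v := z - o in km *.
have ca := cos_half_angle_gt0; have sa := sin_half_angle_gt0; have s2 := sin_angle_gt0.
pose u1 := unit_dir (phi + 2 * k.+1%:R * a); pose u2 := unit_dir (phi + 2 * k.+2%:R * a).
have c1 : 0 <= crossp u1 v.
  by rewrite -(@pmulr_rge0 _ (2 * sin a)) ?mulr_gt0 // -normal_step subr_ge0.
have c2 : 0 <= crossp v u2.
  by rewrite crosspC oppr_ge0 -(@pmulr_rle0 _ (2 * sin a)) ?mulr_gt0 // -normal_step subr_le0.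
have c12 : crossp u1 u2 = sin (2 * a).
  by rewrite crossp_unit_dir; congr sin; rewrite -[k.+2%:R]natr1; ring.
have D0 : 0 < r * sin (2 * a) by rewrite mulr_gt0.
pose x := crossp v u2 / (r * sin (2 * a)); pose y := crossp u1 v / (r * sin (2 * a)).
have x0 : 0 <= x by rewrite divr_ge0 // ltW.
have y0 : 0 <= y by rewrite divr_ge0 // ltW.
have vE : v = x *: (V k.+1 - o) + y *: (V k.+2 - o).
  rewrite !vertexE ![(o + _)%R]addrC !addrK -/u1 -/u2 !scalerA.
  apply: (@scalerI _ _ (sin (2 * a))); first exact: lt0r_neq0.
  rewrite -{1}c12 crossp_cramer scalerDr !scalerA.
  by congr (_ *: _ + _ *: _); rewrite /x /y; field; rewrite !lt0r_neq0.
exists x, y; split => //.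
  have := Kz k.+1; rewrite -/v vE dotpDr !dotpZr (vertex_side k.+1) (vertex_sideS k.+1).
  by rewrite !dotp_side_normal -mulrDl -{2}(mul1r rho) ler_pM2r // inradius_gt0.
rewrite -[LHS](subrK o) -/v vE; apply: plane_eq; rewrite !plE; ring.
Qed.

(** Puts the center into the hull. The side vectors telescope around the closed polygon, so the
    tangents sum to 0, and the normals are their images under a quarter turn. *)
Lemma vertex_mean : o = \sum_(k < S) (S%:R^-1 : R) *: V k.
Proof.
have T0 : \sum_(k < S) d_ k = 0.
  apply: (@scalerI _ _ (2 * h)); first by rewrite mulf_neq0 ?pnatr_eq0 // lt0r_neq0 ?half_side_gt0.
  rewrite scaler_sumr scaler0 (eq_bigr (fun k : 'I_S => V k.+1 - V k)).
    rewrite -(big_mkord xpredT (fun k => V k.+1 - V k)) telescope_sumr //.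
    by rewrite (@vertex_modn S 0) ?subrr // modnn mod0n.
  by move=> k _; rewrite vertex_sideS vertex_side side_pointB; congr (_ *: _); ring.
have rr (k : nat) : n_ k = - rot (d_ k).
  by apply: plane_eq; rewrite /side_tangent /rot !plE /= ?opprK.
have N0 : \sum_(k < S) n_ k = 0.
  have rs (f : nat -> plane R) m : \sum_(k < m) - rot (f k) = - rot (\sum_(k < m) f k).
    elim: m => [|m IH]; first by rewrite !big_ord0; apply: plane_eq; rewrite !plE /rot /= ?plE ?oppr0.
    by rewrite !big_ord_recr /= IH; apply: plane_eq; rewrite !plE /rot /= ?plE; ring.
  under eq_bigr do rewrite rr.
  by rewrite rs T0; apply: plane_eq; rewrite !plE /rot /= ?plE ?oppr0.
rewrite -scaler_sumr; under eq_bigr do rewrite vertex_left.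
rewrite big_split sumrB /= -!scaler_sumr N0 T0 !scaler0 subr0 addr0.
rewrite sumr_const card_ord.
by rewrite -[X in _ *: X]scaler_nat scalerA mulVf // scale1r.
Qed.

Lemma polygon_hullE : polygon_hull (fun k : 'I_S => V k) = K.
Proof.
have S0 : (0 < S)%N by exact: leq_trans S3.
apply/seteqP; split; first by apply: polygon_hull_sub => [|k]; [exact: convex_body_set|exact: vertex_body].
set H := polygon_hull _.
have HV k : H (V k).
  by rewrite (@vertex_modn k (k %% S)) ?modn_mod //; exact: (polygon_hull_vertex _ (Ordinal (ltn_pmod k S0))).
have Ho : H o.
  exists (fun=> S%:R^-1); split => [k||]; last exact: vertex_mean.
    by rewrite invr_ge0 ltW.
  by rewrite sumr_const card_ord -[LHS]mulr_natr mulVf.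
move=> z /body_sector[k [x [y [x0 y0 xy ->]]]].
case: (eqVneq (x + y) 0) => xy0.
  have x00 : x = 0 by lra.
  have y00 : y = 0 by lra.
  by rewrite x00 y00 !scale0r !add0r !subr0 scale1r.
have xyp : 0 < x + y by rewrite lt_def xy0 addr_ge0.
have -> : x *: V k + y *: V k.+1 + (1 - x - y) *: o =
   (x + y) *: ((x / (x + y)) *: V k + (1 - x / (x + y)) *: V k.+1) + (1 - (x + y)) *: o.
  by apply: plane_eq; rewrite !plE; field.
have xy1 : 0 <= x / (x + y) <= 1.
  by rewrite divr_ge0 ?(ltW xyp) //= ler_pdivrMr // mul1r lerDl.
apply: polygon_hull_convex; [|exact: Ho|by rewrite (ltW xyp)].
by apply: polygon_hull_convex; [exact: HV|exact: HV|].
Qed.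

End RegularPolygonGeometry.

Section RegularPolygonTopology.
Variable R : realType.
Implicit Types (u v w z q : plane R) (x y t : R).
Variables (S : nat) (o : plane R) (r phi : R).
Hypotheses (S3 : (2 < S)%N) (r0 : 0 < r).
Local Notation a := (half_angle R S).
Local Notation n_ := (side_normal S phi).
Local Notation d_ := (side_tangent S phi).
Local Notation rho := (inradius S r).
Local Notation h := (half_side S r).
Local Notation V := (regular_vertex S o r phi).
Local Notation K := (polygon_body S o r phi).
Local Notation side := (side_point S o r phi).

Let h0 : 0 < h. Proof. exact: half_side_gt0. Qed.
Let rho0 : 0 < rho. Proof. exact: inradius_gt0. Qed.
Let S0 : (0 < S)%N. Proof. exact: leq_trans S3. Qed.

Lemma enorm_normal k : enorm (n_ k) = 1.
Proof. by rewrite /enorm dotp_normal sqrtr1. Qed.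

Lemma enorm_tangent k : enorm (d_ k) = 1.
Proof. by rewrite /enorm dotp_side_tangent sqrtr1. Qed.

Lemma tangent_neq0 k : d_ k != 0.
Proof. by rewrite -enorm_eq0 enorm_tangent oner_eq0. Qed.

Lemma continuous_dotp_sub v z : continuous (fun w : plane R => dotp v (w - z)).
Proof.
apply: (@continuous_dotp R (fun=> v) (fun w : plane R => w - z)) => w; first exact: cvg_cst.
by apply: cvgB; [exact: cvg_id|exact: cvg_cst].
Qed.

(** [P] selects the sides concerned; as it is compatible with reduction modulo [S], only finitely
    many strict linear inequalities are involved. *)
Lemma slack_nbhs (P : nat -> Prop) z : (forall l, P l -> P (l %% S)%N) ->
  (forall l, P l -> dotp (n_ l) (z - o) < rho) ->
  nbhs z [set w | forall l, P l -> dotp (n_ l) (w - o) < rho].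
Proof.
move=> Pm Pz.
have : \forall w \near z, forall i : 'I_S, P i -> dotp (n_ i) (w - o) < rho.
  apply: (@filter_forall _ _ (fun (i : 'I_S) w => P i -> dotp (n_ i) (w - o) < rho) _ (nbhs_filter z)) => i.
  case: (pselect (P i)) => Pi; last by apply: nearW => w /Pi.
  have : \forall w \near z, dotp (n_ i) (w - o) < rho.
    apply: (@continuous_dotp_sub (n_ i) o z [set x | x < rho]).
    by apply: open_nbhs_nbhs; split; [exact: open_lt|exact: Pz].
  by apply: filterS => w ? _.
apply: filterS => w hw l Pl.
have E : (l = l %% S %[mod S])%N by rewrite modn_mod.
by rewrite (normal_modn phi S3 E); apply: (hw (Ordinal (ltn_pmod l S0))); exact: Pm.
Qed.

Lemma body_center_nbhs : nbhs o K.
Proof.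
have := @slack_nbhs (fun=> True) o (fun _ _ => I).
have hz l : True -> dotp (n_ l) (o - o) < rho by rewrite subrr dotp0r.
by move=> /(_ hz); apply: filterS => w hw l; exact: ltW (hw l I).
Qed.

Lemma body_bounded z : K z -> enorm (z - o) <= r.
Proof.
move=> /(body_sector S3 r0)[k [x [y [x0 y0 xy ->]]]].
have nV l : enorm (V l - o) = r.
  rewrite (vertexE _ _ _ S3) addrAC subrr add0r enormZ gtr0_norm //.
  by rewrite /enorm dotp_unit_dir subrr cos0 sqrtr1 mulr1.
have -> : x *: V k + y *: V k.+1 + (1 - x - y) *: o - o = x *: (V k - o) + y *: (V k.+1 - o).
  by apply: plane_eq; rewrite !plE; ring.
apply: le_trans (enormD _ _) _; rewrite !enormZ !nV !ger0_norm // -mulrDl.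
by rewrite ler_piMl // ltW.
Qed.

Lemma body_compact : compact K.
Proof.
have cbox : compact (`[o.1 - r, o.1 + r] `*` `[o.2 - r, o.2 + r]).
  by apply: compact_setX; exact: segment_compact.
apply: (subclosed_compact _ cbox).
  have -> : K = \bigcap_(k : nat) [set z | dotp (n_ k) (z - o) <= rho].
    by apply/seteqP; split => z hz k; [move=> _; exact: hz|exact: hz].
  apply: closed_bigI => k _.
  have -> : [set z | dotp (n_ k) (z - o) <= rho] =
      (fun z : plane R => dotp (n_ k) (z - o)) @^-1` [set x | x <= rho] by [].
  apply: preimage_closed => /=; last exact: closed_le.
  by move=> z _; exact: continuous_dotp_sub.
move=> z /body_bounded zr; have [z1 z2] := normr_le_enorm (z - o).
have zz1 := le_trans z1 zr; have zz2 := le_trans z2 zr.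
by split; rewrite /= in_itv /= -ler_distl.
Qed.

Lemma body_convex_body : convex_body K.
Proof.
split; [exact: body_compact|exact: convex_body_set|].
by exists o; exact: body_center_nbhs.
Qed.

Lemma boundary_side z : boundary K z -> exists k t, `|t| <= h /\ z = side k t.
Proof.
move=> bz; have nz := bz.2.
have [k hk] : exists k, rho <= dotp (n_ k) (z - o).
  apply: contrapT => nk; apply: nz.
  have := @slack_nbhs (fun=> True) z (fun _ _ => I).
  have hz l : True -> dotp (n_ l) (z - o) < rho.
    by move=> _; rewrite ltNge; apply/negP => hl; apply: nk; exists l.
  by move=> /(_ hz); apply: filterS => w hw l; exact: ltW (hw l I).
have [Kz _] := (compact_boundary z body_compact).1 bz.
have [t th E] := body_side S3 Kz (le_anti (introT andP (conj (Kz k) hk))).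
by exists k, t.
Qed.

Lemma side_boundary k t : `|t| <= h -> boundary K (side k t).
Proof.
move=> th; apply/(compact_boundary _ body_compact); split; first exact: side_point_body.
move=> e e0; exists (side k t + (e / 2) *: n_ k).
  move=> /(_ k); rewrite addrAC dotpDr dotp_side_normal dotpZr dotp_normal mulr1.
  by rewrite leNgt ltrDl divr_gt0.
rewrite addrAC subrr add0r enormZ enorm_normal mulr1 gtr0_norm ?divr_gt0 //.
by rewrite ltr_pdivrMr // mulr2n mulrDr mulr1 ltrDl.
Qed.

Lemma body_rotation : rotation (cos (2 * a)) (sin (2 * a)) o @^-1` K = K.
Proof.
have E k z : dotp (n_ k.+1) (rotation (cos (2 * a)) (sin (2 * a)) o z - o) = dotp (n_ k) (z - o).
  rewrite normalS /side_tangent; have := cos2Dsin2 (2 * a).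
  move: (cos _) (sin _) (n_ k) => c s [m1 m2] cs.
  rewrite /dotp /rotation /rot !plE /=.
  transitivity ((c ^+ 2 + s ^+ 2) * (m1 * (z.1 - o.1) + m2 * (z.2 - o.2))); first by ring.
  by rewrite cs mul1r.
apply/seteqP; split => z /= Kz k; first by rewrite -E; exact: Kz.
have -> : n_ k = n_ (k + S.-1).+1 by rewrite -addnS prednK // -(normal_period phi S3 k 1) mul1n.
by rewrite E; exact: Kz.
Qed.

Lemma centroid_body : centroid K = o.
Proof.
apply: (centroid_rotation body_compact _ (cos2Dsin2 (2 * a)) _ body_rotation).
  by exists o; exact: body_center_nbhs.
by rewrite lt0r_neq0 // sin_angle_gt0.
Qed.

Lemma derivable_affine v w t : derivable (fun t : R => v + t *: w) t 1.
Proof.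
rewrite /derivable; apply/cvg_ex; exists w; apply: cvg_near_cst.
near=> x => /=; have x0 : x != 0 by near: x; exact: nbhs_dnbhs_neq.
have -> : v + (x *: 1 + t) *: w - (v + t *: w) = x *: w.
  by apply: plane_eq; rewrite !plE /= /GRing.scale /=; ring.
by rewrite scalerA mulVf // scale1r.
Unshelve. all: by end_near. Qed.

Lemma derive1_affine v w t : derive1 (fun t : R => v + t *: w) t = w.
Proof.
have d1 : derivable (fun t : R => v + t *: w) t 1 by exact: derivable_affine.
apply: (vderiv_uniq (derivable_vderiv d1)); split.
  by apply: dd_eq (ddD (ddc v.1 t) (ddM (ddid t) (ddc w.1 t))) _; rewrite mul1r mulr0 addr0 add0r.
by apply: dd_eq (ddD (ddc v.2 t) (ddM (ddid t) (ddc w.2 t))) _; rewrite mul1r mulr0 addr0 add0r.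
Qed.

Lemma smooth_affine v w : smooth_curve (fun t : R => v + t *: w).
Proof.
move=> n t; case: n => [|n].
  exact: derivable_affine.
suff [c ->] : exists c, derive1n n.+1 (fun t : R => v + t *: w) = cst c by exact: derivable_cst.
elim: n => [|n [c IH]].
  by exists w; rewrite derive1n1; apply/funext => s; exact: derive1_affine.
by exists 0; rewrite derive1nS IH; apply/funext => s; rewrite derive1_cst.
Qed.

Lemma side_local_parametrization k t : `|t| < h ->
  local_parametrization K (side k t) (fun x => side k t + x *: d_ k) (h - `|t|).
Proof.
move=> th; have e0 : 0 < h - `|t| by rewrite subr_gt0.
have shift x : side k t + x *: d_ k = side k (t + x).
  by rewrite addrC -[RHS](subrK (side k t)) side_pointB [t + x]addrC addrK.
have small x : `|x| < h - `|t| -> `|t + x| < h.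
  by move=> xe; apply: le_lt_trans (ler_normD _ _) _; rewrite addrC -ltrBrDr.
split.
- by split => //; rewrite scale0r addr0.
- exact: smooth_affine.
- move=> x y _ _ /addrI /eqP; rewrite -subr_eq0 -scalerBl scaler_eq0 (negbTE (tangent_neq0 k)).
  by rewrite orbF subr_eq0 => /eqP.
- by move=> x _; rewrite derive1_affine tangent_neq0.
(* The first set excludes all other sides, the second bounds the coordinate along side [k] by the
   range of the parameter. *)
exists ([set w | forall l, (l != k %[mod S])%N -> dotp (n_ l) (w - o) < rho] `&`
        [set w | `|dotp (d_ k) (w - side k t)| < h - `|t|]).
  apply: filterI.
    apply: (@slack_nbhs (fun l => is_true (l != k %[mod S])%N)) => l; first by rewrite modn_mod.
    exact: open_side_strict.
  apply/enorm_nbhsP; exists (h - `|t|) => // w we; apply: le_lt_trans we.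
  by apply: le_trans (cauchy_schwarz _ _) _; rewrite enorm_tangent mul1r.
apply/seteqP; split => w.
  move=> [/boundary_side[l [s [sh wE]]] [/(_ l) w1 w2]].
  have lk : (l = k %[mod S])%N.
    apply/eqP; apply: contraT => /w1; by rewrite wE dotp_side_normal ltxx.
  have e : dotp (n_ k) (w - o) = rho by rewrite -(normal_modn phi S3 lk) wE dotp_side_normal.
  have wE' := side_pointE e; exists (dotp (d_ k) (w - side k t)); first by rewrite /= in_itv /= -ltr_norml.
  have -> : w - side k t = (w - o) - (side k t - o) by apply: plane_eq; rewrite !plE; ring.
  by rewrite dotpBr dotp_side_point shift addrC subrK -wE'.
move=> [x]; rewrite /= in_itv /= -ltr_norml => xe <-; have th' := small x xe.
split; first by rewrite shift; apply: side_boundary; exact: ltW.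
split; first by move=> l lk; rewrite shift; exact: open_side_strict.
by rewrite /= addrAC subrr add0r dotpZr dotp_side_tangent mulr1.
Qed.

Lemma vertex_slack k : nbhs (V k.+1) [set w | forall l,
  (l != k %[mod S])%N && (l != k.+1 %[mod S])%N -> dotp (n_ l) (w - o) < rho].
Proof.
apply: (@slack_nbhs (fun l => is_true ((l != k %[mod S])%N && (l != k.+1 %[mod S])%N))) => l.
  by rewrite !modn_mod.
move=> /andP[l1 l2]; apply: (normal_vertex o phi S3 r0 k.+1 l).2 => //.
by rewrite -[l.+1]addn1 -[k.+1]addn1 eqn_modDr.
Qed.

(** At the vertex two side constraints are tight, so the velocity of a smooth boundary curve would
    be orthogonal to two independent normals and therefore 0. *)
Lemma vertex_not_smooth k : ~ smooth_at K (V k.+1).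
Proof.
move=> [g [e lp]]; have [g1 [g2 [[gd _] e0 g0 gb gn]]] := local_param_data lp.
have flat l : dotp (n_ l) (V k.+1 - o) = rho -> dotp (n_ l) (g1 0) = 0.
  move=> eV; have D := vderiv_dotpl (n_ l) (vderivB_cst o (gd 0)).
  apply: (dd_local_max D e0 _) => s; rewrite subr0 => /gb /(compact_boundary _ body_compact)[Ks _].
  by rewrite g0 eV; exact: Ks.
have f1 : dotp (n_ k) (g1 0) = 0 by apply: flat; rewrite (vertex_sideS o r phi S3) dotp_side_normal.
have f2 : dotp (n_ k.+1) (g1 0) = 0 by apply: flat; rewrite (vertex_side o r phi S3) dotp_side_normal.
have f3 : dotp (d_ k) (g1 0) = 0.
  apply: (mulfI (lt0r_neq0 (sin_angle_gt0 R S3))).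
  by move: f2; rewrite normalS dotpDl !dotpZl f1 mulr0 add0r mulr0.
have := gn 0; rewrite normr0 => /(_ e0) /negP; apply; apply/eqP.
by rewrite (side_frame S phi k (g1 0)) f1 f3 !scale0r addr0.
Qed.

Lemma near_vertex k w : boundary K w -> w != V k.+1 ->
  (forall l, (l != k %[mod S])%N && (l != k.+1 %[mod S])%N -> dotp (n_ l) (w - o) < rho) ->
  (exists2 x, 0 < x & w - V k.+1 = x *: - d_ k) \/
  (exists2 x, 0 < x & w - V k.+1 = x *: d_ k.+1).
Proof.
move=> bw wV sl; have [Kw _] := (compact_boundary _ body_compact).1 bw.
have [l [s [sh wE]]] := boundary_side bw.
have : ~~ ((l != k %[mod S])%N && (l != k.+1 %[mod S])%N).
  by apply/negP => /sl; rewrite wE dotp_side_normal ltxx.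
rewrite negb_and !negbK => /orP[] /eqP lk.
  have e : dotp (n_ k) (w - o) = rho by rewrite -(normal_modn phi S3 lk) wE dotp_side_normal.
  have [t th wt] := body_side S3 Kw e.
  left; exists (h - t).
    rewrite subr_gt0 lt_neqAle (le_trans (ler_norm _) th) andbT.
    by apply: contra wV => /eqP th'; rewrite wt th' (vertex_sideS o r phi S3).
  by rewrite wt (vertex_sideS o r phi S3) side_pointB scalerN -scaleNr opprB.
have e : dotp (n_ k.+1) (w - o) = rho by rewrite -(normal_modn phi S3 lk) wE dotp_side_normal.
have [t th wt] := body_side S3 Kw e.
right; exists (t + h).
  rewrite -[h]opprK subr_gt0 lt_neqAle; move: (th); rewrite ler_norml => /andP[-> _].
  by rewrite andbT; apply: contra wV => /eqP th'; rewrite wt -th' (vertex_side o r phi S3).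
by rewrite wt (vertex_side o r phi S3) side_pointB opprK.
Qed.

(** Near the vertex the direction to a boundary point takes only these two values, and a cluster
    point of a finite set of values belongs to it. *)
Lemma vertex_half_tangent k u : half_tangent K (V k.+1) u -> u = - d_ k \/ u = d_ k.+1.
Proof.
move=> hu; apply: contrapT => /not_orP[/eqP u1 /eqP u2].
have := hu [set x | x = - d_ k \/ x = d_ k.+1] [set x | x <> - d_ k /\ x <> d_ k.+1].
case.
- rewrite /= /nbhs /= /within /=; apply: filterS (vertex_slack k) => w sl [bw /eqP wV].
  have dir (v : plane R) x : enorm v = 1 -> 0 < x -> (enorm (x *: v))^-1 *: (x *: v) = v.
    by move=> v1 x0; rewrite enormZ v1 mulr1 gtr0_norm // scalerA mulVf ?scale1r // lt0r_neq0.
  have [[x x0 E]|[x x0 E]] := near_vertex bw wV sl; rewrite E dir //.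
  + by left.
  + by rewrite enormN enorm_tangent.
  + by right.
  + exact: enorm_tangent.
- apply/enorm_nbhsP; exists (Num.min (enorm (- d_ k - u)) (enorm (d_ k.+1 - u))).
    by rewrite lt_min !enorm_gt0 // subr_eq0 eq_sym.
  move=> w; rewrite lt_min => /andP[w1 w2].
  by split => wE; [move: w1|move: w2]; rewrite wE ltxx.
by move=> w [[w1|w1] [w2 w3]].
Qed.

(** The orthogonal projection of [q] to the line of side [k]. *)
Definition foot q k : plane R := side k (dotp (d_ k) (q - o)).

Lemma foot_sub q k : foot q k - q = (rho - dotp (n_ k) (q - o)) *: n_ k.
Proof.
have -> : foot q k - q = (foot q k - o) - (q - o) by apply: plane_eq; rewrite !plE; ring.
rewrite [q - o in LHS](side_frame S phi k) /foot /side_point.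
by apply: plane_eq; rewrite !plE; ring.
Qed.

Lemma foot_small q k : enorm (q - o) < h -> `|dotp (d_ k) (q - o)| < h.
Proof.
by move=> qh; apply: le_lt_trans qh; apply: le_trans (cauchy_schwarz _ _) _;
  rewrite enorm_tangent mul1r.
Qed.

(** [q] may lie beyond the line of the side; even reference points closer to the center than [h] can
    do so in a triangle, where [h] exceeds the inradius. The two cases are the two senses of
    [supports]. *)
Lemma foot_supports q k : supports K (foot q k) (foot q k - q).
Proof.
rewrite foot_sub; have kz z : K z -> dotp (n_ k) (z - foot q k) <= 0.
  move=> Kz; have -> : z - foot q k = (z - o) - (foot q k - o).
    by apply: plane_eq; rewrite !plE; ring.
  by rewrite dotpBr dotp_side_normal subr_le0; exact: Kz.
case: (leP 0 (rho - dotp (n_ k) (q - o))) => c0; [right|left] => z /kz kz0; rewrite dotpZl.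
  exact: mulr_ge0_le0.
by apply: mulr_le0 => //; exact: ltW.
Qed.

(** The ends of the side lie in [K] on either side of the point, so the normal of a supporting line
    there is orthogonal to the side. *)
Lemma equilibrium_open_side q k t : `|t| < h -> equilibrium K q (side k t) ->
  t = dotp (d_ k) (q - o).
Proof.
move=> th [_ [<-|sup]]; first by rewrite dotp_side_point.
have hh : `|h| <= h by rewrite ger0_norm // ltW.
have K1 : K (side k h) by exact: side_point_body.
have K2 : K (side k (- h)) by apply: side_point_body => //; rewrite normrN.
have c0 : dotp (side k t - q) (d_ k) = 0.
  move: th; rewrite ltr_norml => /andP[t1 t2].
  have p1 : 0 < h - t by rewrite subr_gt0.
  have p2 : - h - t < 0 by rewrite subr_lt0.
  case: sup => sup; have := sup _ K1; have := sup _ K2; rewrite !side_pointB !dotpZr.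
    by rewrite (nmulr_rge0 _ p2) (pmulr_rge0 _ p1) => x1 x2; apply/le_anti; rewrite x1.
  by rewrite (nmulr_rle0 _ p2) (pmulr_rle0 _ p1) => x1 x2; apply/le_anti; rewrite x1 andbT.
apply/eqP; rewrite -subr_eq0 -{1}(dotp_side_point S o r phi k t) -dotpBr.
have -> : side k t - o - (q - o) = side k t - q by apply: plane_eq; rewrite !plE; ring.
by rewrite dotpC c0.
Qed.

Lemma vderiv_affine v w t : vderiv (fun s : R => v + s *: w) t w.
Proof.
have D : derivable (fun s : R => v + s *: w) t 1 by exact: derivable_affine.
by have := derivable_vderiv D; rewrite derive1_affine.
Qed.

(** Along the side the distance from [q] has second derivative [1 / enorm (foot q k - q)] at the
    foot; if [q] is the foot itself, it is stable by definition. *)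
Lemma stable_foot q k : enorm (q - o) < h -> stable K q (foot q k).
Proof.
move=> qh; have th := foot_small k qh; have lp := side_local_parametrization k th.
split; first by split; [apply: side_boundary; exact: ltW|right; exact: foot_supports].
split; first by do 2!eexists; exact: lp.
case: (pselect (foot q k = q)) => fq; [by left|right].
exists (fun x => foot q k + x *: d_ k), (h - `|dotp (d_ k) (q - o)|); split => //.
have cn : rho - dotp (n_ k) (q - o) != 0.
  apply/eqP => c0; apply: fq; apply/eqP; rewrite -subr_eq0 foot_sub c0 scale0r //.
have f0 : foot q k + 0 *: d_ k - q = (rho - dotp (n_ k) (q - o)) *: n_ k.
  by rewrite scale0r addr0 foot_sub.
rewrite (@distance_derive2E _ _ (fun=> d_ k) (fun=> 0) q _ _ 1 ltr01).
- rewrite f0 dotp0r addr0 dotp_side_tangent divr_gt0 // enorm_gt0 // scaler_eq0 (negbTE cn) /=.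
  by rewrite -enorm_eq0 enorm_normal oner_eq0.
- by move=> s; exact: vderiv_affine.
- by move=> s; exact: vderiv_cst.
- move=> s _; rewrite -subr_eq0 addrAC foot_sub; move: (rho - _) cn => c cn; apply/eqP => E.
  move/(congr1 (dotp (n_ k))): E; rewrite dotp0r dotpDr !dotpZr dotp_normal dotp_normal_tangent.
  by rewrite mulr1 mulr0 addr0 => /eqP; rewrite (negbTE cn).
- by rewrite f0 dotpZl dotp_normal_tangent mulr0.
Qed.

Lemma boundary_cases z : boundary K z ->
  (exists k, z = V k.+1) \/ (exists k t, `|t| < h /\ z = side k t).
Proof.
move=> /boundary_side[k [t [th ->]]]; case: (ltP `|t| h) => th'.
  by right; exists k, t.
have /eqP := le_anti (introT andP (conj th th')); rewrite eqr_norml (ltW h0) andbT.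
move=> /orP[] /eqP ->; left; first by exists k; rewrite (vertex_sideS o r phi S3).
exists (k + S.-1)%N; rewrite -addnS prednK // -(vertex_side o r phi S3).
by apply: vertex_modn => //; rewrite modnDr.
Qed.

Lemma acute_angle u v : 0 < dotp u v -> angle u v < pi / 2.
Proof.
move=> uv; have u0 : u != 0 by apply: contraTneq uv => ->; rewrite dotp0l ltxx.
have v0 : v != 0 by apply: contraTneq uv => ->; rewrite dotp0r ltxx.
have D0 : 0 < enorm u * enorm v by rewrite mulr_gt0 ?enorm_gt0.
have c0 : 0 < dotp u v / (enorm u * enorm v) by rewrite divr_gt0.
have c1 : dotp u v / (enorm u * enorm v) <= 1.
  by rewrite ler_pdivrMr // mul1r ler_normlW // cauchy_schwarz.
have cI : -1 <= dotp u v / (enorm u * enorm v) <= 1.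
  by rewrite c1 andbT (le_trans _ (ltW c0)) // oppr_le0 ler01.
have p0 := pi_gt0 R.
have mp : pi / 2 \in `[0, (pi : R)] by rewrite in_itv /=; apply/andP; split; lra.
rewrite /angle -(ltr_cos _ mp); last by rewrite in_itv /= acos_ge0 ?acos_lepi.
by rewrite cos_pihalf acosK // in_itv.
Qed.

(** At distance less than [h] from the center all feet fall inside their sides, and this is also
    what makes both angles at every vertex acute. *)
Lemma nondegenerate_near q z : enorm (q - o) < h -> equilibrium K q z ->
  Defs.nondegenerate K q z.
Proof.
move=> qh eqz; have [bz _] := eqz.
case: (boundary_cases bz) => [[k zE]|[k [t [th zE]]]]; last first.
  have tE := @equilibrium_open_side q k t th; rewrite -zE in tE.
  have zf : z = foot q k by rewrite zE (tE eqz).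
  have [_ [sz st]] := stable_foot k qh; left; rewrite zf; split => //.
  case: st => [->|[g [e [lp d2]]]]; [by left|right].
  by exists g, e; split => //; exact: lt0r_neq0.
right; rewrite zE; split; first exact: vertex_not_smooth.
have dk l : `|dotp (d_ l) (q - o)| < h by exact: foot_small.
have P1 : 0 < dotp (q - V k.+1) (- d_ k).
  rewrite (vertex_sideS o r phi S3) dotpNr -dotpNl opprB dotpC.
  have -> : side k h - q = (side k h - o) - (q - o) by apply: plane_eq; rewrite !plE; ring.
  by rewrite dotpBr dotp_side_point subr_gt0; have := dk k; rewrite ltr_norml => /andP[].
split; first by move=> E; move: P1; rewrite E subrr dotp0l ltxx.
move=> u /vertex_half_tangent[->|->]; apply: acute_angle => //.
rewrite (vertex_side o r phi S3) dotpC.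
have -> : q - side k.+1 (- h) = (q - o) - (side k.+1 (- h) - o).
  by apply: plane_eq; rewrite !plE; ring.
rewrite dotpBr dotp_side_point subr_gt0.
by have := dk k.+1; rewrite ltr_norml => /andP[].
Qed.

(** The stable points are the feet on the [S] sides; they are distinct because an inner point of one
    side lies on the line of no other. *)
Lemma has_stable_points_near q : enorm (q - o) < h -> has_stable_points K S q.
Proof.
move=> qh; split; first by move=> z; exact: nondegenerate_near.
have -> : [set z | stable K q z] = foot q @` `I_S.
  apply/seteqP; split => z; last by move=> [k _ <-]; exact: stable_foot.
  move=> [eqz [sz _]]; case: (boundary_cases eqz.1) => [[k zE]|[k [t [th zE]]]].
    by case: (@vertex_not_smooth k); rewrite -zE.
  exists (k %% S)%N; first by rewrite /= ltn_mod.
  have tE := @equilibrium_open_side q k t th; rewrite -zE in tE.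
  rewrite zE (tE eqz) /foot /side_point /side_tangent.
  by rewrite (@normal_modn _ _ phi S3 (k %% S) k) // modn_mod.
apply: inj_card_eq => k l; rewrite !inE /= => kS lS E.
apply/eqP; apply: contraT => kl.
have lk : (l != k %[mod S])%N by rewrite !modn_small // eq_sym.
have := open_side_strict o phi S3 r0 (foot_small k qh) lk.
by rewrite -/(foot q k) E dotp_side_normal ltxx.
Qed.

Lemma has_stable_points_center : has_stable_points K S o.
Proof. by apply: has_stable_points_near; rewrite subrr /enorm dotp0r sqrtr0. Qed.

(** Displaced by [h] along side 0, the reference point has the vertex as its foot on that side, so
    the angle with the half tangent [- d_ 0] is a right angle. *)
Lemma degenerate_vertex : equilibrium K (o + h *: d_ 0) (V 1) /\
  ~ Defs.nondegenerate K (o + h *: d_ 0) (V 1).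
Proof.
have E : V 1 - (o + h *: d_ 0) = rho *: n_ 0.
  by rewrite (vertex_sideS o r phi S3) /side_point; apply: plane_eq; rewrite !plE; ring.
have hh : `|h| <= h by rewrite ger0_norm // ltW.
split.
  split; first by rewrite (vertex_sideS o r phi S3); exact: side_boundary.
  right; right => z Kz; rewrite E dotpZl pmulr_rle0 // (vertex_sideS o r phi S3).
  have -> : z - side 0 h = (z - o) - (side 0 h - o) by apply: plane_eq; rewrite !plE; ring.
  by rewrite dotpBr dotp_side_normal subr_le0; exact: Kz.
move=> [[/vertex_not_smooth //]|[_ [_ ac]]].
have : half_tangent K (V 1) (- d_ 0).
  apply: half_tangent_limit => x x0.
  pose y := Num.min (x / 2) h.
  have y0 : 0 < y by rewrite lt_min divr_gt0.
  have yx : y < x.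
    by apply: (@le_lt_trans _ _ (x / 2)); rewrite ?ge_min ?lexx // ltr_pdivrMr // mulr2n mulrDr mulr1 ltrDl.
  have yh : y <= h by rewrite ge_min lexx orbT.
  have dE : side 0 (h - y) - V 1 = y *: - d_ 0.
    by rewrite (vertex_sideS o r phi S3) side_pointB addrAC subrr add0r scalerN scaleNr.
  have yn : enorm (y *: - d_ 0) = y by rewrite enormZ enormN enorm_tangent mulr1 gtr0_norm.
  exists (side 0 (h - y)); split.
  - by apply: side_boundary; rewrite ler_norml; apply/andP; split; lra.
  - by rewrite -subr_eq0 dE -enorm_eq0 yn lt0r_neq0.
  - by rewrite dE yn.
  - by rewrite dE yn scalerA mulVf ?lt0r_neq0 // scale1r subrr /enorm dotp0r sqrtr0.
move=> /ac; rewrite -opprB E /angle dotpNl dotpNr opprK dotpZl dotp_normal_tangent mulr0 mul0r.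
by rewrite acos0 ltxx.
Qed.

Lemma escape_radius_body : escape_radius K o = h.
Proof.
have [eqv nd] := degenerate_vertex.
have nE : enorm (o + h *: d_ 0 - o) = h.
  by rewrite addrAC subrr add0r enormZ enorm_tangent mulr1 gtr0_norm.
apply/le_anti/andP; split; first by rewrite -[leRHS]nE; exact: escape_radius_le eqv nd.
apply: lb_le_inf.
  by exists h; exists (o + h *: d_ 0) => // -[S' _ [nd' _]]; apply: nd; exact: nd'.
move=> _ [q /= qR <-]; rewrite leNgt; apply/negP => qh; apply: qR.
exists S; [exact: has_stable_points_center|exact: has_stable_points_near].
Qed.

End RegularPolygonTopology.

(** * Length of an arbitrary parametrization of the regular polygon *)

Section FiniteValues.
Variable R : realType.

Lemma avoid_values (s : seq R) (x y : R) : x < y -> exists2 z, x < z < y & z \notin s.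
Proof.
elim: s x y => [|c s IH] x y xy; first by exists ((x + y) / 2); rewrite ?midf_lt.
case: (boolP (x < c < y)) => [/andP[xc cy]|nc].
  have [z /andP[xz zc] zs] := IH x c xc; exists z; first by rewrite xz (lt_trans zc).
  by rewrite inE negb_or zs andbT lt_eqF.
have [z xz zs] := IH x y xy; exists z => //.
by rewrite inE negb_or zs andbT; apply: contra nc => /eqP <-.
Qed.

(** Two different values would, by the intermediate value theorem, give all values in between, which
    a finite list cannot exhaust. The negated list serves the decreasing case, treated through
    [- f]. *)
Lemma finite_values_constant (s : seq R) (f df : R -> R) (a b : R) : a <= b ->
  (forall x : R, a <= x <= b -> is_derive x 1 f (df x)) ->
  (forall x, a <= x <= b -> f x \in s) -> f a = f b.
Proof.
move=> ab fd fs.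
have key (g dg : R -> R) : (forall x : R, a <= x <= b -> is_derive x 1 g (dg x)) ->
    g a < g b -> exists2 c, a <= c <= b & g c \notin (s ++ map -%R s).
  move=> gd /(avoid_values (s ++ map -%R s))[z /andP[az zb] zs].
  have [c cab gc] := dd_ivt ab gd (introT andP (conj (ltW az) (ltW zb))).
  by exists c => //; rewrite gc.
case: (ltgtP (f a) (f b)) => // lt.
  have [c cab] := key f df fd lt; by rewrite mem_cat fs.
have [|c cab] := key (fun x => - f x) (fun x => - df x) (fun x xab => ddN (fd x xab)).
  by rewrite ltrN2.
by rewrite mem_cat negb_or map_f ?andbF // fs.
Qed.

(** Additivity of Lebesgue measure on the disjoint open intervals, all contained in [[0, M]]. *)
Lemma disjoint_lengths (N : nat) (al be : nat -> R) (M : R) : 0 <= M ->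
  (forall i, (i < N)%N -> [/\ 0 <= al i, al i <= be i & be i <= M]) ->
  (forall i j y, (i < j < N)%N -> al i < y < be i -> al j < y < be j -> False) ->
  \sum_(i < N) (be i - al i) <= M.
Proof.
move=> M0 bd dis; pose mu := @lebesgue_measure R.
pose F i : set R := if (i < N)%N then [set` `]al i, be i[] else set0.
have mF i : measurable (F i) by rewrite /F; case: ifP => _; [exact: measurable_itv|exact: measurable0].
have tF : trivIset setT F.
  apply/trivIsetP => i j _ _ ij; rewrite -subset0 /F => y [].
  case: ifP => // iN; case: ifP => // jN; rewrite /= !in_itv /= => yi yj.
  case: (ltngtP i j) ij => // [lt _|gt _].
    by apply: (dis i j y) => //; rewrite lt.
  by apply: (dis j i y) => //; rewrite gt.
have muF (i : 'I_N) : mu (F i) = (be i - al i)%:E.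
  have [_ ab _] := bd i (ltn_ord i).
  rewrite /F ltn_ord /mu lebesgue_measure_itv /= lte_fin; case: ltgtP ab => //.
  by move=> -> _; rewrite subrr.
rewrite -lee_fin -sumEFin; under eq_bigr do rewrite -muF.
rewrite -(measure_bigsetU mu mF tF).
have -> : M%:E = mu [set` `[0, M]].
  rewrite /mu lebesgue_measure_itv /= lte_fin; case: ltgtP M0 => // [_ _|<- _]; last by [].
  by rewrite oppr0 adde0.
apply: le_measure; rewrite ?inE.
- by apply: bigsetU_measurable => i _; exact: mF.
- exact: measurable_itv.
move=> y; rewrite -bigcup_mkord => -[i /= iN]; rewrite /F iN /= !in_itv /= => /andP[y1 y2].
have [a0 _ bM] := bd i iN.
by rewrite (le_trans a0 (ltW y1)) (le_trans (ltW y2)).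
Qed.

End FiniteValues.

Section RegularPolygonPerimeter.
Variable R : realType.
Implicit Types (u v w z q : plane R) (x y t : R).
Variables (S : nat) (o : plane R) (r phi : R).
Hypotheses (S3 : (2 < S)%N) (r0 : 0 < r).
Local Notation n_ := (side_normal S phi).
Local Notation d_ := (side_tangent S phi).
Local Notation rho := (inradius S r).
Local Notation h := (half_side S r).
Local Notation V := (regular_vertex S o r phi).
Local Notation K := (polygon_body S o r phi).
Local Notation side := (side_point S o r phi).
Variables (L : R) (P : periodic_boundary K L) (e : R).
Hypotheses (e2 : e ^+ 2 = 1)
  (eK : forall j t, in_piece P j t -> supporting P e j t).
Local Notation tau := (pb_tau P).
Local Notation vel := (pb_vel P).

Let h0 : 0 < h. Proof. exact: half_side_gt0. Qed.
Let rho0 : 0 < rho. Proof. exact: inradius_gt0. Qed.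
Let S0 : (0 < S)%N. Proof. exact: leq_trans S3. Qed.
Let cK : compact K. Proof. exact: body_compact. Qed.

(** Pigeonhole: [S + 1] parameters within one period give distinct points, and at most [S] of them
    are vertices. *)
Lemma nonvertex_between x y : 0 <= x -> x < y -> y <= x + 1 ->
  exists t, x < t < y /\ exists k s, `|s| < h /\ P t = side k s.
Proof.
move=> x0 xy y1; pose m : nat := S.+2.
have m0 : 0 < m%:R :> R by rewrite ltr0n.
pose pt (i : nat) := x + (y - x) * (i.+1%:R / m%:R).
have ptI (i : nat) : (i < S.+1)%N -> x < pt i < y.
  move=> iS; rewrite /pt ltrDl mulr_gt0 ?subr_gt0 ?divr_gt0 ?ltr0n //=.
  by rewrite -ltrBrDl gtr_pMr ?subr_gt0 // ltr_pdivrMr // mul1r ltr_nat.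
have pt_lt (i j : nat) : (i < j)%N -> pt i < pt j.
  by move=> ij; rewrite /pt ltrD2l ltr_pM2l ?subr_gt0 // ltr_pM2r ?invr_gt0 // ltr_nat.
apply: contrapT => no.
have H (i : 'I_S.+1) : exists k : 'I_S, P (pt i) = V k.
  have /andP[xi iy] := ptI i (ltn_ord i).
  have p0 : 0 <= pt i by rewrite (le_trans x0) // ltW.
  case: (boundary_cases S3 r0 (pb_boundary P p0)) => [[k E]|[k [s [sh E]]]].
    exists (Ordinal (ltn_pmod k.+1 S0)) => /=; rewrite E; apply: vertex_modn => //.
    by rewrite modn_mod.
  by case: no; exists (pt i); split; [rewrite xi|exists k, s].
have [f fE] := choice H.
have inj : injective f.
  have key (i j : 'I_S.+1) : (i < j)%N -> P (pt i) != P (pt j).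
    move=> lt; have /andP[xi _] := ptI i (ltn_ord i); have /andP[_ jy] := ptI j (ltn_ord j).
    apply: pb_inj; [by rewrite (le_trans x0) // ltW|exact: pt_lt|].
    by apply: lt_le_trans jy _; apply: le_trans y1 _; rewrite lerD2r ltW.
  move=> i j fij; have E : P (pt i) = P (pt j) by rewrite !fE fij.
  case: (ltngtP i j) => [/key|/key|/val_inj //]; by rewrite E eqxx.
by have := leq_card f inj; rewrite !card_ord ltnn.
Qed.

(** The tangent line supports [K] at an inner point of a side, so it is the line of that side; the
    position of the center relative to it fixes the direction. *)
Lemma nonvertex_velocity j t k s : in_piece P j t -> `|s| < h -> P t = side k s ->
  vel j t = (e * enorm (vel j t)) *: d_ k.
Proof.
move=> jt sh PE; have sup := eK jt; have v0 := vel_neq0 jt.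
have hh : `|h| <= h by rewrite ger0_norm // ltW.
have K1 : K (side k h) by exact: side_point_body.
have K2 : K (side k (- h)) by apply: side_point_body => //; rewrite normrN.
have cr : crossp (vel j t) (d_ k) = 0.
  move: sh; rewrite ltr_norml => /andP[t1 t2].
  have p1 : 0 < h - s by rewrite subr_gt0.
  have p2 : - h - s < 0 by rewrite subr_lt0.
  have := sup _ K1; have := sup _ K2; rewrite PE !side_pointB !crosspZr !(mulrCA e).
  rewrite (nmulr_rge0 _ p2) (pmulr_rge0 _ p1) => x1 x2.
  have /eqP : e * crossp (vel j t) (d_ k) = 0 by apply/le_anti; rewrite x1.
  by rewrite mulf_eq0 -sqrf_eq0 e2 oner_eq0 /= => /eqP.
have crd : crossp (d_ k) (vel j t) = 0 by rewrite crosspC cr oppr0.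
have := crossp_eq0_parallel (tangent_neq0 S phi k) crd.
rewrite dotp_side_tangent divr1; set c := dotp _ _ => vE.
have Ko : K o by apply: nbhs_singleton; exact: body_center_nbhs.
have c0 : 0 <= e * c.
  have := sup _ Ko; rewrite PE vE crosspZl mulrA.
  have -> : crossp (d_ k) (o - side k s) = rho.
    rewrite -(dotp_side_normal S o r phi k s) /side_tangent -dotp_rot /dotp /rot !plE /=; ring.
  by rewrite pmulr_lge0.
have -> : enorm (vel j t) = e * c.
  have en : `|e| = 1 by apply/eqP; rewrite -(@eqrXn2 _ 2) // real_normK ?num_real // e2 expr1n.
  by rewrite vE enormZ enorm_tangent mulr1 -[RHS]ger0_norm // normrM en mul1r.
by rewrite mulrA -expr2 e2 mul1r.
Qed.

(** This includes parameters of vertices: otherwise the velocity would be parallel to no side in a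
    whole neighbourhood, where some parameter gives an inner point of a side. *)
Lemma velocity_parallel j t : in_piece P j t -> exists k, crossp (vel j t) (d_ k) = 0.
Proof.
move=> jt; apply: contrapT => no.
have nz (k : 'I_S) : \forall x \near t, crossp (vel j x) (d_ k) != 0.
  have D := vderiv_crossp (velocity_vderiv P j t) (vderiv_cst (d_ k) t).
  have nE : crossp (vel j t) (d_ k) != 0 by apply/eqP => E; apply: no; exists k.
  have np : 0 < `|crossp (vel j t) (d_ k)| by rewrite normr_gt0.
  have [x x0 hx] := dd_cont D np.
  apply/nbhs_ballP; exists x => //= s; rewrite /ball /= distrC => /hx.
  by apply: contraTneq => ->; rewrite sub0r normrN ltxx.
have /nbhs_ballP[x /= x0 hx] := @filter_forall _ _ _ _ (nbhs_filter t) nz.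
have /andP[jt1 jt2] := jt.
have T01 : tau j.+1 <= tau j + 1.
  by rewrite -pb_tauN; apply: tau_le; rewrite -addn1 leq_add2l pb_num_gt0.
have lt := pb_tau_lt P j.
pose y1 := Num.max (tau j) (t - x); pose y2 := Num.min (tau j.+1) (t + x).
have y12 : y1 < y2.
  rewrite gt_max !lt_min lt /=; apply/andP; split; first by rewrite (le_lt_trans jt1) // ltrDl.
  by rewrite ltrBlDr (le_lt_trans jt2) ?ltrDl //= ltrBlDr -addrA ltrDl addr_gt0.
have y10 : 0 <= y1 by rewrite le_max tau_ge0.
have y21 : y2 <= y1 + 1.
  by rewrite ge_min (le_trans T01) // lerD2r le_max lexx.
have [s [/andP[ys sy] [k [c [ch PE]]]]] := nonvertex_between y10 y12 y21.
move: ys sy; rewrite gt_max lt_min => /andP[s1 s2] /andP[s3 s4].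
have js : in_piece P j s by rewrite /in_piece !ltW.
have := nonvertex_velocity js ch PE => vE.
have bs : ball t x s by rewrite /ball /= ltr_distlC; apply/andP; split.
have := hx s bs (Ordinal (ltn_pmod k S0)); rewrite /= => /negP; apply.
have -> : d_ (k %% S) = d_ k.
  by rewrite /side_tangent (@normal_modn _ _ phi S3 (k %% S) k) // modn_mod.
by rewrite vE crosspZl crosspp mulr0.
Qed.

Lemma dd_zero_cst (f : R -> R) x y : x <= y ->
  (forall t : R, x <= t <= y -> is_derive t 1 f 0) -> f x = f y.
Proof.
rewrite le_eqVlt => /predU1P[->//|xy] fd.
have [c _] := dd_mvt xy fd.
by rewrite mul0r => /eqP; rewrite subr_eq0 => /eqP.
Qed.

Lemma piece_zero_cst (f : R -> R) j :
  (forall t : R, in_piece P j t -> is_derive t 1 f 0) ->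
  forall s t, in_piece P j s -> in_piece P j t -> f s = f t.
Proof.
move=> fd s t js jt; have key x y : in_piece P j x -> in_piece P j y -> x <= y -> f x = f y.
  move=> /andP[x1 _] /andP[_ y2] xy; apply: dd_zero_cst xy _ => z /andP[z1 z2].
  by apply: fd; rewrite /in_piece (le_trans x1) // (le_trans z2).
by case: (leP s t) => [|/ltW] st; [exact: key|apply/esym; exact: key].
Qed.

(* The unit tangent of a piece is continuous and takes finitely many values. *)
Lemma piece_side j : exists k : 'I_S, forall t, in_piece P j t ->
  vel j t = (e * enorm (vel j t)) *: d_ k /\ dotp (n_ k) (P t - o) = rho.
Proof.
have T01 : tau j.+1 <= tau j + 1.
  by rewrite -pb_tauN; apply: tau_le; rewrite -addn1 leq_add2l pb_num_gt0.
have [t1 [/andP[ta tb] [k' [s [sh PE]]]]] := nonvertex_between (tau_ge0 P j) (pb_tau_lt P j) T01.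
pose k := Ordinal (ltn_pmod k' S0).
have kk : (k' = k %[mod S])%N by rewrite /= modn_mod.
have nk : n_ k' = n_ k by exact: normal_modn.
have dk : d_ k' = d_ k by rewrite /side_tangent nk.
have j1 : in_piece P j t1 by rewrite /in_piece !ltW.
have v1 := nonvertex_velocity j1 sh PE; rewrite dk in v1.
have w0 t : in_piece P j t -> enorm (vel j t) != 0.
  by move=> jt; rewrite lt0r_neq0 // enorm_gt0 // vel_neq0.
(* The cosine of the angle between velocity and side [k]. The velocity is always parallel to some
   side, so only finitely many values are possible. *)
pose f t := dotp (d_ k) (vel j t) * (enorm (vel j t))^-1.
pose vals := [seq dotp (d_ k) (d_ l) | l <- iota 0 S].
have fv t : in_piece P j t -> f t \in vals ++ map -%R vals.
  move=> jt; have [l cr] := velocity_parallel jt.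
  have crd : crossp (d_ l) (vel j t) = 0 by rewrite crosspC cr oppr0.
  have := crossp_eq0_parallel (tangent_neq0 S phi l) crd.
  rewrite dotp_side_tangent divr1; set c := dotp _ _ => vE.
  have lv : dotp (d_ k) (d_ l) \in vals.
    apply/mapP; exists (l %% S)%N; first by rewrite mem_iota /= add0n ltn_mod.
    by rewrite /side_tangent (@normal_modn _ _ phi S3 (l %% S) l) // modn_mod.
  have := w0 t jt; rewrite /f vE dotpZr enormZ enorm_tangent mulr1 normr_eq0 => c0.
  have -> : c * dotp (d_ k) (d_ l) * `|c|^-1 = c / `|c| * dotp (d_ k) (d_ l) by rewrite mulrAC.
  rewrite mem_cat; case: (ltgtP c 0) c0 => // cs _.
    by rewrite ltr0_norm // invrN mulrN divff ?lt_eqF // mulN1r map_f ?orbT.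
  by rewrite gtr0_norm // divff ?gt_eqF // mul1r lv.
have fd t : in_piece P j t -> exists d, is_derive t 1 f d.
  move=> jt; have sp : speed P j t != 0 by exact: w0.
  have D := ddM (vderiv_dotpl (d_ k) (velocity_vderiv P j t)) (ddV sp (dd_speed jt)).
  by eexists; exact: D.
have [df fdf] : exists df : R -> R, forall t : R, in_piece P j t -> is_derive t 1 f (df t).
  have H t : exists d, in_piece P j t -> is_derive t 1 f d.
    case: (pselect (in_piece P j t)) => [/fd[d fdd]|nj]; first by exists d.
    by exists 0 => /nj.
  by have [df dfP] := choice H; exists df.
have key x y : in_piece P j x -> in_piece P j y -> x <= y -> f x = f y.
  move=> /andP[x1 _] /andP[_ y2] xy.
  have sub (t : R) : x <= t <= y -> in_piece P j t.
    by move=> /andP[z1 z2]; rewrite /in_piece (le_trans x1) // (le_trans z2).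
  by apply: (finite_values_constant (s := vals ++ map -%R vals) (df := df) xy) => z /sub zj;
    [exact: fdf|exact: fv].
have fc t : in_piece P j t -> f t = e.
  have f1 : f t1 = e.
    by rewrite /f {1}v1 dotpZr dotp_side_tangent mulr1 mulfK // w0.
  move=> jt; rewrite -f1; case: (leP t t1) => [|/ltW] tt; [exact: key|apply/esym; exact: key].
(* A cosine equal to [e], which is 1 or -1, is the equality case of the Cauchy-Schwarz
   inequality. *)
have vE t : in_piece P j t -> vel j t = (e * enorm (vel j t)) *: d_ k.
  move=> jt; have := fc t jt; rewrite /f => /(canRL (mulfVK (w0 t jt))) E.
  apply/eqP; rewrite -subr_eq0 -dotp_eq0 dotpBl !dotpBr !dotpZl !dotpZr.
  rewrite dotp_side_tangent (dotpC (vel j t) (d_ k)) E -enorm_sqr.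
  apply/eqP; transitivity ((1 - e ^+ 2) * enorm (vel j t) ^+ 2); first by ring.
  by rewrite e2 subrr mul0r.
exists k => t jt; split; first exact: vE.
rewrite -(dotp_side_normal S o r phi k' s) -PE nk (pb_curveE jt) (pb_curveE j1).
apply: (piece_zero_cst (j := j) (f := fun t => dotp (n_ k) (pb_piece P j t - o))) => // x jx.
apply: dd_eq (vderiv_dotpl (n_ k) (vderivB_cst o (piece_vderiv P j x))) _.
by rewrite vE // dotpZr dotp_normal_tangent mulr0.
Qed.

(* The pieces are disjoint segments on the sides; unrolling the sides onto the
   interval [0, 2 S h] makes them disjoint intervals. *)
Lemma polygon_length_le : L <= S%:R * (2 * h).
Proof.
have [m mP] := choice piece_side.
pose X j t := e * dotp (d_ (m j)) (P t - o).
have lenX j s t : in_piece P j s -> in_piece P j t ->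
    pb_len P t - pb_len P s = X j t - X j s.
  move=> js jt; rewrite (pb_lenE js jt) /X (pb_curveE js) (pb_curveE jt).
  pose f (x : R) := pb_prim P j x - e * dotp (d_ (m j)) (pb_piece P j x - o).
  have : f s = f t.
    apply: (piece_zero_cst (j := j)) => // x jx.
    apply: dd_eq (ddB (pb_prim_derive jx) (ddM (ddc e x)
      (vderiv_dotpl (d_ (m j)) (vderivB_cst o (piece_vderiv P j x))))) _.
    rewrite mul0r add0r {2}(mP j x jx).1 dotpZr dotp_side_tangent mulr1.
    by rewrite mulrA -expr2 e2 mul1r subrr.
  rewrite /f; move: (pb_prim P j s) (pb_prim P j t) (e * _) (e * _) => a b c d E; lra.
have PX j t : in_piece P j t -> P t = side (m j) (e * X j t).
  by move=> jt; rewrite [LHS](side_pointE (mP j t jt).2) /X mulrA -expr2 e2 mul1r.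
have en : `|e| = 1 by apply/eqP; rewrite -(@eqrXn2 _ 2) // real_normK ?num_real // e2 expr1n.
have Xb j t : in_piece P j t -> `|X j t| <= h.
  move=> jt; have Kt := curve_boundary P cK (in_piece_ge0 jt).
  have [y yh E] := body_side S3 Kt (mP j t jt).2.
  by rewrite /X E dotp_side_point normrM en mul1r.
(* The unrolled position: side [m] occupies the interval from [2 h m] to [2 h (m + 1)]. *)
pose Y j t := h + 2 * h * (m j)%:R + X j t.
have X_le j s t : in_piece P j s -> in_piece P j t -> s <= t -> X j s <= X j t.
  move=> js jt st; rewrite -subr_ge0 -(lenX j s t js jt) subr_ge0; exact: (len_le P (in_piece_ge0 js) st).
have LE : L = \sum_(j < pb_num P) (Y j (tau j.+1) - Y j (tau j)).
  transitivity (pb_len P (tau (pb_num P)) - pb_len P (tau 0)).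
    by rewrite -[pb_num P]add0n pb_tauN pb_tau0 pb_len_per // addrAC subrr add0r.
  rewrite -(@telescope_sumr _ 0 (pb_num P) (fun j => pb_len P (tau j))) // big_mkord; apply: eq_bigr => j _.
  rewrite (lenX j _ _ (in_piece_l P j) (in_piece_r P j)) /Y.
  by move: (X j _) (X j _) => *; ring.
rewrite [leLHS]LE; apply: (@disjoint_lengths R (pb_num P) (fun j => Y j (tau j)) (fun j => Y j (tau j.+1))).
- by rewrite mulr_ge0 // mulr_ge0 // ltW.
- move=> j jN; have := Xb _ _ (in_piece_l P j); have := Xb _ _ (in_piece_r P j).
  have := X_le _ _ _ (in_piece_l P j) (in_piece_r P j) (ltW (pb_tau_lt P j)).
  have mS : (m j)%:R + 1 <= S%:R :> R by rewrite natr1 ler_nat.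
  have m0 : 0 <= (m j)%:R :> R by [].
  have hp : 0 <= 2 * h by rewrite mulr_ge0 // ltW.
  have q1 : 0 <= 2 * h * (m j)%:R by rewrite mulr_ge0.
  have q2 : 2 * h * (m j)%:R + 2 * h <= S%:R * (2 * h).
    by rewrite (mulrC S%:R) -[X in _ + X]mulr1 -mulrDr ler_wpM2l.
  rewrite !ler_norml /Y; move: (X j (tau j)) (X j (tau j.+1)) q1 q2.
  move: (2 * h * _) (S%:R * _) => c d a b q1 q2.
  by move=> ab /andP[b1 b2] /andP[a1 a2]; split; lra.
(* A common unrolled position lies strictly inside the interval of one side; both pieces would pass
   through the corresponding boundary point, at parameters less than a period apart. *)
move=> i j y /andP[ij jN] /andP[i1 i2] /andP[j1 j2].
have bnd k : Y k (tau k) < y < Y k (tau k.+1) -> 2 * h * (m k)%:R < y < 2 * h * ((m k)%:R + 1).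
  have := Xb _ _ (in_piece_l P k); have := Xb _ _ (in_piece_r P k).
  rewrite !ler_norml /Y mulrDr mulr1; move: (X k _) (X k _) (2 * h * _) => a b c.
  by move=> /andP[b1 b2] /andP[a1 a2] /andP[y1 y2]; apply/andP; split; lra.
have ijm : m i = m j.
  have /andP[a1 a2] := bnd i (introT andP (conj i1 i2)).
  have /andP[b1 b2] := bnd j (introT andP (conj j1 j2)).
  have h2 : 0 < 2 * h by rewrite mulr_gt0.
  have := lt_trans a1 b2; have := lt_trans b1 a2; rewrite !ltr_pM2l // !natr1 !ltr_nat !ltnS.
  by move=> l1 l2; apply/val_inj/anti_leq; rewrite l1 l2.
have hit k : Y k (tau k) < y < Y k (tau k.+1) ->
    exists t, [/\ tau k <= t, t < tau k.+1 & P t = side (m k) (e * (y - (h + 2 * h * (m k)%:R)))].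
  move=> /andP[y1 y2].
  have D (t : R) : tau k <= t <= tau k.+1 -> is_derive t 1
      (fun t : R => e * dotp (d_ (m k)) (pb_piece P k t - o))
      (0 * dotp (d_ (m k)) (pb_piece P k t - o) + e * dotp (d_ (m k)) (vel k t)).
    by move=> _; exact: (ddM (ddc e t) (vderiv_dotpl (d_ (m k)) (vderivB_cst o (piece_vderiv P k t)))).
  have XE t : in_piece P k t -> e * dotp (d_ (m k)) (pb_piece P k t - o) = X k t.
    by move=> kt; rewrite /X (pb_curveE kt).
  have [|t kt tE] := dd_ivt (y := y - (h + 2 * h * (m k)%:R)) (ltW (pb_tau_lt P k)) D.
    rewrite !XE; [|exact: in_piece_r|exact: in_piece_l].
    by rewrite lerBrDl lerBlDl !ltW.
  rewrite XE // in tE; exists t; case/andP: (kt) => k1 k2; split => //.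
    rewrite lt_neqAle k2 andbT; apply/eqP => tE'; move: y2.
    by rewrite /Y -tE' tE addrC subrK ltxx.
  by rewrite (PX k t kt) tE.
have [s [s1 s2 sE]] := hit i (introT andP (conj i1 i2)).
have [t [t1 t2 tE]] := hit j (introT andP (conj j1 j2)).
have st : s < t by apply: lt_le_trans s2 _; apply: le_trans t1; exact: tau_le.
have tN : t < s + 1.
  apply: lt_le_trans t2 _; apply: (@le_trans _ _ 1); last by rewrite lerDr (le_trans (tau_ge0 P i)).
  have -> : 1 = tau (pb_num P) :> R by rewrite -[pb_num P]add0n pb_tauN pb_tau0 add0r.
  exact: tau_le.
have := pb_inj P (le_trans (tau_ge0 P i) s1) st tN.
by rewrite sE tE ijm eqxx.
Qed.

End RegularPolygonPerimeter.

(** * A parametrization of the boundary of the regular polygon *)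

Section BoundaryParametrization.
Variable R : realType.
Implicit Types (u v w z q : plane R) (x y t : R).
Variables (S : nat) (o : plane R) (r phi : R).
Hypotheses (S3 : (2 < S)%N) (r0 : 0 < r).
Local Notation n_ := (side_normal S phi).
Local Notation d_ := (side_tangent S phi).
Local Notation rho := (inradius S r).
Local Notation h := (half_side S r).
Local Notation V := (regular_vertex S o r phi).
Local Notation K := (polygon_body S o r phi).
Local Notation side := (side_point S o r phi).

Let h0 : 0 < h. Proof. exact: half_side_gt0. Qed.
Let S0 : (0 < S)%N. Proof. exact: leq_trans S3. Qed.
Let SR : 0 < S%:R :> R. Proof. by rewrite ltr0n. Qed.

(** Side [k] is run through while [S t] goes from [k] to [k + 1]. At [t = 1] the integer part is
    [S], and side [S] is side 0 again. *)
Definition polygon_curve t : plane R :=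
  side (Num.truncn (S%:R * t)) (2 * h * (S%:R * t - (Num.truncn (S%:R * t))%:R) - h).

Lemma polygon_curveE k t : k%:R <= S%:R * t < k.+1%:R ->
  polygon_curve t = side k (2 * h * (S%:R * t - k%:R) - h).
Proof. by move=> kt; rewrite /polygon_curve (truncn_def kt). Qed.

Lemma polygon_curve_piece k t : k%:R <= S%:R * t <= k.+1%:R ->
  polygon_curve t = side k (2 * h * (S%:R * t - k%:R) - h).
Proof.
move=> /andP[k1]; rewrite le_eqVlt => /predU1P[kt|kt]; last by apply: polygon_curveE; rewrite k1.
have -> : polygon_curve t = V k.+1.
  have kt1 : k.+1%:R <= S%:R * t < k.+2%:R by rewrite kt lexx ltr_nat /=.
  by rewrite (polygon_curveE kt1) kt subrr mulr0 sub0r (vertex_side o r phi S3).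
rewrite kt (vertex_sideS o r phi S3) -natr1; congr (side _ _); ring.
Qed.

Lemma half_open_side k t : k%:R <= S%:R * t < k.+1%:R ->
  - h <= 2 * h * (S%:R * t - k%:R) - h < h.
Proof.
rewrite -natr1 => /andP[k1 k2].
have : 0 <= S%:R * t - k%:R by rewrite subr_ge0.
have : S%:R * t - k%:R < 1 by rewrite ltrBlDl.
move: (S%:R * t - k%:R) => x x1 x0.
have hp : 0 < 2 * h by rewrite mulr_gt0.
have y0 : 0 <= 2 * h * x by rewrite mulr_ge0 // ltW.
have y1 : 2 * h * x < 2 * h by rewrite gtr_pMr.
by move: (2 * h * x) y0 y1 => y y0 y1; apply/andP; split; lra.
Qed.

Lemma half_open_boundary z : boundary K z ->
  exists k s, [/\ (k < S)%N, - h <= s < h & z = side k s].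
Proof.
have red k s : - h <= s < h -> exists k' s', [/\ (k' < S)%N, - h <= s' < h & side k s = side k' s'].
  move=> sh; exists (k %% S)%N, s; rewrite ltn_mod S0; split => //.
  by rewrite /side_point /side_tangent (@normal_modn _ _ phi S3 (k %% S) k) // modn_mod.
move=> /(boundary_side S3 r0)[k [s [sh ->]]].
move: sh; rewrite ler_norml => /andP[s1]; rewrite le_eqVlt => /predU1P[->|s2]; last first.
  by apply: red; rewrite s1.
rewrite -(vertex_sideS o r phi S3) (vertex_side o r phi S3); apply: red.
by rewrite lexx gtrN.
Qed.

(** Each vertex is counted with the side that starts there. A point on two different half-open sides
    would make each of them the predecessor of the other. *)
Lemma half_open_side_inj k l s t : (k < S)%N -> (l < S)%N ->
  - h <= s < h -> - h <= t < h -> side k s = side l t -> k = l /\ s = t.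
Proof.
move=> kS lS sh th E; case: (eqVneq k l) => [kl|kl].
  by split => //; rewrite -(dotp_side_point S o r phi k s) E kl dotp_side_point.
have end_ k' l' s' t' : (k' < S)%N -> (l' < S)%N -> k' != l' -> - h <= s' < h ->
    side k' s' = side l' t' -> (l'.+1 = k' %[mod S])%N.
  move=> kS' lS' kl' /andP[s1 s2] E'.
  have lk : (l' != k' %[mod S])%N by rewrite !modn_small // eq_sym.
  have e1 : dotp (n_ l') (side k' s' - o) = rho by rewrite E' dotp_side_normal.
  move: s1; rewrite le_eqVlt => /predU1P[sE|s1]; last first.
    have sh' : `|s'| < h by rewrite ltr_norml s1.
    by have := open_side_strict o phi S3 r0 sh' lk; rewrite e1 ltxx.
  apply/eqP; apply: contraT => l1k.
  have [_ /(_ lk l1k)] := normal_vertex o phi S3 r0 k' l'.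
  by rewrite (vertex_side o r phi S3) sE e1 ltxx.
have a1 := end_ _ _ _ _ kS lS kl sh E.
rewrite eq_sym in kl; have a2 := end_ _ _ _ _ lS kS kl th (esym E).
by case: (neighbour_sides S3 (esym a1) _); rewrite -a2.
Qed.

Lemma polygon_parametrization : boundary_parametrization K polygon_curve.
Proof.
have c0 : polygon_curve 0 = V 0.
  have c0' : 0%:R <= S%:R * (0 : R) < 1%:R by rewrite mulr0 lexx ltr01.
  by rewrite (polygon_curveE c0') mulr0 subrr mulr0 sub0r (vertex_side o r phi S3).
have c1 : polygon_curve 1 = V 0.
  have c1' : S%:R <= S%:R * (1 : R) < S.+1%:R by rewrite mulr1 lexx ltr_nat /=.
  rewrite (polygon_curveE c1') mulr1 subrr mulr0 sub0r -(vertex_side o r phi S3).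
  by apply: vertex_modn => //; rewrite modnn mod0n.
have cell t : 0 <= t < 1 -> exists2 k, (k < S)%N & k%:R <= S%:R * t < k.+1%:R.
  move=> /andP[t0 t1]; have st : 0 <= S%:R * t by rewrite mulr_ge0 // ltW.
  have tI := truncn_itv st; exists (Num.truncn (S%:R * t)) => //.
  case/andP: tI => tI _; rewrite -(ltr_nat R); apply: le_lt_trans tI _.
  by rewrite gtr_pMr.
have cV k : boundary K (V k).
  by rewrite (vertex_side o r phi S3); apply: side_boundary; rewrite // normrN ger0_norm // ltW.
split.
- apply/seteqP; split => z.
    move=> [t]; rewrite /= in_itv /= => /andP[t0]; rewrite le_eqVlt => /predU1P[->|t1] <-.
      by rewrite c1.
    have [|k kS kt] := cell t; first by rewrite t0.
    rewrite (polygon_curveE kt); apply: side_boundary => //.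
    by have /andP[a1 a2] := half_open_side kt; rewrite ler_norml a1 ltW.
  move=> /half_open_boundary[k [s [kS /andP[s1 s2] ->]]].
  pose x := (s + h) / (2 * h).
  have hp : 0 < 2 * h by rewrite mulr_gt0.
  have sp : 0 <= s + h by lra.
  have x0 : 0 <= x by rewrite divr_ge0 // ltW.
  have x1 : x < 1 by rewrite ltr_pdivrMr //; lra.
  have SE : S%:R * ((k%:R + x) / S%:R) = k%:R + x by rewrite mulrC divfK // lt0r_neq0.
  exists ((k%:R + x) / S%:R).
    rewrite /= in_itv /= divr_ge0 ?addr_ge0 ?(ltW SR) //= ler_pdivrMr // mul1r.
    by apply: (@le_trans _ _ k.+1%:R); rewrite ?ler_nat // -natr1 lerD2l ltW.
  rewrite (@polygon_curveE k) SE; last by rewrite lerDl x0 -natr1 ltrD2l.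
  congr (side k _); rewrite /x; have hn := lt0r_neq0 h0.
  by field.
- by rewrite c0 c1.
- move=> s t; rewrite !in_itv /= => /cell[k kS ks] /cell[l lS lt].
  rewrite (polygon_curveE ks) (polygon_curveE lt) => E.
  have [kl st] := half_open_side_inj kS lS (half_open_side ks) (half_open_side lt) E.
  move: st; rewrite kl => /addIr /(mulfI _) st.
  have hn : 2 * h != 0 by rewrite mulf_neq0 ?pnatr_eq0 // lt0r_neq0.
  by apply: (mulfI (lt0r_neq0 SR)); apply: (addIr (- l%:R)); exact: st.
exists S, (fun i => i%:R / S%:R); split.
- by rewrite mul0r.
- by rewrite divff ?lt0r_neq0.
- by move=> i _; rewrite ltr_pM2r ?invr_gt0 // ltr_nat.
move=> i iS; pose w := (2 * h * S%:R) *: d_ i.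
exists (fun t => (V i - (2 * h * i%:R) *: d_ i) + t *: w); split.
- exact: smooth_affine.
- move=> t _; rewrite derive1_affine /w scaler_eq0 (negbTE (tangent_neq0 S phi i)) orbF.
  by rewrite lt0r_neq0 // mulr_gt0 // mulr_gt0.
move=> t; rewrite in_itv /= ler_pdivrMr // ler_pdivlMr // (mulrC t) => it.
rewrite (polygon_curve_piece it) (vertex_side o r phi S3) /w /side_point.
by apply: plane_eq; rewrite !plE; ring.
Qed.

End BoundaryParametrization.

(** * The extremal problem *)

Section Extremal.
Variable R : realType.
Implicit Types (K : set (plane R)) (p o : plane R).

(** Stated for any one parametrization, because the perimeter is known only to be the length of some
    parametrization. *)
Lemma robustness_bound K c p (S : nat) : (0 < S)%N -> convex_body K ->
  boundary_parametrization K c -> strictly_inside K p -> has_stable_points K S p ->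
  [/\ 0 < arc_length c, (2 * S%:R) * escape_radius K p <= arc_length c &
      arc_length c = (2 * S%:R) * escape_radius K p -> regular_polygon S K].
Proof.
move=> S0 [cK vK iK] /periodic_boundary_exists[P] pK hs.
have [e e2 eK] := orientation P cK vK pK.
have [sig [sig0 sig_lt sigS sigP]] := stable_sequence P S0 hs.
split.
- have l01 : 0 < 0 + 1 :> R by rewrite add0r.
  by have := len_lt P (lexx 0) l01; rewrite pb_len_per // ltrDl.
- exact (perimeter_ge cK vK pK e2 eK sig0 sig_lt sigS sigP).
move=> LE.
have [v [l [r vP]]] := corners cK vK pK e2 eK S0 sig0 sig_lt sigS sigP LE.
have r0 := r0_gt0 sig0 vP.
have [h _ hc] := corner_coord cK pK e2 eK vP.
have Du i := side_unit vP i.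
have cS : corner P v S = corner P v 0%N by exact: (corner_period sig0 sigS vP 0).
have [rho [phi [rho0 [f [bf fE]]]]] := regular_of_recurrence S0 (lt0r_neq0 r0) Du hc cS (corner_inj sig0 sigS vP).
exists p, rho, phi; split => //.
rewrite (body_hull cK vK pK e2 eK S0 sig0 sig_lt sigS sigP LE vP).
exact: polygon_hull_reindex bf fE.
Qed.

(** [get] picks an unspecified element of the set of lengths, which is nonempty here. *)
Lemma perimeter_arc_length K : (exists c, boundary_parametrization K c) ->
  exists2 c, boundary_parametrization K c & perimeter K = arc_length c.
Proof.
move=> [c cP]; rewrite /perimeter.
have : [set l : R | exists2 c, boundary_parametrization K c & l = arc_length c] !=set0.
  by exists (arc_length c), c.
by move=> /getPex.
Qed.

Lemma internal_robustness_le K (S : nat) : (0 < S)%N -> stable_class S K ->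
  internal_robustness K (centroid K) <= 1 / (2 * S%:R) /\
  (internal_robustness K (centroid K) = 1 / (2 * S%:R) -> regular_polygon S K).
Proof.
move=> S0 [[bK ex] hs]; have [cK vK iK] := bK.
have [c cP pE] := perimeter_arc_length ex.
have pK := centroid_strictly_inside cK iK.
have [L0 Lge Leq] := robustness_bound S0 bK cP pK hs.
have S2 : 0 < 2 * S%:R :> R by rewrite mulr_gt0 ?ltr0n.
rewrite /internal_robustness pE -/(escape_radius K (centroid K)).
split; first by rewrite ler_pdivrMr // mul1r ler_pdivlMl.
move=> /(canRL (divfK (lt0r_neq0 L0))) E; apply: Leq.
by rewrite E mulrA mulrA mulr1 divff ?mul1r // lt0r_neq0.
Qed.

Lemma regular_polygon_robustness K (S : nat) : (3 <= S)%N -> regular_polygon S K ->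
  stable_class S K /\ internal_robustness K (centroid K) = 1 / (2 * S%:R).
Proof.
move=> S3 [ o [r [phi [r0 ->]]]].
have S0 : (0 < S)%N by exact: leq_trans S3.
rewrite -[polygon_hull _]/(polygon_hull (fun k : 'I_S => regular_vertex S o r phi k)).
rewrite (polygon_hullE o phi S3 r0); set K' := polygon_body _ _ _ _.
have cE : centroid K' = o by exact: centroid_body.
have bK : convex_body K' by exact: body_convex_body.
have [cK vK iK] := bK.
have ex : exists c, boundary_parametrization K' c.
  by exists (polygon_curve S o r phi); exact: polygon_parametrization.
have hs : has_stable_points K' S o by exact: has_stable_points_center.
have pK : strictly_inside K' o by rewrite -cE; exact: centroid_strictly_inside.
split; first by split; [exact: conj bK ex|rewrite cE; exact: hs].
have [c cP pE] := perimeter_arc_length ex.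
have [L0 le _] := robustness_bound S0 bK cP pK hs.
have eE : escape_radius K' o = half_side S r by exact: escape_radius_body.
have h0 : 0 < half_side S r by exact: half_side_gt0.
have [P] := periodic_boundary_exists cP.
have [e e2 eK] := orientation P cK vK pK.
(* The lower bound is the general inequality for a body with [S] stable points and escape radius
   [half_side S r]; the upper bound comes from unrolling the sides. *)
have LE : arc_length c = S%:R * (2 * half_side S r).
  apply/le_anti; rewrite (polygon_length_le S3 r0 e2 eK) /=.
  by move: le; rewrite eE -mulrA mulrCA.
rewrite /internal_robustness cE pE -/(escape_radius K' o) eE LE.
have := lt0r_neq0 h0; move: (half_side S r) => x xn.
have Sn : S%:R != 0 :> R by rewrite pnatr_eq0 -lt0n.
by field; rewrite Sn xn.
Qed.

End Extremal.

Theorem corollary3 (R : realType) (S : nat) (hS : (3 <= S)%N) :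
  max_internal_robustness R S = 1 / (2 * S%:R) /\
  (forall K : set (plane R),
     (stable_class S K /\
      internal_robustness K (centroid K) = max_internal_robustness R S) <->
     regular_polygon S K).
Proof.
have S0 : (0 < S)%N by exact: leq_trans hS.
(* A single regular polygon makes the set of values nonempty and shows that the bound is
   attained. *)
pose K0 : set (plane R) := polygon_hull (fun k : 'I_S => regular_vertex S 0 1 0 k).
have [K0S K0E] : stable_class S K0 /\ internal_robustness K0 (centroid K0) = 1 / (2 * S%:R).
  by apply: regular_polygon_robustness => //; exists 0, 1, 0; split.
have mE : max_internal_robustness R S = 1 / (2 * S%:R).
  have ub : ubound [set internal_robustness K (centroid K) | K in @stable_class R S] (1 / (2 * S%:R)).
    by move=> _ [K KS <-]; have [] := internal_robustness_le S0 KS.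
  apply/le_anti/andP; split; first by apply: ge_sup => //; exists (1 / (2 * S%:R)); exists K0.
  by apply: ub_le_sup; [exists (1 / (2 * S%:R))|exists K0].
split; [exact: mE|move=> K; rewrite mE].
split=> [[KS]|]; last exact: regular_polygon_robustness.
exact: (internal_robustness_le S0 KS).2.
Qed.
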